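(* The maps $L:\mathcal D\to\mathcal H$ and $M:\mathcal H\to\mathcal D$ (the restriction to $\mathcal H$ of $M:\mathcal F\to\mathcal D$) are invertible. We have $$L\circ M=\Pi\ \text{ on }\mathcal F,\qquad M\circ L=\mathrm{id}_{\mathcal D},$$ where $\Pi:\mathcal F\to\mathcal H$ is a projection which associates to any element $X\in\mathcal F$ a unique element $\tilde X\in\mathcal H$; in particular, $\mathcal F/G$ and $\mathcal H$ are in bijection.
   Context: All functions are 1-periodic (subscript ''per'') unless noted. **Eulerian set.** $\mathcal D$ is the set of triplets $(u,\rho,\mu)$ with $u\in H^1_{\rm per}$, $\rho\in L^2_{\rm per}$, and $\mu$ a positive (nonnegative) 1-periodic Radon measure on $\mathbb R$ whose absolutely continuous part is $\mu_{\rm ac}=(u^2+u_x^2+\rho^2)dx$. **Lagrangian set.** $E$ is the set of $(y,U,\nu,r)$ with $(y-\mathrm{id},U,\nu,r)\in W^{1,1}_{\rm per}\times W^{1,1}_{\rm per}\times L^1_{\rm per}\times L^1_{\rm per}$. $\mathcal F$ is the set of $(y,U,\nu,r)\in E$ with $y,U\in W^{1,\infty}_{\rm loc}(\mathbb R)$, $\nu,r\in L^\infty(\mathbb R)$, $y_\xi\ge0$, $\nu\ge0$, $y_\xi+\nu\ge c$ a.e. for some constant $c>0$, and $y_\xi\nu=y_\xi^2U^2+U_\xi^2+r^2$ a.e. **Relabeling.** $G$ is the group (under composition) of invertible $f\in W^{1,\infty}_{\rm loc}(\mathbb R)$ with $f(\xi+1)=f(\xi)+1$ and $f-\mathrm{id},f^{-1}-\mathrm{id}\in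 W^{1,\infty}_{\rm per}$. It acts on $\mathcal F$ by $X\bullet f=(y\circ f,U\circ f,(\nu\circ f)f_\xi,(r\circ f)f_\xi)$ for $X=(y,U,\nu,r)$; $\mathcal F/G$ is the set of orbits. With $h=\|\nu\|_{L^1([0,1])}$, $\mathcal F_0=\{X\in\mathcal F: y_\xi+\nu=1+h\}$ and $\mathcal H=\{X\in\mathcal F_0:\int_0^1y\,d\xi=0\}$. **Projection.** $\Pi=\Pi_2\circ\Pi_1:\mathcal F\to\mathcal H$, where $\Pi_1:\mathcal F\to\mathcal F_0$, $\Pi_1(X)=X\bullet f^{-1}$ with $f(\xi)=\frac1{1+h}\big(y(\xi)+\int_0^\xi\nu(\theta)\,d\theta\big)\in G$, and $\Pi_2:\mathcal F_0\to\mathcal H$, $\Pi_2(X)(\xi)=X(\xi-a)$ with $a=\int_0^1y(\xi)\,d\xi$. **Change of variables.** For $(u,\rho,\mu)\in\mathcal D$, $\tilde L(u,\rho,\mu)=(y,U,\nu,r)\in\mathcal F$ with $h=\mu([0,1))$, $y(\xi)=\sup\{y: F_\mu(y)+y<(1+h)\xi\}$, $\nu=(1+h)-y_\xi$, $U=u\circ y$, $r=(\rho\circ y)y_\xi$, where $F_\mu(x)=\mu([0,x))$ for $x>0$, $F_\mu(0)=0$, $F_\mu(x)=-\mu([x,0))$ for $x<0$. $L=\Pi\circ\tilde L$. $M:\mathcal F\to\mathcal D$ is $M(y,U,\nu,r)=(u,\rho,\mu)$ with $u(x)=U(\xi)$ for any $\xi$ with $x=y(\xi)$, $\mu=y_\#(\nu\,d\xi)$,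 $\rho\,dx=y_\#(r\,d\xi)$, where $(f_\#\lambda)(B)=\lambda(f^{-1}(B))$ is the push-forward. *)

(* Defs.v *)
From HB Require Import structures.
From mathcomp Require Import all_boot all_order all_algebra.
From mathcomp Require Import all_classical all_reals all_analysis.

Set Implicit Arguments.
Unset Strict Implicit.
Unset Printing Implicit Defensive.

Import Order.TTheory GRing.Theory Num.Theory.
Import numFieldNormedType.Exports.

Local Open Scope classical_set_scope.
Local Open Scope ring_scope.
Local Open Scope quotient_scope.

(* A value of type {measure set _ -> \bar R} also carries arbitrary values on
   the non-measurable sets. Quotienting by equality on the measurable sets
   makes Leibniz equality the equality of Borel measures. *)
Definition pre_borel_measure (R : realType) : Type :=
  {measure set (measurableTypeR R) -> \bar R}.

HB.instance Definition _ (R : realType) := gen_eqMixin (pre_borel_measure R).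
HB.instance Definition _ (R : realType) :=
  gen_choiceMixin (pre_borel_measure R).

Section borel_measure.
Context {R : realType}.
Implicit Types m : pre_borel_measure R.

Definition borel_measure_eq m1 m2 : bool :=
  `[< forall B : set (measurableTypeR R), measurable B ->
      (m1 : {measure set _ -> \bar R}) B = (m2 : {measure set _ -> \bar R}) B >].

Let borel_measure_eq_refl : reflexive borel_measure_eq.
Proof. by move=> m; apply/asboolP. Qed.

Let borel_measure_eq_sym : symmetric borel_measure_eq.
Proof.
by move=> m1 m2; apply/idP/idP => /asboolP e; apply/asboolP => B mB; rewrite e.
Qed.

Let borel_measure_eq_trans : transitive borel_measure_eq.
Proof.
move=> m2 m1 m3 /asboolP e12 /asboolP e23.
by apply/asboolP => B mB; rewrite e12// e23.
Qed.

Canonical borel_measure_equiv := EquivRel borel_measure_eq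
  borel_measure_eq_refl borel_measure_eq_sym borel_measure_eq_trans.

Definition borel_measure : Type := {eq_quot borel_measure_eq}.
HB.instance Definition _ := Choice.on borel_measure.
HB.instance Definition _ := EqQuotient.on borel_measure.

Definition measure_of (mu : borel_measure) :
  {measure set (measurableTypeR R) -> \bar R} := repr mu.

End borel_measure.
Arguments borel_measure R : clear implicits.
Coercion measure_of : borel_measure >-> Measure.type.

Section two_component_camassa_holm.
Context (R : realType).

Local Notation leb := (@lebesgue_measure R).

(* Borel functions modulo equality almost everywhere; elements coerce to
   functions by the choice of a representative. *)
Local Notation Mclass :=
  {mfun_ leb, (measurableTypeR R) >-> (measurableTypeR R)}.

Definition Mclass0 : Mclass :=
  \pi_(Mclass) (cst 0 : {mfun (measurableTypeR R) >-> (measurableTypeR R)}).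

(* The class of a function that is almost everywhere equal to a Borel one. *)
Definition ae_class (f : R -> R) : Mclass :=
  xget Mclass0 [set c : Mclass | \forall x \ae leb, c x = f x].

Definition leb_itv (a b : R) :
    {measure set (measurableTypeR R) -> \bar R} :=
  mrestr leb (measurable_itv `[a, b]).

Definition Lp_per (p : \bar R) (f : R -> R) : Prop :=
  (f \in Lfun (leb_itv 0 1) p) /\ (\forall x \ae leb, f (x + 1) = f x).

Definition Linf (f : R -> R) : Prop := f \in Lfun leb +oo%E.

Definition Linf_loc (f : R -> R) : Prop :=
  forall a b : R, f \in Lfun (leb_itv a b) +oo%E.

(* C^1_c and C^oo_c test functions define the same weak derivative. *)
Definition test_function (phi : R -> R) : Prop :=
  [/\ forall x, derivable phi x 1, continuous (derive1 phi) &
      exists2 K : set R, compact K & forall x, ~ K x -> phi x = 0].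

Definition weak_derivative (f g : R -> R) : Prop :=
  [/\ locally_integrable setT f, locally_integrable setT g &
      forall phi, test_function phi ->
        \int[leb]_x (f x * derive1 phi x) = - \int[leb]_x (g x * phi x)].

Definition wderiv (f : R -> R) : Mclass :=
  xget Mclass0 [set g : Mclass | weak_derivative f g].

(* Elements of the Sobolev spaces are given by their continuous
   representatives, so that they can be evaluated and composed pointwise. *)
Definition W1_per (p : \bar R) (f : R -> R) : Prop :=
  [/\ continuous f, forall x, f (x + 1) = f x, Lp_per p f &
      exists2 g : Mclass, weak_derivative f g & Lp_per p g].

Definition W1inf_loc (f : R -> R) : Prop :=
  [/\ continuous f, Linf_loc f &
      exists2 g : Mclass, weak_derivative f g & Linf_loc g].

Definition H1_per := W1_per 2%:E.

Record eulerian := Eulerian {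
  eu_u : R -> R;
  eu_rho : Mclass;
  eu_mu : borel_measure R }.

HB.instance Definition _ := gen_eqMixin eulerian.
HB.instance Definition _ := gen_choiceMixin eulerian.

Definition radon (mu : borel_measure R) : Prop :=
  forall K : set R, compact K -> (mu K < +oo)%E.

Definition periodic_measure (mu : borel_measure R) : Prop :=
  forall B : set (measurableTypeR R), measurable B ->
    mu [set x + 1 | x in B] = mu B.

(* mac is the absolutely continuous part of mu in its Lebesgue decomposition
   with respect to Lebesgue measure. *)
Definition is_ac_part (mu : borel_measure R)
    (mac : set (measurableTypeR R) -> \bar R) : Prop :=
  mac `<< leb /\
  exists mus : {measure set (measurableTypeR R) -> \bar R},
    (exists N : set (measurableTypeR R),
       [/\ measurable N, leb N = 0%E & mus (~` N) = 0%E]) /\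
    (forall B : set (measurableTypeR R), measurable B ->
       mu B = (mac B + mus B)%E).

Definition calD : set eulerian := [set E |
  [/\ H1_per (eu_u E), Lp_per 2%:E (eu_rho E), radon (eu_mu E),
      periodic_measure (eu_mu E) &
      is_ac_part (eu_mu E) (fun B => \int[leb]_(x in B)
        (eu_u E x ^+ 2 + wderiv (eu_u E) x ^+ 2 + eu_rho E x ^+ 2)%:E)%E]].

Record lagrangian := Lagrangian {
  la_y : R -> R;
  la_U : R -> R;
  la_nu : Mclass;
  la_r : Mclass }.

Definition calE : set lagrangian := [set X |
  [/\ W1_per 1 (fun xi => la_y X xi - xi), W1_per 1 (la_U X),
      Lp_per 1 (la_nu X) & Lp_per 1 (la_r X)]].

Definition calF : set lagrangian := [set X |
  let: Lagrangian y U nu r := X in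
  [/\ calE X,
      W1inf_loc y /\ W1inf_loc U,
      Linf nu /\ Linf r,
      [/\ \forall xi \ae leb, 0 <= wderiv y xi,
          \forall xi \ae leb, 0 <= nu xi &
          exists2 c : R, 0 < c & \forall xi \ae leb, c <= wderiv y xi + nu xi] &
      \forall xi \ae leb, wderiv y xi * nu xi =
        wderiv y xi ^+ 2 * U xi ^+ 2 + wderiv U xi ^+ 2 + r xi ^+ 2]].

Definition calG : set (R -> R) := [set f |
  [/\ W1inf_loc f, forall xi, f (xi + 1) = f xi + 1,
      W1_per +oo%E (fun xi => f xi - xi) &
      exists g : R -> R, [/\ cancel f g, cancel g f &
        W1_per +oo%E (fun xi => g xi - xi)]]].

Definition relabel (X : lagrangian) (f : R -> R) : lagrangian :=
  Lagrangian (la_y X \o f) (la_U X \o f)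
    (ae_class (fun xi => la_nu X (f xi) * wderiv f xi))
    (ae_class (fun xi => la_r X (f xi) * wderiv f xi)).

Definition relabel_orbit (X : lagrangian) : set lagrangian :=
  [set relabel X f | f in calG].

Definition FmodG : set (set lagrangian) := [set relabel_orbit X | X in calF].

Definition energy (X : lagrangian) : R :=
  fine ('N[leb_itv 0 1]_1[EFin \o la_nu X])%E.

Definition calF0 : set lagrangian := [set X | calF X /\
  \forall xi \ae leb, wderiv (la_y X) xi + la_nu X xi = 1 + energy X].

Definition calH : set lagrangian := [set X | calF0 X /\
  \int[leb]_(xi in `[0, 1]) la_y X xi = 0].

(* \int_0^x g, with the usual sign convention when x < 0. *)
Definition primitive (g : R -> R) (x : R) : R :=
  if 0 <= x then \int[leb]_(t in `[0, x]) g t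
  else - \int[leb]_(t in `[x, 0]) g t.

Definition Pi1 (X : lagrangian) : lagrangian :=
  let f xi := (1 + energy X)^-1 * (la_y X xi + primitive (la_nu X) xi) in
  relabel X ('pinv_(fun=> 0) setT f).

Definition Pi2 (X : lagrangian) : lagrangian :=
  let a := \int[leb]_(xi in `[0, 1]) la_y X xi in
  Lagrangian (fun xi => la_y X (xi - a)) (fun xi => la_U X (xi - a))
    (ae_class (fun xi => la_nu X (xi - a)))
    (ae_class (fun xi => la_r X (xi - a))).

Definition Pi (X : lagrangian) : lagrangian := Pi2 (Pi1 X).

Definition cumul (mu : borel_measure R) (x : R) : R :=
  if 0 <= x then fine (mu `[0, x[%classic) else - fine (mu `[x, 0[%classic).

Definition Ltilde (E : eulerian) : lagrangian :=
  let: Eulerian u rho mu := E in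
  let h := fine (mu `[0, 1[%classic) in
  let y xi := sup [set x | cumul mu x + x < (1 + h) * xi] in
  Lagrangian y (u \o y) (ae_class (fun xi => 1 + h - wderiv y xi))
    (ae_class (fun xi => rho (y xi) * wderiv y xi)).

Definition mapL (E : eulerian) : lagrangian := Pi (Ltilde E).

(* u (y xi) = U xi, mu = y_# (nu dxi) and rho dx = y_# (r dxi). The last
   measure is signed and in general infinite on R: it is compared with rho dx
   on the bounded Borel sets. *)
Definition is_eulerian_of (X : lagrangian) (E : eulerian) : Prop :=
  let: Lagrangian y U nu r := X in
  let: Eulerian u rho mu := E in
  [/\ forall xi, u (y xi) = U xi,
      forall B : set (measurableTypeR R), measurable B ->
        mu B = (\int[leb]_(xi in y @^-1` B) (nu xi)%:E)%E,
      locally_integrable setT rho &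
      forall (a b : R) (B : set (measurableTypeR R)), measurable B ->
        B `<=` `[a, b] ->
        \int[leb]_(x in B) rho x = \int[leb]_(xi in y @^-1` B) r xi].

Definition mapM (X : lagrangian) : eulerian :=
  xget (Eulerian (cst 0) Mclass0 (\pi_(borel_measure R) mzero))
    [set E | is_eulerian_of X E].

End two_component_camassa_holm.

Arguments calD R : clear implicits.
Arguments calF R : clear implicits.
Arguments calH R : clear implicits.
Arguments FmodG R : clear implicits.

(* Main.v *)
From HB Require Import structures.
Require Import Defs.
From mathcomp Require Import all_boot all_order all_algebra.
From mathcomp Require Import all_classical all_reals all_analysis.
From mathcomp Require Import measurable_realfun ess_sup_inf.
From mathcomp Require Import lra ring.

(* Everything is reduced to two facts about monotone changes of variables.
   First, M is constant on the orbits of G, because the push-forwards of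
   [nu dxi] and [r dxi] are unchanged by a relabeling. Second, M is injective
   on H: if [X] is in H and M X = (u, rho, mu), then [y_xi + nu = 1 + h] forces
   the generalized inverse [chi] of [y] to satisfy
   [(1 + h) (chi b - chi a) = b - a + mu [a, b)], so mu determines [y] up to a
   translation of the variable, which is fixed by the normalization of the mean
   of [y]; then [U = u o y] and [r = (rho o y) y_xi]. Finally L~ is a section of
   M: by construction [y] pushes [(1 + h) dxi] forward to [mu + dx], and since
   [mu_ac = g dx], this gives [y_xi = (1 + h) / (1 + g o y)], or [0] where [y]
   lands in the support of the singular part. Since [Pi X] is a relabeling of
   [X] in H, the identities for L, M and [Pi] all follow. *)

(** The obstacle is that [y] may be flat: it has no inverse, and composing with it does not preserve
    null sets. So a monotone change of variables enters only through one identity, that [y] pushes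
    [y_xi dxi] forward to Lebesgue measure. It gives the substitute for preservation of null sets:
    [y_xi] vanishes almost everywhere over a null set. The energy identity then forces [U_xi] and
    [r] to vanish with [y_xi], which is why [U] factors through [y] and why [r dxi] is pushed to a
    measure with a density. Nothing forces [nu] to vanish there, and what remains of it is the
    singular part of [mu]. The definitions speak of weak derivatives while the arguments integrate
    over segments. The lemma of du Bois-Reymond identifies the two points of view for continuous
    functions, and all Sobolev conditions are restated with primitives. Conditions that hold almost
    everywhere are moved to representatives that satisfy them at every point. *)

Set Implicit Arguments.
Unset Strict Implicit.
Unset Printing Implicit Defensive.

Import Order.TTheory GRing.Theory Num.Theory.
Import numFieldNormedType.Exports.

Local Open Scope classical_set_scope.
Local Open Scope ring_scope.
Local Open Scope quotient_scope.

(** * Measures with density and changes of variables *)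

Section density.
Context d (T : measurableType d) (R : realType).
Variable mu : {measure set T -> \bar R}.

(* The absolute value makes the set function a measure for any [g]. *)
Definition density (g : T -> R) (mg : measurable_fun setT g) (A : set T) :
  \bar R := (\int[mu]_(x in A) `|g x|%:E)%E.

Variables (g : T -> R) (mg : measurable_fun setT g).
Local Notation dens := (density mg).

Let dens0 : dens set0 = 0%E. Proof. exact: integral_set0. Qed.

Let dens_ge0 A : (0 <= dens A)%E.
Proof. by apply: integral_ge0 => x _; rewrite lee_fin. Qed.

Let dens_sigma_additive : semi_sigma_additive dens.
Proof.
apply: semi_sigma_additive_nng_induced => [|x]; last by rewrite lee_fin.
by apply/measurable_EFinP; exact: measurableT_comp.
Qed.

HB.instance Definition _ := isMeasure.Build _ _ _ dens
  dens0 dens_ge0 dens_sigma_additive.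

Import HBNNSimple.

(** For indicators this is the definition of [density]; simple functions follow by linearity, and
    nonnegative [f] by monotone convergence along [nnsfun_approx]. *)
Lemma ge0_integral_density (D : set T) (f : T -> R) : measurable D ->
  (forall x, D x -> 0 <= f x) -> measurable_fun D f ->
  (\int[dens]_(x in D) (f x)%:E = \int[mu]_(x in D) (f x * `|g x|)%:E)%E.
Proof.
move=> mD f0 mf.
have mEf : measurable_fun D (EFin \o f) by exact/measurable_EFinP.
have f0' x : D x -> (0 <= (EFin \o f) x)%E by move=> /f0; rewrite lee_fin.
pose h := nnsfun_approx mD mEf.
have mg1 : measurable_fun D (fun x => `|g x|).
  by apply: measurable_funTS; exact: measurableT_comp.
have -> : (\int[dens]_(x in D) (f x)%:E =
    lim (\int[dens]_(x in D) (h n x)%:E @[n --> \oo]))%E.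
  have fE x : D x -> (f x)%:E = lim ((h n x)%:E @[n --> \oo]).
    by move=> Dx; apply/esym/cvg_lim => //; exact: (cvg_nnsfun_approx mD mEf).
  under eq_integral => x /[!inE] /fE -> //.
  apply: monotone_convergence => //.
  - by move=> n; apply/measurable_EFinP; exact: measurable_funTS.
  - by move=> n x Dx; rewrite lee_fin.
  - by move=> x Dx a b ab; rewrite lee_fin; exact/lefP/nd_nnsfun_approx.
have -> : (\int[mu]_(x in D) (f x * `|g x|)%:E =
    lim (\int[mu]_(x in D) (h n x * `|g x|)%:E @[n --> \oo]))%E.
  have fE x : D x -> (f x * `|g x|)%:E = lim ((h n x * `|g x|)%:E @[n --> \oo]).
    move=> Dx; apply/esym/cvg_lim => //.
    under eq_fun do rewrite EFinM.
    by rewrite EFinM; apply: cvgeZr => //; exact: (cvg_nnsfun_approx mD mEf).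
  under eq_integral => x /[!inE] /fE -> //.
  apply: monotone_convergence => //.
  - move=> n; apply/measurable_EFinP; apply: measurable_funM => //.
    exact: measurable_funTS.
  - by move=> n x Dx; rewrite lee_fin mulr_ge0.
  - move=> x Dx a b ab; rewrite lee_fin ler_wpM2r//.
    exact/lefP/nd_nnsfun_approx.
suff H n : (\int[mu]_(x in D) (h n x * `|g x|)%:E =
            \int[dens]_(x in D) (h n x)%:E)%E.
  by under [in RHS]eq_fun do rewrite H.
have mind r : measurable_fun D (\1_(h n @^-1` [set r]) : T -> R).
  exact: measurable_funTS.
transitivity (\int[dens]_(x in D)
   (\sum_(y \in range (h n)) (y * \1_(h n @^-1` [set y]) x)%:E))%E; last first.
  by apply: eq_integral => t tE; rewrite /= fimfunE -fsumEFin.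
rewrite ge0_integral_fsum//; last 2 first.
  - by move=> y; apply/measurable_EFinP; apply: measurable_funM.
  - by move=> m y Ey; exact: nnfun_muleindic_ge0.
transitivity (\int[mu]_(x in D) (\sum_(y \in range (h n))
    (y * \1_(h n @^-1` [set y]) x)%:E * `|g x|%:E))%E.
  under [RHS]eq_integral => x xE.
    rewrite -ge0_mule_fsuml => [|y]; last exact: nnfun_muleindic_ge0.
    rewrite fsumEFin // -(fimfunE _ x); over.
  by under eq_integral do rewrite EFinM.
rewrite ge0_integral_fsum//; last 2 first.
  - move=> y; apply: emeasurable_funM; apply/measurable_EFinP => //.
    exact: measurable_funM.
  - by move=> m y Ey; rewrite mule_ge0 ?lee_fin// -lee_fin nnfun_muleindic_ge0.
apply: eq_fsbigr => r rhn.
have [r0|r0] := leP 0 r; last first.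
  rewrite integral0_eq ?integral0_eq// => x Dx.
    by rewrite preimage_nnfun0// indic0 mulr0.
  by rewrite preimage_nnfun0// indic0 mulr0 mul0e.
under [LHS]eq_integral do rewrite EFinM -muleA.
under [RHS]eq_integral do rewrite EFinM.
rewrite !ge0_integralZl_EFin//; last 2 first.
  - exact/measurable_EFinP.
  - by apply: emeasurable_funM; apply/measurable_EFinP.
congr (_ * _)%E; rewrite integral_indic//= setIC /density [RHS]integral_mkcondr.
apply: eq_integral => x xD; rewrite patchE indicE.
by case: ifPn => _; rewrite ?mul1e ?mul0e.
Qed.

End density.

Section transport.
Context {R : realType}.
Local Notation leb := (@lebesgue_measure R).
Local Notation Mclass :=
  {mfun_ leb, (measurableTypeR R) >-> (measurableTypeR R)}.

Lemma aeS (P Q : R -> Prop) : (forall x, P x -> Q x) ->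
  (\forall x \ae leb, P x) -> \forall x \ae leb, Q x.
Proof. exact: (@filterS _ _ (ae_filter_ringOfSetsType leb)). Qed.

Lemma aeS2 (P1 P2 Q : R -> Prop) : (forall x, P1 x -> P2 x -> Q x) ->
  (\forall x \ae leb, P1 x) -> (\forall x \ae leb, P2 x) ->
  \forall x \ae leb, Q x.
Proof. exact: (@filterS2 _ _ (ae_filter_ringOfSetsType leb)). Qed.

Lemma aeS3 (P1 P2 P3 Q : R -> Prop) :
  (forall x, P1 x -> P2 x -> P3 x -> Q x) ->
  (\forall x \ae leb, P1 x) -> (\forall x \ae leb, P2 x) ->
  (\forall x \ae leb, P3 x) -> \forall x \ae leb, Q x.
Proof. exact: (@filterS3 _ _ (ae_filter_ringOfSetsType leb)). Qed.

Lemma measurable_preimage d1 d2 (T1 : measurableType d1)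
    (T2 : measurableType d2) (f : T1 -> T2) (B : set T2) :
  measurable_fun setT f -> measurable B -> measurable (f @^-1` B).
Proof. by move=> mf mB; rewrite -[X in measurable X]setTI; exact: mf. Qed.

Lemma ae_class_eq (c1 c2 : Mclass) :
  (\forall x \ae leb, c1 x = c2 x) -> c1 = c2.
Proof.
move=> h; have : c1 == c2 %[mod Mclass].
  by apply/ae_eqP; apply: aeS h => x h _.
by rewrite !reprK => /eqP.
Qed.

Lemma measurable_class (c : Mclass) : measurable_fun setT (c : R -> R).
Proof. exact: (measurable_funP (repr c)). Qed.

Lemma pi_classE (f : {mfun (measurableTypeR R) >-> (measurableTypeR R)}) :
  \forall x \ae leb, (\pi_(Mclass) f : Mclass) x = f x.
Proof.
have : \pi_(Mclass) (repr (\pi_(Mclass) f)) == \pi_(Mclass) f by rewrite reprK.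
rewrite eqmodE => /asboolP; apply: aeS => x h; exact: h.
Qed.

(** The class of [f] itself belongs to the set from which [ae_class] chooses, so the default
    [Mclass0] is excluded. *)
Lemma ae_classE (f : R -> R) : measurable_fun setT f ->
  \forall x \ae leb, ae_class f x = f x.
Proof.
move=> mf; rewrite /ae_class; case: xgetP => [c _ //|/(_ _) h].
have m := isMeasurableFun.Build _ _ _ _ _ (mf : @measurable_fun _ _
  (measurableTypeR R) (measurableTypeR R) setT f).
pose F : {mfun (measurableTypeR R) >-> (measurableTypeR R)} := HB.pack f m.
by have /h := pi_classE F.
Qed.

Lemma eq_ae_class (f g : R -> R) : (\forall x \ae leb, f x = g x) ->
  ae_class f = ae_class g.
Proof.
move=> fg; rewrite /ae_class; congr xget; apply/seteqP; split => c.
  by apply: aeS2 fg => x <-.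
by apply: aeS2 fg => x ->.
Qed.

(** Half-open intervals are stable under intersection, generate the Borel sets and exhaust the line
    by sets of finite measure. This shape is also the one preserved by preimages under monotone maps
    ([lift_preimage_itvco]) and the one measured by [cumul]. *)
Lemma measure_eq_itvco (m1 m2 : {measure set (measurableTypeR R) -> \bar R}) :
  (forall a b, a <= b -> m1 `[a, b[%classic = m2 `[a, b[%classic) ->
  (forall a b, (m1 `[a, b[%classic < +oo)%E) ->
  forall A, measurable A -> m1 A = m2 A.
Proof.
move=> m12 m1y.
pose G : set (set R) := [set A | exists a b, A = `[a, b[%classic].
apply: (@measure_unique _ R (measurableTypeR R) G
  (fun n => `[- n%:R, n%:R[%classic : set R) _ _ _ _ m1 m2) => //.
- rewrite /measurable /=.
  transitivity (<<s @RGenCInfty.G R >>); first exact: RGenCInfty.measurableE.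
  apply/seteqP; split.
    apply: smallest_sub; first exact: smallest_sigma_algebra.
    move=> _ [x ->].
    have -> : `[x, +oo[%classic = \bigcup_n `[x, x + n%:R[%classic.
      apply/seteqP; split => y /=.
        rewrite in_itv/= andbT => xy.
        exists (Num.truncn (y - x)).+1 => //=; rewrite in_itv/= xy/=.
        by rewrite -ltrBlDl truncnS_gt.
      by move=> [n _]/=; rewrite !in_itv/= andbT => /andP[].
    apply: (@bigcupT_measurable _ (g_sigma_algebraType G)) => n.
    by apply: sub_gen_smallest; exists x, (x + n%:R).
  apply: smallest_sub; first exact: smallest_sigma_algebra.
  move=> _ [a [b ->]].
  have : (@RGenCInfty.G R).-sigma.-measurable `[a, b[%classic.
    exact: RGenCInfty.measurable_itv_bounded.
  by [].
- move=> _ _ [a [b ->]] [c [e ->]]; exists (Num.max a c), (Num.min b e).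
  apply/seteqP; split => y /=; rewrite !in_itv/= ge_max lt_min.
    by move=> [/andP[-> ->] /andP[-> ->]].
  by move=> /andP[/andP[-> ->] /andP[-> ->]].
- by move=> n; exists (- n%:R), n%:R.
- apply/seteqP; split => // x _; exists (Num.truncn `|x|).+1 => //=.
  rewrite in_itv/= lerNl.
  have h := truncnS_gt `|x|.
  rewrite (le_lt_trans (ler_norm _) h) andbT ltW//.
  by rewrite (le_lt_trans (ler_norm _))// normrN.
- move=> _ [a [b ->]]; have [ab|ba] := leP a b; first exact: m12.
  by rewrite set_itv_ge ?measure0// bnd_simp -leNgt ltW.
Qed.

Definition image_density (y : measurableTypeR R -> measurableTypeR R)
    (my : measurable_fun setT y) (g : measurableTypeR R -> R)
    (mg : measurable_fun setT g) :
    {measure set (measurableTypeR R) -> \bar R} :=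
  measure_function_pushforward__canonical__measure_function_Measure
    (density leb mg) my.

Lemma image_densityE (y g : R -> R) (my : measurable_fun setT y)
    (mg : measurable_fun setT g) (B : set R) :
  image_density my mg B = (\int[leb]_(x in y @^-1` B) `|g x|%:E)%E.
Proof. by []. Qed.

Lemma ge0_integral_image_density (y g : R -> R) (my : measurable_fun setT y)
    (mg : measurable_fun setT g) (B : set R) (f : R -> R) : measurable B ->
  measurable_fun setT f -> (forall x, B x -> 0 <= f x) ->
  (\int[image_density my mg]_(x in B) (f x)%:E =
   \int[leb]_(x in y @^-1` B) (f (y x) * `|g x|)%:E)%E.
Proof.
move=> mB mf f0.
rewrite [LHS](@ge0_integral_pushforward _ _ (measurableTypeR R)
  (measurableTypeR R) R y my)//; last 2 first.
  by apply/measurable_EFinP; exact: measurable_funTS.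
  by move=> x; rewrite inE => /f0; rewrite lee_fin.
apply: (@ge0_integral_density _ (measurableTypeR R) R leb g mg _ (f \o y)).
- exact: measurable_preimage.
- by move=> x; exact: f0.
- by apply: measurable_funTS; exact: measurableT_comp.
Qed.

(* The push-forward by [y] of the measure with density [y'] is Lebesgue
   measure, as is the case when [y] is nondecreasing and onto with weak
   derivative [y']. *)
Definition transports (y y' : R -> R) : Prop :=
  [/\ measurable_fun setT y, measurable_fun setT y', forall x, 0 <= y' x &
      forall B : set (measurableTypeR R), measurable B ->
        leb B = (\int[leb]_(x in y @^-1` B) (y' x)%:E)%E].

Section change_of_variables.
Variables (y y' : R -> R) (yy' : transports y y').

Lemma ge0_transport_integral (B : set R) (f : R -> R) : measurable B ->
  measurable_fun setT f -> (forall x, B x -> 0 <= f x) ->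
  (\int[leb]_(x in B) (f x)%:E =
   \int[leb]_(x in y @^-1` B) (f (y x) * y' x)%:E)%E.
Proof.
case: yy' => my my' y'0 yE mB mf f0.
transitivity (\int[image_density my my']_(x in B) (f x)%:E)%E.
  apply: eq_measure_integral => A mA _; apply: (etrans (yE _ mA)).
  by apply: eq_integral => x _; rewrite ger0_norm.
rewrite ge0_integral_image_density//.
by apply: eq_integral => x _; rewrite ger0_norm.
Qed.

(** The factor [y' x] is nonnegative, hence passes through the maxima that define the positive and
    negative parts, and each part transports separately. *)
Lemma transport_integral (B : set R) (f : R -> R) : measurable B ->
  measurable_fun setT f ->
  (\int[leb]_(x in B) (f x)%:E =
   \int[leb]_(x in y @^-1` B) (f (y x) * y' x)%:E)%E.
Proof.
move=> mB mf; have [_ _ y'0 _] := yy'.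
have pos (g : R -> R) (D : set R) :
    (\int[leb]_(x in D) (EFin \o g)^\+ x =
     \int[leb]_(x in D) (g^\+%R x)%:E)%E.
  by apply: eq_integral => x _; rewrite funeposE /funrpos EFin_max.
have neg (g : R -> R) (D : set R) :
    (\int[leb]_(x in D) (EFin \o g)^\- x =
     \int[leb]_(x in D) (g^\-%R x)%:E)%E.
  by apply: eq_integral => x _; rewrite funenegE /funrneg EFin_max.
rewrite integralE [RHS]integralE.
rewrite (pos f) (neg f) (pos (fun x => f (y x) * y' x)).
rewrite (neg (fun x => f (y x) * y' x)).
have /(ge0_transport_integral mB)-> := measurable_funrpos mf; last first.
  by move=> x _; exact: funrpos_ge0.
have /(ge0_transport_integral mB)-> := measurable_funrneg mf; last first.
  by move=> x _; exact: funrneg_ge0.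
congr (_ - _)%E; apply: eq_integral => x _.
  by rewrite /funrpos maxr_pMl// mul0r.
by rewrite /funrneg maxr_pMl// mul0r mulNr.
Qed.

(** The integral of [y'] over the preimage of a null set is the measure of that set, hence zero.
    This replaces preservation of null sets by preimages, which fails when a flat piece of [y] lands
    in [N]. *)
Lemma transport_null (N : set R) : leb.-negligible N ->
  \forall x \ae leb, N (y x) -> y' x = 0.
Proof.
case: yy' => my my' y'0 yE [A [mA A0 NA]].
have myA : measurable (y @^-1` A) by exact: measurable_preimage.
have : (\int[leb]_(x in y @^-1` A) `|(EFin \o y') x| = 0)%E.
  rewrite -[RHS]A0 yE//; apply: eq_integral => x _ /=.
  by rewrite ger0_norm.
move/(ae_eq_integral_abs leb myA).
have my'A : measurable_fun (y @^-1` A) (EFin \o y').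
  by apply/measurable_EFinP; exact: measurable_funTS.
move=> /(_ my'A); apply: aeS => x h /NA /h /= [].
by [].
Qed.

Lemma transport_ae (P : R -> Prop) : (\forall x \ae leb, P x) ->
  \forall x \ae leb, y' x = 0 \/ P (y x).
Proof.
move=> h; have := @transport_null (~` [set x | P x]) h.
apply: aeS => x hx; have [Px|nPx] := pselect (P (y x)); first by right.
by left; apply: hx.
Qed.

Lemma transport_integrable (B : set R) (f : R -> R) : measurable B ->
  measurable_fun setT f ->
  leb.-integrable B (EFin \o f) <->
  leb.-integrable (y @^-1` B) (EFin \o (fun x => f (y x) * y' x)).
Proof.
move=> mB mf; have [my my' y'0 _] := yy'.
have E : (\int[leb]_(x in B) `|(EFin \o f) x| =
  \int[leb]_(x in y @^-1` B) `|(EFin \o (fun x => f (y x) * y' x)%R) x|)%E.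
  rewrite (@ge0_transport_integral _ (fun x => `|f x|))//.
    by apply: eq_integral => x _ /=; rewrite normrM (ger0_norm (y'0 _)).
  exact: measurableT_comp.
have mfy : measurable_fun setT (fun x => f (y x) * y' x).
  by apply: measurable_funM => //; exact: measurableT_comp.
split=> /integrableP[_ h]; apply/integrableP; split.
- by apply/measurable_EFinP; exact: measurable_funTS.
- by rewrite -E.
- by apply/measurable_EFinP; exact: measurable_funTS.
- by rewrite E.
Qed.

Lemma transport_Rintegral (B : set R) (f : R -> R) : measurable B ->
  measurable_fun setT f ->
  \int[leb]_(x in B) f x = \int[leb]_(x in y @^-1` B) (f (y x) * y' x).
Proof. by move=> mB mf; rewrite /Rintegral transport_integral. Qed.

End change_of_variables.

End transport.

(** * Locally integrable functions, primitives and weak derivatives *)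

Section primitives.
Context {R : realType}.
Local Notation leb := (@lebesgue_measure R).
Implicit Types (f g : R -> R) (a b c : R).

(** Local integrability tested on segments, the form that primitives use; [loc_intP] compares it
    with compact sets. *)
Definition loc_int g : Prop := measurable_fun setT g /\
  forall a b, leb.-integrable `[a, b] (EFin \o g).

Lemma loc_intP g : loc_int g <-> locally_integrable setT g.
Proof.
split=> [[mg ig]|[mg _ ig]]; split => //.
- exact: openT.
- move=> K _ cK; have mK := compact_measurable cK.
  have [M [_ MK]] := compact_bounded cK.
  have KM : K `<=` `[- (M + 1), M + 1].
    move=> x Kx /=; rewrite in_itv/=.
    have : `|x| <= M + 1 by apply: MK => //; rewrite ltrDl.
    by rewrite ler_norml.
  have /integrableP[_] := ig (- (M + 1)) (M + 1).
  apply: le_lt_trans; apply: ge0_subset_integral => //=.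
  apply/measurable_EFinP; apply: measurable_funTS.
  exact: measurableT_comp.
- move=> a b; apply/integrableP; split.
    by apply/measurable_EFinP; exact: measurable_funTS.
  by apply: ig => //; exact: segment_compact.
Qed.

Lemma loc_int_itv g (I : interval R) a b : loc_int g ->
  [set` I] `<=` `[a, b] -> leb.-integrable [set` I] (EFin \o g).
Proof. by move=> [_ ig] Iab; apply: integrableS (ig a b). Qed.

Lemma loc_int_sub g (B : set R) a b : loc_int g -> measurable B ->
  B `<=` `[a, b] -> leb.-integrable B (EFin \o g).
Proof. by move=> [_ ig] mB Bab; apply: integrableS (ig a b). Qed.

Lemma le_loc_int f g : measurable_fun setT f ->
  (\forall x \ae leb, `|f x| <= `|g x|) -> loc_int g -> loc_int f.
Proof.
move=> mf fg [mg ig]; split=> // a b; apply/integrableP; split.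
  by apply/measurable_EFinP; exact: measurable_funTS.
have /integrableP[_] := ig a b; apply: le_lt_trans.
apply: ae_ge0_le_integral => //.
- apply/measurable_EFinP; apply: measurable_funTS; exact: measurableT_comp.
- apply/measurable_EFinP; apply: measurable_funTS; exact: measurableT_comp.
- by apply: aeS fg => x /= fg _; rewrite lee_fin.
Qed.

Lemma loc_int_cst c : loc_int (cst c).
Proof.
split=> // a b; apply: measurable_bounded_integrable => //.
  rewrite /= lebesgue_measure_itv/=; case: ifP => // _; exact: ltry.
by exists `|c|; split=> // M cM x _ /=; exact: ltW.
Qed.

Lemma loc_int_bounded g c : measurable_fun setT g ->
  (\forall x \ae leb, `|g x| <= c) -> loc_int g.
Proof.
move=> mg gc; apply: le_loc_int (loc_int_cst c) => //.
by apply: aeS gc => x /le_trans; apply; exact: ler_norm.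
Qed.

Lemma continuous_loc_int f : continuous f -> loc_int f.
Proof.
move=> cf; split; first exact: continuous_measurable_fun.
move=> a b; apply: continuous_compact_integrable.
  exact: segment_compact.
exact: continuous_subspaceT.
Qed.

Lemma loc_intD f g : loc_int f -> loc_int g -> loc_int (f \+ g).
Proof.
move=> [mf If] [mg Ig]; split=> [|a b]; first exact: measurable_funD.
by have := integrableD _ (If a b) (Ig a b); apply.
Qed.

Lemma loc_intZ f c : loc_int f -> loc_int (fun x => c * f x).
Proof.
move=> [mf If]; split=> [|a b]; first exact: measurable_funM.
by have := integrableZl _ c (If a b); apply.
Qed.

Lemma loc_int_ae f g : measurable_fun setT g ->
  (\forall x \ae leb, f x = g x) -> loc_int f -> loc_int g.
Proof. by move=> mg fg; apply: le_loc_int => //; apply: aeS fg => x ->. Qed.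

Lemma Rintegral_itv_split g a b c : loc_int g -> a <= b -> b <= c ->
  \int[leb]_(x in `[a, c]) g x =
  \int[leb]_(x in `[a, b]) g x + \int[leb]_(x in `[b, c]) g x.
Proof.
move=> lg ab bc.
have /(_ a c) ig := lg.2.
have := @Rintegral_itvB _ g (BLeft a) (BRight c) b ig.
rewrite !bnd_simp => /(_ ab bc) /eqP; rewrite subr_eq addrC => /eqP ->.
congr (_ + _); rewrite Rintegral_itv_obnd_cbnd//.
by apply: (@loc_int_itv _ _ b c) => //; apply: subset_itvr; rewrite bnd_simp.
Qed.

Lemma eq_ae_Rintegral f g (B : set R) : measurable B ->
  measurable_fun setT f -> measurable_fun setT g ->
  (\forall x \ae leb, f x = g x) ->
  \int[leb]_(x in B) f x = \int[leb]_(x in B) g x.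
Proof.
move=> mB mf mg fg; rewrite /Rintegral; congr fine.
apply: ae_eq_integral => //; try
  by apply/measurable_EFinP; exact: measurable_funTS.
by apply: aeS fg => x -> _.
Qed.

(** Local absolute continuity of [f] with derivative [g]. It is the working form of
    [weak_derivative], to which it is equivalent for continuous [f] by [weak_derivativeP]. *)
Definition is_prim f g : Prop := loc_int g /\
  forall a b, a <= b -> f b - f a = \int[leb]_(x in `[a, b]) g x.

Lemma is_prim_primitive g : loc_int g -> is_prim (primitive g) g.
Proof.
move=> lg; split=> // a b ab; rewrite /primitive.
case: (leP 0 a) => a0.
  by rewrite (le_trans a0 ab) (Rintegral_itv_split lg a0 ab) addrAC subrr add0r.
case: (leP 0 b) => b0; rewrite opprK.
  by rewrite (Rintegral_itv_split lg (ltW a0) b0) addrC.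
by rewrite (Rintegral_itv_split lg ab (ltW b0)) addrC addrK.
Qed.

Lemma is_prim_continuous f g : is_prim f g -> continuous f.
Proof.
move=> [lg fg] x.
have xx : x - 1 < x + 1 by rewrite ltrD2l -subr_gt0 opprK.
have := parameterized_integral_continuous (ltW xx) (lg.2 _ _).
move=> /(within_continuous_continuous xx) => /(_ x).
rewrite in_itv/= ltrBlDr ltrDl ltr01 => /(_ isT) cP.
have fE : \forall z \near x,
    f (x - 1) + parameterized_integral leb (x - 1) z g = f z.
  near=> z; rewrite /parameterized_integral -fg; first by rewrite addrCA subrr addr0.
  by apply: ltW; near: z; apply: lt_nbhsr; rewrite ltrBlDr ltrDl ltr01.
rewrite /continuous_at -(nbhs_singleton fE).
have cfP : f (x - 1) + parameterized_integral leb (x - 1) z g @[z --> x] -->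
    f (x - 1) + parameterized_integral leb (x - 1) x g.
  by apply: cvgD; [exact: cvg_cst|exact: cP].
have h := (@near_eq_cvg _ _ _ (nbhs_filter x) _ _ fE). by apply: cvg_trans cfP; exact: h.
Unshelve. all: by end_near. Qed.

(** By Lebesgue differentiation [g] is almost everywhere the derivative of its integral from [- n],
    and the hypothesis makes this integral nondecreasing. Countably many starting points [- n] cover
    the line. *)
Lemma loc_int_ge0_ae g : loc_int g ->
  (forall a b, a <= b -> 0 <= \int[leb]_(x in `[a, b]) g x) ->
  \forall x \ae leb, 0 <= g x.
Proof.
move=> lg g0.
suff H (n : nat) : \forall x \ae leb, - n%:R < x -> 0 <= g x.
  have := @ae_foralln _ (measurableTypeR R) R leb _ H.
  apply: aeS => x /(_ (Num.truncn `|x|).+1); apply.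
  rewrite ltrNl (le_lt_trans (ler_norm _))// normrN.
  exact: truncnS_gt.
have := @FTC1 R g (BLeft (- n%:R)).
move=> /(_ (fun y => lg.2 _ y) ((loc_intP g).1 lg)).
set F := fun x => _; apply: aeS => x /[apply] -[dF <-].
have Fnd u v : u <= v -> F u <= F v.
  rewrite /F => uv; have [nv|vn] := leP (- n%:R) v; last first.
    rewrite !set_itv_ge ?Rintegral_set0// bnd_simp -ltNge//.
    exact: le_lt_trans vn.
  have [nu|un] := leP (- n%:R) u.
    by rewrite (Rintegral_itv_split lg nu uv) lerDl g0.
  by rewrite (@set_itv_ge _ _ (BLeft _) (BRight u)) ?Rintegral_set0 ?g0// bnd_simp -ltNge.
rewrite derive1E; apply: limr_ge => //.
near=> h; rewrite /GRing.scale/= mulr1 [h + x]addrC.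
have [h0|h0] := leP 0 h.
  by rewrite mulr_ge0 ?invr_ge0// subr_ge0 Fnd// lerDl.
rewrite mulr_le0 ?invr_le0 ?(ltW h0)//.
by rewrite subr_le0 Fnd// gerDl ltW.
Unshelve. all: by end_near. Qed.

Lemma loc_intN f : loc_int f -> loc_int (\- f).
Proof.
move=> lf; have := loc_intZ (-1) lf.
by rewrite (_ : (fun x => _) = \- f)//; apply/funext => x; rewrite mulN1r.
Qed.

Lemma loc_intB f g : loc_int f -> loc_int g -> loc_int (f \- g).
Proof. by move=> lf lg; exact: loc_intD lf (loc_intN lg). Qed.

Lemma loc_int_le_ae f g : loc_int f -> loc_int g ->
  (forall a b, a <= b ->
    \int[leb]_(x in `[a, b]) f x <= \int[leb]_(x in `[a, b]) g x) ->
  \forall x \ae leb, f x <= g x.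
Proof.
move=> lf lg fg; apply: aeS (loc_int_ge0_ae (loc_intB lg lf) _) => [x|a b ab].
  by rewrite /= subr_ge0.
by rewrite RintegralB ?subr_ge0 ?fg//; [exact: lg.2|exact: lf.2].
Qed.

Lemma is_prim_uniq f g1 g2 : is_prim f g1 -> is_prim f g2 ->
  \forall x \ae leb, g1 x = g2 x.
Proof.
move=> [lg1 fg1] [lg2 fg2].
apply: aeS2 (loc_int_le_ae lg1 lg2 _) (loc_int_le_ae lg2 lg1 _).
- by move=> x g12 g21; apply/eqP; rewrite eq_le g12.
- by move=> a b ab; rewrite -fg1// -fg2.
- by move=> a b ab; rewrite -fg1// -fg2.
Qed.

Lemma is_prim_ae f g1 g2 : measurable_fun setT g2 ->
  (\forall x \ae leb, g1 x = g2 x) -> is_prim f g1 -> is_prim f g2.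
Proof.
move=> mg2 g12 [lg1 fg1]; split; first exact: loc_int_ae lg1.
move=> a b ab; rewrite fg1//; apply: eq_ae_Rintegral => //; exact: lg1.1.
Qed.

Lemma is_primD f1 f2 g1 g2 : is_prim f1 g1 -> is_prim f2 g2 ->
  is_prim (f1 \+ f2) (g1 \+ g2).
Proof.
move=> [lg1 fg1] [lg2 fg2]; split; first exact: loc_intD.
move=> a b ab; rewrite RintegralD//=; [|exact: lg1.2|exact: lg2.2].
by rewrite -fg1// -fg2// opprD addrACA.
Qed.

Lemma is_primZ f g c : is_prim f g ->
  is_prim (fun x => c * f x) (fun x => c * g x).
Proof.
move=> [lg fg]; split; first exact: loc_intZ.
move=> a b ab; rewrite RintegralZl//; last exact: lg.2.
by rewrite -fg// mulrBr.
Qed.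

Lemma is_prim_id : is_prim id (cst 1).
Proof.
split=> [|a b ab]; first exact: loc_int_cst.
rewrite Rintegral_cst//= lebesgue_measure_itv/= lte_fin mul1r.
move: ab; rewrite le_eqVlt => /predU1P[->|->]; last by [].
by rewrite ltxx subrr.
Qed.

Lemma is_prim_cst c : is_prim (cst c) (cst 0).
Proof.
split=> [|a b ab]; first exact: loc_int_cst.
by rewrite Rintegral_cst//= mul0r subrr.
Qed.

Lemma is_primB f1 f2 g1 g2 : is_prim f1 g1 -> is_prim f2 g2 ->
  is_prim (f1 \- f2) (g1 \- g2).
Proof.
move=> h1 /(is_primZ (-1)) h2; have := is_primD h1 h2.
rewrite (_ : _ \+ _ = f1 \- f2); last by apply/funext => x /=; rewrite mulN1r.
by rewrite (_ : _ \+ _ = g1 \- g2)//; apply/funext => x /=; rewrite mulN1r.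
Qed.

Lemma leb_itv_lty a b (b0 b1 : bool) :
  (leb [set` Interval (BSide b0 a) (BSide b1 b)] < +oo)%E.
Proof. by rewrite lebesgue_measure_itv/=; case: ifP => // _; exact: ltry. Qed.

(** Translation invariance of Lebesgue measure, put in the form that makes shifts an instance of the
    change of variables. *)
Lemma transports_shift c : transports (fun x => x + c) (cst 1).
Proof.
have mc : measurable_fun setT (fun x : R => x + c) by exact: measurable_funD.
split=> // B mB.
have -> : (\int[leb]_(x in (fun x => (x + c)%R) @^-1` B) (cst 1%R x)%:E =
    leb ((fun x => (x + c)%R) @^-1` B))%E.
  rewrite -[RHS]mul1e.
  exact: (@integral_cst _ (measurableTypeR R) R leb _
    (measurable_preimage mc mB) 1%E).
apply: (@measure_eq_itvco _ leb (pushforward leb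
  ((fun x => x + c) : measurableTypeR R -> measurableTypeR R))) => //.
  move=> a b ab; transitivity (leb `[a - c, b - c[%classic).
    rewrite [RHS]lebesgue_measure_itv [LHS]lebesgue_measure_itv/= !lte_fin.
    by rewrite ltrD2r -!EFinB opprB addrA subrK.
  rewrite /pushforward; congr leb; apply/seteqP; split => x /=;
    by rewrite !in_itv/= lerBlDr ltrBrDr.
by move=> a b; exact: leb_itv_lty.
Qed.

End primitives.

(** * Integration by parts: a primitive has its density as weak derivative *)

Section weak_derivatives.
Context {R : realType}.
Local Notation leb := (@lebesgue_measure R).
Implicit Types (f g phi : R -> R) (a b c : R).

Lemma EFin_Rintegral (B : set R) g : measurable B -> leb.-integrable B (EFin \o g) ->
  (\int[leb]_(x in B) (g x)%:E = (\int[leb]_(x in B) g x)%R%:E)%E.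
Proof.
move=> mB ig; rewrite /Rintegral fineK//.
exact: (@integrable_fin_num _ (measurableTypeR R) R leb B mB (EFin \o g)).
Qed.

Lemma Rintegral_supp (B : set R) g : (forall x, ~ B x -> g x = 0) ->
  \int[leb]_x g x = \int[leb]_(x in B) g x.
Proof.
move=> g0; rewrite [RHS]Rintegral_mkcond; apply: eq_Rintegral => x _.
by rewrite patchE; case: ifPn => // /negP; rewrite inE => /g0.
Qed.

Lemma loc_int_supp_integrable g a b : loc_int g ->
  (forall x, ~ `[a, b]%classic x -> g x = 0) ->
  leb.-integrable setT (EFin \o g).
Proof.
move=> lg g0; have := lg.2 a b.
rewrite integrable_mkcond//; apply: eq_integrable => // x _ /=.
by rewrite patchE; case: ifPn => // /negP; rewrite inE => /g0 /= ->.
Qed.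

Lemma derivable_is_prim f : (forall x, derivable f x 1) ->
  continuous (derive1 f) -> is_prim f (derive1 f).
Proof.
move=> df cf'; split; first exact: continuous_loc_int.
move=> a b; rewrite le_eqVlt => /predU1P[->|ab].
  by rewrite subrr set_itv1 Rintegral_set1.
have cf x : {for x, continuous f}.
  by apply: differentiable_continuous; apply/derivable1_diffP.
rewrite /Rintegral (@continuous_FTC2 _ (derive1 f) f _ _ ab).
- by rewrite -EFinB.
- exact: continuous_subspaceT.
- split => [x _|//|//].
  + exact: df.
  + by apply: cvg_at_right_filter; exact: cf.
  + by apply: cvg_at_left_filter; exact: cf.
- by [].
Qed.

Lemma test_function_supp phi : test_function phi ->
  exists2 M : R, 0 < M & forall x, M <= `|x| -> phi x = 0 /\ derive1 phi x = 0.
Proof.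
move=> [_ _ [K cK phiK]].
have [M [_ MK]] := compact_bounded cK.
have phi0 x : `|M| + 1 < `|x| -> phi x = 0.
  move=> Mx; apply: phiK => Kx.
  have : `|x| <= `|M| + 1.
    by apply: MK => //; rewrite (le_lt_trans (ler_norm _))// ltrDl.
  by rewrite leNgt Mx.
(* The function [phi] vanishes where the absolute value of [x] exceeds |M| + 1, an open set; |M| + 2
   lies strictly inside, so [phi] is zero near such [x] and its derivative vanishes too. *)
exists (`|M| + 2) => [|x Mx]; first by rewrite ltr_wpDl.
have Mx1 : `|M| + 1 < `|x| by rewrite (lt_le_trans _ Mx)// ltrD2l ltr1n.
split; first exact: phi0.
rewrite derive1E -(derive_cst (0 : R) x 1).
apply: near_eq_derive; near=> z; apply: phi0.
near: z; apply: (@cvgr_norm_gt _ _ _ (nbhs x)) => //.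
exact: cvg_id.
Unshelve. all: by end_near. Qed.

Let triangle : set (measurableTypeR R * measurableTypeR R) :=
  [set z | (z.2 : R) <= (z.1 : R)].

Let measurable_triangle : measurable triangle.
Proof.
rewrite /triangle -[X in measurable X]setTI.
by apply: measurable_fun_le => //; exact: measurable_fun_fst.
Qed.

(** Fubini for [phi' x * g t] on the triangle [t <= x], with [t] cut off to [[- M, M]]. Integrating
    in [t] first gives [phi' x * (f x - f (- M))], integrating in [x] first gives [- (g t * phi t)].
    The term with [f (- M)] drops out because [phi'] has integral zero. *)
Lemma is_prim_by_parts f g phi phi' (M : R) : 0 < M -> is_prim f g ->
  is_prim phi phi' -> continuous phi' ->
  (forall x, M <= `|x| -> phi x = 0 /\ phi' x = 0) ->
  \int[leb]_x (f x * phi' x) = - \int[leb]_x (g x * phi x).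
Proof.
move=> M0 fg pp' cp' supp.
pose g1 t := g t * \1_(`[- M, M]%classic : set R) t.
pose h (z : measurableTypeR R * measurableTypeR R) : R :=
  phi' z.1 * g1 z.2 * \1_triangle z.
have mg1 : measurable_fun setT g1.
  by apply: measurable_funM; [exact: fg.1.1|exact: measurable_indic].
have mh : measurable_fun setT h.
  apply: measurable_funM; last exact: measurable_indic.
  apply: measurable_funM.
    by apply: measurableT_comp => //; exact: pp'.1.1.
  exact: measurableT_comp.
have supp_itv x : ~ `[- M, M]%classic x -> phi x = 0 /\ phi' x = 0.
  move=> nx; apply: supp; rewrite leNgt; apply/negP => xM; apply: nx.
  by rewrite /= in_itv/= -ler_norml ltW.
have ig1 : leb.-integrable setT (EFin \o g1).
  have := fg.1.2 (- M) M; rewrite integrable_mkcond//.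
  apply: eq_integrable => // t _ /=; rewrite patchE /g1 indicE.
  by case: ifPn; rewrite /= ?mulr1 ?mulr0.
have iphi' : leb.-integrable setT (EFin \o phi').
  apply: (@loc_int_supp_integrable _ (- M) M) => [|x /supp_itv[]//].
  exact: pp'.1.
(* Tonelli: the absolute value of [h] is bounded by that of [phi' x * g1 t], a product of two
   integrable functions of one variable. *)
have ih : (leb \x leb)%E.-integrable setT (EFin \o h).
  apply/integrable12ltyP; first exact/measurable_EFinP.
  have /integrableP[_ Iphi'] := iphi'; have /integrableP[_ Ig1] := ig1.
  have fI : (\int[leb]_t `|(g1 t)%:E|)%E \is a fin_num.
    by rewrite ge0_fin_numE// integral_ge0.
  apply: (@le_lt_trans _ _
      (\int[leb]_x (`|(phi' x)%:E| * \int[leb]_t `|(g1 t)%:E|))%E).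
    have mah : measurable_fun setT (abse \o (EFin \o h)).
      by apply: measurableT_comp => //; exact/measurable_EFinP.
    have mabs1 : measurable_fun setT (fun t => `|(g1 t)%:E|%E).
      by apply: measurableT_comp => //; exact/measurable_EFinP.
    apply: ge0_le_integral => //.
    - by move=> x _; apply: integral_ge0.
    - exact: (@measurable_fun_fubini_tonelli_F _ _ (measurableTypeR R)
        (measurableTypeR R) R leb (abse \o (EFin \o h)) mah
        (fun z => abse_ge0 _)).
    - apply: emeasurable_funM => //.
      apply: measurableT_comp => //; apply/measurable_EFinP; exact: pp'.1.1.
    - move=> x _; rewrite -ge0_integralZl//.
      apply: ge0_le_integral => //.
      + apply: measurableT_comp => //; apply/measurable_EFinP.
        by have := measurableT_comp mh (measurable_pair1 x).
      + by apply: measurable_funeM.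
      + move=> t _; rewrite -abseM lee_fin /h /= !normrM ler_piMr//.
        by rewrite indicE; case: (_ \in _); rewrite ?normr1 ?normr0.
  rewrite ge0_integralZr//; last 2 first.
    - by apply: measurableT_comp => //; apply/measurable_EFinP; exact: pp'.1.1.
    - exact: integral_ge0.
  by rewrite muleC lte_mul_pinfty// integral_ge0.
have H1 x : (\int[leb]_t (h (x, t))%:E = (phi' x * (f x - f (- M)))%:E)%E.
  have [xM|xM] := leP M `|x|.
    have [_ px] := supp _ xM; rewrite px mul0r integral0_eq// => t _.
    by rewrite /h /= px !mul0r.
  have /andP[Mx xM'] : - M < x < M by rewrite -ltr_norml.
  rewrite fg.2 ?(ltW Mx)// EFinM -EFin_Rintegral//; last exact: fg.1.2.
  rewrite -integralZl//; last exact: fg.1.2.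
  rewrite [RHS]integral_mkcond; apply: eq_integral => t _.
  rewrite patchE /h /g1 /= !indicE.
  case: ifPn => [|/negP]; rewrite inE/= in_itv/=.
    move=> /andP[Mt tx]; rewrite !mem_set ?mulr1 ?EFinM//=.
    by rewrite in_itv/= Mt (le_trans tx)// ltW.
  move=> nt; have [|] := pselect (`[- M, M]%classic t); last first.
    by move=> nt'; rewrite (memNset nt') mulr0 mulr0 mul0r.
  rewrite /= in_itv/= => /andP[Mt _]; rewrite [_ \in triangle]memNset ?mulr0//.
  by move=> tx; apply: nt; rewrite Mt.
have H2 t : (\int[leb]_x (h (x, t))%:E = (- (g t * phi t))%:E)%E.
  have [tM|nt] := pselect (`[- M, M]%classic t); last first.
    rewrite integral0_eq => [|x _]; last first.
      by rewrite /h /g1 /= indicE (memNset nt) !mulr0 mul0r.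
    by have [-> _] := supp_itv _ nt; rewrite mulr0 oppr0.
  have /andP[Mt tM'] : - M <= t <= M by move: tM; rewrite /= in_itv.
  have -> : - (g t * phi t) = g t * (phi M - phi t).
    have [-> _] := supp M (ler_norm _); first by rewrite sub0r mulrN.
  rewrite pp'.2// EFinM -EFin_Rintegral//; last exact: pp'.1.2.
  rewrite -integralZl//; last exact: pp'.1.2.
  rewrite [RHS]integral_mkcond; apply: eq_integral => x _.
  rewrite patchE /h /g1 /= !indicE (mem_set tM) mulr1.
  case: ifPn => [|/negP]; rewrite inE/= in_itv/=.
    move=> /andP[tx xM]; rewrite !mem_set ?mulr1//.
    by rewrite mulrC EFinM.
  move=> nx; have [tx|tx] := leP t x; last first.
    by rewrite [_ \in triangle]memNset ?mulr0//= ; apply/negP; rewrite -ltNge.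
  have [|_ ->] := supp x; last by rewrite !mul0r.
  have [Mx|xM] := leP M x; first by rewrite (le_trans Mx)// ler_norm.
  by exfalso; apply: nx; rewrite tx ltW.
have := @Fubini _ _ _ _ _ leb leb (EFin \o h) ih.
under eq_integral do rewrite H1.
under [in RHS]eq_integral do rewrite H2.
move=> /(congr1 fine); rewrite -!/(Rintegral _ _ _) => E.
have ip0 : \int[leb]_x phi' x = 0.
  rewrite (@Rintegral_supp `[- M, M]%classic) => [|x /supp_itv[]//].
  rewrite -pp'.2; last by rewrite -subr_ge0 opprK addr_ge0 ?ltW.
  have [-> _] := supp M (ler_norm _).
  by have [|-> _] := supp (- M); rewrite ?normrN ?ler_norm// subrr.
have cf : continuous f := is_prim_continuous fg.
have ifp : leb.-integrable setT (EFin \o (fun x => phi' x * (f x - f (- M)))).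
  by apply: eq_integrable (integrable_fubini_F ih) => // x _; exact: H1.
have cphi : continuous phi := is_prim_continuous pp'.
have igp : leb.-integrable setT (EFin \o (fun t => - (g t * phi t))).
  have [C [_ HC]] := compact_bounded (continuous_compact
    (continuous_subspaceT (A := `[- M, M]%classic) cphi) (@segment_compact _ _ _)).
  have phiC x : `|phi x| <= `|C| + 1.
    have [xM|/supp_itv[-> _]] := pselect (`[- M, M]%classic x).
      apply: HC; last by exists x.
      by rewrite (le_lt_trans (ler_norm _))// ltrDl.
    by rewrite normr0 addr_ge0.
  apply: (@loc_int_supp_integrable _ (- M) M) => [|x /supp_itv[-> _]]; last first.
    by rewrite mulr0 oppr0.
  apply: le_loc_int (loc_intZ (`|C| + 1) fg.1).
    apply: measurableT_comp => //; apply: measurable_funM; first exact: fg.1.1.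
    exact: continuous_measurable_fun.
  apply: aeW => x; rewrite normrN !normrM mulrC.
  by rewrite ler_wpM2r// (le_trans (phiC x))// ler_norm.
transitivity (\int[leb]_x (phi' x * (f x - f (- M)) + f (- M) * phi' x)).
  by apply: eq_Rintegral => x _; rewrite mulrBr (mulrC (f (- M))) subrK mulrC.
rewrite RintegralD//; last first.
  by have := integrableZl _ (f (- M)) iphi'; apply.
rewrite RintegralZl// ip0 mulr0 addr0.
transitivity (\int[leb]_t - (g t * phi t)); first exact: E.
have -> : \int[leb]_x (g x * phi x) = -1 * \int[leb]_t - (g t * phi t).
  rewrite -RintegralZl//; apply: eq_Rintegral => t _.
  by rewrite mulN1r opprK.
by rewrite mulN1r opprK.
Qed.

Lemma is_prim_weak f g : is_prim f g -> weak_derivative f g.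
Proof.
move=> fg; split.
- by apply/loc_intP/continuous_loc_int; exact: is_prim_continuous fg.
- exact/loc_intP/fg.1.
- move=> phi tphi; have [dphi cphi' _] := tphi.
  have [M M0 supp] := test_function_supp tphi.
  apply: (@is_prim_by_parts _ _ _ _ M) => //.
  exact: derivable_is_prim.
Qed.

End weak_derivatives.

(** * The lemma of du Bois-Reymond: weak derivatives come from primitives *)

Section primitives_and_weak_derivatives.
Context {R : realType}.
Local Notation leb := (@lebesgue_measure R).
Implicit Types (f g phi : R -> R) (a b c : R).

Lemma ae_eq0_continuous f : continuous f -> (\forall x \ae leb, f x = 0) ->
  forall x, f x = 0.
Proof.
move=> cf [N [mN N0 fN]] x; apply/eqP; apply: contrapT => /negP fx0.
have /nbhs_ballP[e /= e0 xe] : \forall z \near x, f z != 0.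
  by apply: (@cvgr_neq0 _ _ _ (nbhs x) _ f (f x)); [exact: cf|exact: fx0].
have : (leb (ball x e) <= leb N)%E.
  apply: le_measure; rewrite ?inE//; first exact: measurable_ball.
  by move=> z xz; apply: fN => /= fz0; have := xe _ xz; rewrite fz0 eqxx.
rewrite [X in (_ <= X)%E]N0 lebesgue_measure_ball; last exact: ltW.
by rewrite lee_fin leNgt pmulrn_lgt0// e0.
Qed.

Section du_Bois_Reymond.
Variable k : R -> R.
Hypothesis ck : continuous k.
Hypothesis k0 : forall phi, test_function phi ->
  \int[leb]_x (k x * derive1 phi x) = 0.

(** The primitive of [psi] from minus infinity vanishes to the left of [- N] because [psi] does, and
    to the right of [N] because the total integral is zero; so its support is compact. *)
Lemma test_function_primitive psi (N : R) : 0 < N -> continuous psi ->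
  (forall x, N < `|x| -> psi x = 0) -> \int[leb]_x psi x = 0 ->
  exists2 phi, test_function phi & derive1 phi = psi.
Proof.
move=> N0 cpsi supp int0.
have ipsi : leb.-integrable setT (EFin \o psi).
  apply: (@loc_int_supp_integrable _ _ (- N) N).
    exact: continuous_loc_int.
  move=> x /= nx; apply: supp; rewrite ltNge ler_norml.
  by apply/negP; move: nx; rewrite in_itv.
pose phi x := \int[leb]_(t in `]-oo, x]%classic) psi t.
have dphi x : derivable phi x 1 /\ derive1 phi x = psi x.
  apply: (@continuous_FTC1 R psi -oo%O x (x + 1)) => //.
  - by rewrite ltrDl.
  - by apply: integrableS ipsi.
  - by rewrite ltNyr.
  - exact: cpsi.
have dphiE : derive1 phi = psi by apply/funext => x; exact: (dphi x).2.
exists phi => //; split.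
- by move=> x; exact: (dphi x).1.
- by rewrite dphiE.
exists `[- N, N]%classic; first exact: segment_compact.
move=> x /= /negP; rewrite in_itv/= negb_and -!ltNge => /orP[xN|Nx].
  rewrite /phi /Rintegral integral0_eq// => t /=; rewrite in_itv/= => tx.
  by rewrite supp// ltr_normr orbC ltrNr (le_lt_trans tx).
rewrite /phi -int0 [RHS](@Rintegral_supp _ `]-oo, x]%classic)// => t /= /negP.
rewrite in_itv/= -ltNge => xt.
by rewrite supp// ltr_normr (lt_trans Nx).
Qed.

(** Let [m = D * theta], where [theta] is a tent at [a] of radius 1. Then [m x - m (x - s)] has
    integral zero, hence is the derivative of a test function. Moving the shift from [m] to [k]
    turns the hypothesis into the vanishing of the integral of [D ^ 2 * theta]; this integrand is
    continuous and nonnegative, so it is zero at [a], where [theta] is 1. *)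
Lemma du_Bois_Reymond a b : k a = k b.
Proof.
pose s := b - a.
pose D x := k x - k (x + s).
pose theta x := Num.max 0 (1 - `|x - a|).
pose m x := D x * theta x.
have cshift c : continuous (fun x : R => x + c).
  by move=> x; apply: cvgD; [exact: cvg_id|exact: cvg_cst].
have cD : continuous D.
  move=> x; apply: cvgB; first exact: ck.
  by apply: (@continuous_comp _ _ _ (fun x => x + s) k); [exact: cshift|exact: ck].
have ctheta : continuous theta.
  move=> x; apply: (@continuous_max R R (cst 0) (fun x => 1 - `|x - a|)).
    exact: cvg_cst.
  apply: cvgB; first exact: cvg_cst.
  by apply: cvg_norm; exact: cshift.
have cm : continuous m by move=> x; apply: cvgM; [exact: cD|exact: ctheta].
have cms : continuous (fun x => m (x - s)).
  by move=> x; apply: (@continuous_comp _ _ _ (fun x => x - s) m);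
    [exact: cshift|exact: cm].
(* Large enough to contain the support of [m], which is within distance 1 of [a], and its translate
   by [s]. *)
pose N := `|a| + `|s| + 1.
have N0 : 0 < N by rewrite ltr_wpDl// addr_ge0.
have supp_m x : 1 < `|x - a| -> m x = 0.
  move=> xa; rewrite /m /theta (max_idPl _) ?mulr0// subr_le0 ltW//.
have supp1 x : N < `|x| -> m x = 0.
  move=> Nx; apply: supp_m; rewrite -(ltrD2r `|a|).
  have : `|x| <= `|x - a| + `|a| by rewrite -{1}(subrK a x) ler_normD.
  by apply: lt_le_trans; rewrite (le_lt_trans _ Nx)// /N addrC lerD2r lerDl.
have supp2 x : N < `|x| -> m (x - s) = 0.
  move=> Nx; apply: supp_m; rewrite -(ltrD2r (`|s| + `|a|)).
  have : `|x| <= `|x - s - a| + (`|s| + `|a|).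
    rewrite -{1}(subrK s x) -{1}(subrK a (x - s)).
    by rewrite -addrA (le_trans (ler_normD _ _))// lerD2l addrC ler_normD.
  by apply: lt_le_trans; rewrite (le_lt_trans _ Nx)// /N [leRHS]addrC (addrC `|a|).
have int_supp h : continuous h -> (forall x, N < `|x| -> h x = 0) ->
    leb.-integrable setT (EFin \o h).
  move=> ch suppN; apply: (@loc_int_supp_integrable _ _ (- N) N).
    exact: continuous_loc_int.
  move=> x /= nx; apply: suppN; rewrite ltNge ler_norml.
  by apply/negP; move: nx; rewrite in_itv.
have shift (h : R -> R) : measurable_fun setT h ->
    \int[leb]_x h x = \int[leb]_x h (x + s).
  move=> mh; rewrite (transport_Rintegral (transports_shift s))// preimage_setT.
  by apply: eq_Rintegral => x _; rewrite mulr1.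
have [|||phi tphi phiE] := @test_function_primitive (fun x => m x - m (x - s)) N N0.
- by move=> x; apply: cvgB; [exact: cm|exact: cms].
- by move=> x Nx; rewrite supp1// supp2// subrr.
- rewrite RintegralB//; [|exact: int_supp|exact: int_supp].
  rewrite [X in _ - X]shift; last exact: continuous_measurable_fun.
  by under [X in _ - X]eq_Rintegral do rewrite addrK; rewrite subrr.
have ckm : continuous (fun x => k x * m x).
  by move=> x; apply: cvgM; [exact: ck|exact: cm].
have ckms : continuous (fun x => k x * m (x - s)).
  by move=> x; apply: cvgM; [exact: ck|exact: cms].
have ckms' : continuous (fun x => k (x + s) * m x).
  move=> x; apply: cvgM; last exact: cm.
  by apply: (@continuous_comp _ _ _ (fun x => x + s) k); [exact: cshift|exact: ck].
have cDm : continuous (fun x => D x * m x).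
  by move=> x; apply: cvgM; [exact: cD|exact: cm].
have E : \int[leb]_x (D x * m x) = 0.
  rewrite -(k0 tphi) phiE.
  under [RHS]eq_Rintegral do rewrite mulrBr.
  rewrite RintegralB//; last 2 first.
    by apply: int_supp => // x Nx; rewrite supp1 ?mulr0.
    by apply: int_supp => // x Nx; rewrite supp2 ?mulr0.
  rewrite [X in _ - X]shift; last exact: continuous_measurable_fun.
  under [X in _ - X]eq_Rintegral do rewrite addrK.
  rewrite -RintegralB//; last 2 first.
    by apply: int_supp => // x Nx; rewrite supp1 ?mulr0.
    by apply: int_supp => // x Nx; rewrite supp1 ?mulr0.
  by apply: eq_Rintegral => x _; rewrite /D mulrBl.
have Dm0 x : 0 <= D x * m x.
  by rewrite /m mulrA -expr2 mulr_ge0 ?sqr_ge0// le_max lexx.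
have iDm : leb.-integrable setT (EFin \o (fun x => D x * m x)).
  by apply: int_supp => // x Nx; rewrite supp1 ?mulr0.
have /(ae_eq0_continuous cDm) /(_ a) : \forall x \ae leb, D x * m x = 0.
  have : (\int[leb]_(x in setT) `|(EFin \o (fun x => D x * m x)%R) x| = 0)%E.
    apply: etrans (etrans (EFin_Rintegral measurableT iDm) (congr1 EFin E)).
    by apply: eq_integral => x _ /=; rewrite ger0_norm.
  move=> /(ae_eq_integral_abs leb measurableT (measurable_int _ iDm)).
  by apply: aeS => x /(_ I) /= [].
rewrite /m /theta subrr normr0 subr0 (max_idPr _)// mulr1 => /eqP.
by rewrite mulf_eq0 orbb subr_eq0 => /eqP; rewrite /s addrC subrK.
Qed.

End du_Bois_Reymond.

(** The difference between [f] and the primitive of [g] is continuous with zero weak derivative,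
    hence constant. *)
Lemma weak_is_prim f g : continuous f -> weak_derivative f g -> is_prim f g.
Proof.
move=> cf [lf /loc_intP lg fg].
have pG := is_prim_primitive lg.
have [_ _ Gg] := is_prim_weak pG.
have cG := is_prim_continuous pG.
have k0 phi : test_function phi ->
    \int[leb]_x ((f x - primitive g x) * derive1 phi x) = 0.
  move=> tphi; have [_ cphi' _] := tphi.
  have [M M0 supp] := test_function_supp tphi.
  have int_supp (h : R -> R) : continuous h ->
      leb.-integrable setT (EFin \o (fun x => h x * derive1 phi x)).
    move=> ch; apply: (@loc_int_supp_integrable _ _ (- M) M).
      by apply: continuous_loc_int => x; apply: cvgM; [exact: ch|exact: cphi'].
    move=> x /= nx; have [|_ ->] := supp x; last by rewrite mulr0.
    rewrite leNgt; apply/negP => xM; apply: nx.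
    by rewrite in_itv/= -ler_norml ltW.
  under eq_Rintegral do rewrite mulrBl.
  rewrite RintegralB//; [|exact: int_supp|exact: int_supp].
  by rewrite fg// Gg// subrr.
split=> // a b ab; rewrite -(pG.2 a b ab).
have cfG : continuous (fun x => f x - primitive g x).
  by move=> x; apply: cvgB; [exact: cf|exact: cG].
have /eqP := du_Bois_Reymond cfG k0 a b.
by rewrite subr_eq addrAC eq_sym subr_eq => /eqP; lra.
Qed.

Lemma weak_derivativeP f g : continuous f ->
  weak_derivative f g <-> is_prim f g.
Proof. by move=> cf; split; [exact: weak_is_prim|exact: is_prim_weak]. Qed.

End primitives_and_weak_derivatives.

(** * Periodic Lebesgue and Sobolev spaces *)

Section Lfun_characterizations.
Context d (T : measurableType d) (R : realType).
Variable mu : {measure set T -> \bar R}.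

Lemma Lfun_ooP (f : T -> R) : f \in Lfun mu +oo%E <->
  measurable_fun setT f /\ exists C : R, \forall x \ae mu, `|f x| <= C.
Proof.
split=> [/andP[]|[mf [C hC]]].
  rewrite !inE/= /finite_norm unlock => mf.
  (* The norm is an essential supremum only if the whole space has positive measure; for the zero
     measure any bound holds almost everywhere. *)
  case: ifPn => [mu0 h|mu0 _]; split => //.
    have [C hC] : exists C : R, (ess_sup mu (abse \o (EFin \o f)) <= C%:E)%E.
      move: h; case: (ess_sup _ _) => [r _||]//; first by exists r.
      by move=> _; exists 0; exact: leNye.
    exists C; move/ess_supP : hC; apply: filterS => x.
    by rewrite /= lee_fin.
  exists 0; apply: measure0_ae; apply/eqP.
  by rewrite eq_le measure_ge0 andbT leNgt.
apply/andP; rewrite !inE/= /finite_norm unlock; split => //.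
case: ifPn => [mu0|//].
apply: (@le_lt_trans _ _ C%:E); last exact: ltry.
by apply/ess_supP; apply: filterS hC => x; rewrite /= lee_fin.
Qed.

Lemma Lfun1P (f : T -> R) : f \in Lfun mu 1%E <->
  mu.-integrable setT (EFin \o f).
Proof.
split=> [/andP[]|/integrableP[/measurable_EFinP mf fy]].
  rewrite !inE/= /finite_norm Lnorm1 => mf fy; apply/integrableP; split => //.
  exact/measurable_EFinP.
by apply/andP; rewrite !inE/= /finite_norm Lnorm1.
Qed.

Lemma Lfun2P (f : T -> R) : f \in Lfun mu 2%:E <->
  measurable_fun setT f /\ (\int[mu]_x (f x ^+ 2)%:E < +oo)%E.
Proof.
have E : (\int[mu]_x (f x ^+ 2)%:E =
    'N[mu]_2%:E[EFin \o f] `^ 2)%E.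
  rewrite poweR_Lnorm ?pnatr_eq0//; apply: eq_integral => x _ /=.
  by rewrite powR_mulrn// real_normK// num_real.
split=> [/andP[]|[mf fy]].
  by rewrite !inE/= /finite_norm => mf fy; split => //; rewrite E poweR_lty.
apply/andP; rewrite !inE/= /finite_norm; split => //.
by apply: (@lty_poweRy _ _ 2); rewrite ?pnatr_eq0// -E.
Qed.

End Lfun_characterizations.

Section periodic.
Context {R : realType}.
Local Notation leb := (@lebesgue_measure R).
Local Notation Mclass :=
  {mfun_ leb, (measurableTypeR R) >-> (measurableTypeR R)}.
Implicit Types (f g : R -> R) (a b c C : R).

Lemma ge0_integral_leb_itv a b (f : R -> \bar R) : measurable_fun setT f ->
  (forall x, (0 <= f x)%E) ->
  (\int[leb_itv a b]_x f x = \int[leb]_(x in `[a, b]) f x)%E.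
Proof.
move=> mf f0.
have mab : measurable (`[a, b]%classic : set (measurableTypeR R)) by [].
have mabC : measurable (~` `[a, b]%classic : set (measurableTypeR R)).
  exact: measurableC.
rewrite -(setUv (`[a, b]%classic : set (measurableTypeR R))).
rewrite (@ge0_integral_setU _ (measurableTypeR R) R _ _ _ mab mabC); last 3 first.
- by rewrite setUv.
- by move=> x _; exact: f0.
- by apply/disj_setPS => x [].
rewrite (@eq_measure_integral _ (measurableTypeR R) R _ leb); last first.
  by move=> A mA Aab; rewrite /leb_itv /= /mrestr setIidl.
rewrite (@eq_measure_integral _ (measurableTypeR R) R _ mzero (leb_itv a b)).
  by rewrite integral_measure_zero adde0.
move=> A mA Aab; rewrite /leb_itv /= /mrestr /mzero.
have /disjoints_subset -> := Aab.
by rewrite measure0.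
Qed.

Lemma ae_leb_itv a b (P : R -> Prop) :
  (\forall x \ae leb_itv a b, P x) <->
  (\forall x \ae leb, a <= x <= b -> P x).
Proof.
split=> -[N [mN N0 PN]].
  exists (N `&` `[a, b]%classic); split.
  - exact: measurableI.
  - exact: N0.
  - move=> x /= /not_implyP[xab nP]; split; first exact: PN.
    by rewrite /= in_itv.
exists (N `|` ~` `[a, b]%classic); split.
- by apply: measurableU => //; exact: measurableC.
- rewrite /leb_itv /= /mrestr setIUl setICl setU0.
  apply: (subset_measure0 (B := N)) => //; exact: measurableI.
- move=> x /= nP; have [xab|] := pselect (`[a, b]%classic x); last by right.
  by left; apply: PN => /= h; apply: nP; apply: h; move: xab; rewrite /= in_itv.
Qed.

Lemma ae_shift c (P : R -> Prop) : (\forall x \ae leb, P x) ->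
  \forall x \ae leb, P (x + c).
Proof.
move=> /(transport_ae (transports_shift c)); apply: aeS => x [/eqP|//].
by rewrite oner_eq0.
Qed.

(** Induction widens the interval by one unit on each side: a point of the new left piece inherits
    [P] from [x + 1], one of the new right piece from [x - 1]. *)
Lemma ae_itv01 (P : R -> Prop) : (\forall x \ae leb, P (x + 1) <-> P x) ->
  (\forall x \ae leb, 0 <= x <= 1 -> P x) -> \forall x \ae leb, P x.
Proof.
move=> Pper P01.
have H (n : nat) : \forall x \ae leb, - n%:R <= x <= n.+1%:R -> P x.
  elim: n => [|n IH]; first by rewrite oppr0.
  have IH2 := aeS2 (fun x p q => conj p q) (ae_shift 1 IH) (ae_shift (-1) IH).
  apply: (aeS3 _ Pper (ae_shift (-1) Pper) (aeS2 (fun x p q => conj p q) IH IH2)).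
  move=> x Px Px1 [IHx [IHp IHm]] /andP[nx xn].
  have [x0|x0] := ltP x (- n%:R).
    apply/Px/IHp; move: nx x0; rewrite -!natr1 => nx x0.
    have n0 : (0 : R) <= n%:R by [].
    by apply/andP; split; lra.
  have [xn1|xn1] := leP x n.+1%:R; first by apply: IHx; rewrite x0.
  move: Px1; rewrite subrK => -[_ +]; apply.
  apply: IHm; move: xn xn1; rewrite -!natr1 => xn xn1.
  have n0 : (0 : R) <= n%:R by [].
  by apply/andP; split; lra.
have := @ae_foralln _ (measurableTypeR R) R leb _ H.
apply: aeS => x /(_ (Num.truncn `|x|).+1); apply.
have h := truncnS_gt `|x|.
rewrite lerNl (le_trans (ler_norm _)) ?normrN ?(ltW h)//=.
by rewrite (le_trans (ler_norm _))// (le_trans (ltW h))// ler_nat.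
Qed.

Definition ae_per f : Prop := \forall x \ae leb, f (x + 1) = f x.

Lemma ae_per_bounded f C : ae_per f ->
  (\forall x \ae leb, 0 <= x <= 1 -> `|f x| <= C) ->
  \forall x \ae leb, `|f x| <= C.
Proof. by move=> pf; apply: ae_itv01; apply: aeS pf => x ->. Qed.

Lemma ae_per_eq f g : (\forall x \ae leb, f x = g x) -> ae_per f -> ae_per g.
Proof.
move=> fg; apply: aeS3 fg (ae_shift 1 fg) => x <- <-.
by move=> ->.
Qed.

Lemma is_prim_shift f g c : is_prim f g ->
  is_prim (fun x => f (x + c)) (fun x => g (x + c)).
Proof.
move=> [[mg ig] fg].
have mgc : measurable_fun setT (fun x : R => g (x + c)).
  by apply: measurableT_comp => //; exact: measurable_funD.
have pre a b : `[a, b]%classic = (fun x : R => x + c) @^-1` `[a + c, b + c].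
  by apply/seteqP; split => x /=; rewrite !in_itv/= !lerD2r.
split=> [|a b ab].
  split=> // a b; have := ig (a + c) (b + c).
  rewrite (transport_integrable (transports_shift c))// -pre.
  by apply: eq_integrable => // x _ /=; rewrite mulr1.
rewrite (fg (a + c) (b + c)) ?lerD2r//.
rewrite (transport_Rintegral (transports_shift c))// -pre.
by apply: eq_Rintegral => x _; rewrite mulr1.
Qed.

Lemma is_prim_per f g c : is_prim f g -> (forall x, f (x + 1) = f x + c) ->
  ae_per g.
Proof.
move=> fg pf; have fg1 := is_prim_shift 1 fg.
apply: is_prim_uniq fg1 _.
rewrite (_ : (fun x => _) = f \+ cst c); last by apply/funext => x; rewrite pf.
apply: is_prim_ae (is_primD fg (is_prim_cst c)); first exact: fg.1.1.
by apply: aeW => x /=; rewrite addr0.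
Qed.

(** Shifting a segment by 1 does not change the integral of [g], so [f (x + 1) - f x] does not
    depend on [x]. *)
Lemma per_Rintegral f g : is_prim f g -> ae_per g ->
  forall a, \int[leb]_(x in `[a, a + 1]) g x = \int[leb]_(x in `[0, 1]) g x.
Proof.
move=> fg pg a; have -> : `[(0 : R), 1] = `[0, 0 + 1] by rewrite add0r.
rewrite -fg.2 ?lerDl// -fg.2 ?lerDl//.
have fg1 := is_prim_shift 1 fg.
have H x y : x <= y -> f (y + 1) - f (x + 1) = f y - f x.
  move=> xy; rewrite fg1.2// fg.2//; apply: eq_ae_Rintegral => //.
  - exact: fg1.1.1.
  - exact: fg.1.1.
by have [/H|/ltW/H] := leP 0 a; rewrite add0r; lra.
Qed.

Lemma continuous_per_bounded f : continuous f -> (forall x, f (x + 1) = f x) ->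
  exists C, \forall x \ae leb, `|f x| <= C.
Proof.
move=> cf pf; have [C [_ HC]] := compact_bounded (continuous_compact
    (continuous_subspaceT (A := `[(0 : R), 1]%classic) cf) (@segment_compact _ _ _)).
exists (`|C| + 1); apply: ae_per_bounded; first by apply: aeW.
apply: aeW => x x01; apply: HC; last by exists x => //; rewrite /= in_itv.
by rewrite (le_lt_trans (ler_norm _))// ltrDl.
Qed.

Lemma Lp_per1P f : Lp_per 1%E f <->
  [/\ measurable_fun setT f, leb.-integrable `[0, 1] (EFin \o f) & ae_per f].
Proof.
have E : measurable_fun setT f -> (\int[leb_itv 0 1]_x `|(EFin \o f) x| =
    \int[leb]_(x in `[0%R, 1%R]) `|(EFin \o f) x|)%E.
  move=> mf; apply: ge0_integral_leb_itv => //.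
  by apply: measurableT_comp => //; exact/measurable_EFinP.
split=> [[/Lfun1P/integrableP[/measurable_EFinP mf fy] pf]|[mf /integrableP[_ fy] pf]].
  split => //; apply/integrableP; split; last by rewrite -E.
  by apply/measurable_EFinP; exact: measurable_funTS.
split => //; apply/Lfun1P/integrableP; split; first exact/measurable_EFinP.
by rewrite E.
Qed.

Lemma Lp_per2P f : Lp_per 2%:E f <->
  [/\ measurable_fun setT f, (\int[leb]_(x in `[0%R, 1%R]) (f x ^+ 2)%:E < +oo)%E
    & ae_per f].
Proof.
have E : measurable_fun setT f -> (\int[leb_itv 0 1]_x (f x ^+ 2)%:E =
    \int[leb]_(x in `[0%R, 1%R]) (f x ^+ 2)%:E)%E.
  move=> mf; apply: ge0_integral_leb_itv => [|x].
    by apply/measurable_EFinP; exact: measurable_funX.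
  by rewrite lee_fin sqr_ge0.
split=> [[/Lfun2P[mf fy] pf]|[mf fy pf]].
  by split => //; rewrite -E.
by split => //; apply/Lfun2P; split => //; rewrite E.
Qed.

Lemma Lp_perooP f : Lp_per +oo%E f <->
  [/\ measurable_fun setT f, exists C, \forall x \ae leb, `|f x| <= C
    & ae_per f].
Proof.
split=> [[/Lfun_ooP[mf [C fC]] pf]|[mf [C fC] pf]].
  by split => //; exists C; apply: ae_per_bounded => //; exact/ae_leb_itv.
split => //; apply/Lfun_ooP; split => //; exists C; apply/ae_leb_itv.
by apply: aeS fC.
Qed.

(** The class of [g] is a weak derivative of [f], so the choice made by [wderiv] is not the default
    value. *)
Lemma is_prim_wderiv f g : is_prim f g -> is_prim f (wderiv f).
Proof.
move=> fg; have cf := is_prim_continuous fg.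
rewrite /wderiv; case: xgetP => [h _ /(weak_derivativeP _ cf)//|h].
exfalso; apply: (h (ae_class g)); apply/(weak_derivativeP _ cf).
apply: (is_prim_ae _ _ fg); first exact: measurable_class.
have := ae_classE fg.1.1.
by apply: aeS => x ->.
Qed.

Lemma wderivE f g : is_prim f g -> \forall x \ae leb, wderiv f x = g x.
Proof. by move=> fg; exact: (is_prim_uniq (is_prim_wderiv fg) fg). Qed.

Lemma is_prim_class f g : is_prim f g -> is_prim f (ae_class g).
Proof.
move=> fg; apply: (is_prim_ae _ _ fg); first exact: measurable_class.
have := ae_classE fg.1.1.
by apply: aeS => x ->.
Qed.

Lemma W1_perP p f : W1_per p f <->
  [/\ forall x, f (x + 1) = f x, Lp_per p f &
      exists2 g : Mclass, is_prim f g & Lp_per p g].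
Proof.
split=> [[cf pf Lf [g /(weak_derivativeP _ cf) fg Lg]]|[pf Lf [g fg Lg]]].
  by split=> //; exists g.
have cf := is_prim_continuous fg.
by split=> //; exists g => //; apply/weak_derivativeP.
Qed.

(** A primitive is continuous, hence integrable over a period, and its density inherits periodicity;
    what is left of the Sobolev condition is the existence of the density. *)
Lemma W1_per1P f : W1_per 1%E f <->
  (forall x, f (x + 1) = f x) /\ exists g, is_prim f g.
Proof.
split=> [/W1_perP[pf _ [g fg _]]|[pf [g fg]]]; first by split => //; exists g.
have lf := continuous_loc_int (is_prim_continuous fg).
have fgc := is_prim_class fg.
apply/W1_perP; split => //.
  by apply/Lp_per1P; split; [exact: lf.1|exact: lf.2|exact: aeW].
exists (ae_class g) => //; apply/Lp_per1P; split.
- exact: fgc.1.1.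
- exact: fgc.1.2.
- by apply: (is_prim_per (c := 0) fgc) => x; rewrite addr0.
Qed.

Lemma W1_perooP f : W1_per +oo%E f <->
  (forall x, f (x + 1) = f x) /\
  exists2 g, is_prim f g & exists C, \forall x \ae leb, `|g x| <= C.
Proof.
split=> [/W1_perP[pf _ [g fg /Lp_perooP[_ gC _]]]|[pf [g fg [C gC]]]].
  by split => //; exists g.
have cf := is_prim_continuous fg.
have fgc := is_prim_class fg.
apply/W1_perP; split => //.
  apply/Lp_perooP; split; [exact: (continuous_loc_int cf).1| |exact: aeW].
  exact: continuous_per_bounded.
exists (ae_class g) => //; apply/Lp_perooP; split.
- exact: fgc.1.1.
- by exists C; apply: aeS2 gC (ae_classE fg.1.1) => x gC ->.
- by apply: (is_prim_per (c := 0) fgc) => x; rewrite addr0.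
Qed.

Lemma H1_perP f : H1_per f <->
  (forall x, f (x + 1) = f x) /\
  exists2 g, is_prim f g & (\int[leb]_(x in `[0%R, 1%R]) (g x ^+ 2)%:E < +oo)%E.
Proof.
split=> [/W1_perP[pf _ [g fg /Lp_per2P[_ gy _]]]|[pf [g fg gy]]].
  by split => //; exists g.
have cf := is_prim_continuous fg.
have fgc := is_prim_class fg.
apply/W1_perP; split => //.
  apply/Lp_per2P; split; [exact: (continuous_loc_int cf).1| |exact: aeW].
  have cff : continuous (fun x => f x ^+ 2).
    by move=> x; apply: cvgM; exact: cf.
  by apply: integrable_lty => //; exact: (continuous_loc_int cff).2.
exists (ae_class g) => //; apply/Lp_per2P; split.
- exact: fgc.1.1.
- apply: le_lt_trans gy; rewrite le_eqVlt; apply/orP; left; apply/eqP.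
  apply: ae_eq_integral => //.
  + apply/measurable_EFinP/measurable_funTS/measurable_funX; exact: fgc.1.1.
  + apply/measurable_EFinP/measurable_funTS/measurable_funX; exact: fg.1.1.
  + by apply: aeS (ae_classE fg.1.1) => x -> _.
- by apply: (is_prim_per (c := 0) fgc) => x; rewrite addr0.
Qed.

Lemma LinfP f : Linf f <->
  measurable_fun setT f /\ exists C, \forall x \ae leb, `|f x| <= C.
Proof. exact: Lfun_ooP. Qed.

Lemma Linf_locP f : Linf_loc f <-> measurable_fun setT f /\
  forall a b, exists C, \forall x \ae leb, a <= x <= b -> `|f x| <= C.
Proof.
split=> [h|[mf h] a b].
  split=> [|a b]; first by have /Lfun_ooP[] := h 0 1.
  by have /Lfun_ooP[_ [C hC]] := h a b; exists C; exact/ae_leb_itv.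
apply/Lfun_ooP; split=> //; have [C hC] := h a b.
by exists C; exact/ae_leb_itv.
Qed.

Lemma continuous_Linf_loc f : continuous f -> Linf_loc f.
Proof.
move=> cf; apply/Linf_locP; split; first exact: (continuous_loc_int cf).1.
move=> a b; have [C [_ HC]] := compact_bounded (continuous_compact
    (continuous_subspaceT (A := `[a, b]%classic) cf) (@segment_compact _ _ _)).
exists (`|C| + 1); apply: aeW => x xab; apply: HC.
  by rewrite (le_lt_trans (ler_norm _))// ltrDl.
by exists x => //; rewrite /= in_itv.
Qed.

Lemma W1inf_locP f : W1inf_loc f <->
  exists2 g, is_prim f g &
    forall a b, exists C, \forall x \ae leb, a <= x <= b -> `|g x| <= C.
Proof.
split=> [[cf _ [g /(weak_derivativeP _ cf) fg /Linf_locP[_ hg]]]|[g fg hg]].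
  by exists g.
have cf := is_prim_continuous fg.
have fgc := is_prim_class fg.
split=> //; first exact: continuous_Linf_loc.
exists (ae_class g); first exact/weak_derivativeP.
apply/Linf_locP; split; first exact: fgc.1.1.
move=> a b; have [C hC] := hg a b; exists C.
by apply: aeS2 hC (ae_classE fg.1.1) => x hC ->.
Qed.

End periodic.

(** * Monotone changes of variables *)

Section monotone_transport.
Context {R : realType}.
Local Notation leb := (@lebesgue_measure R).
Implicit Types (f g u w : R -> R) (a b c : R).
Variables (y y' : R -> R).
Hypothesis yy' : transports y y'.
Hypothesis ynd : {homo y : s t / s <= t}.

(* The preimage of [`[y a, y b]] exceeds [`[a, b]] only by points sent to [y a]
   or [y b], where [y'] vanishes almost everywhere. *)
Lemma itv_transport_ae a b : a <= b ->
  \forall x \ae leb, y' x = 0 \/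
    (`[y a, y b]%classic (y x) <-> `[a, b]%classic x).
Proof.
move=> ab.
have N0 : leb.-negligible [set y a; y b].
  exists [set y a; y b]; split => //.
    by apply: measurableU; exact: measurable_set1.
  apply: countable_lebesgue_measure0; apply: finite_set_countable.
  exact: finite_set2.
apply: aeS (transport_null yy' N0) => x h.
have [/h|/= nx] := pselect ([set y a; y b] (y x)); first by left.
right; rewrite /= !in_itv/=; split => /andP[h1 h2].
  apply/andP; split; rewrite leNgt; apply/negP => xa; apply: nx.
    by left; apply/eqP; rewrite eq_le h1 ynd// ltW.
  by right; apply/eqP; rewrite eq_le h2 ynd// ltW.
by rewrite !ynd.
Qed.

Lemma transport_measurable f : measurable_fun setT f ->
  measurable_fun setT (fun x => f (y x) * y' x).
Proof.
case: yy' => my my' _ _ mf.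
by apply: measurable_funM => //; exact: measurableT_comp.
Qed.

Lemma itv_transport_patch a b f : a <= b ->
  \forall x \ae leb,
    ((EFin \o (fun x => f (y x) * y' x)) \_ (y @^-1` `[y a, y b])) x =
    ((EFin \o (fun x => f (y x) * y' x)) \_ `[a, b]) x.
Proof.
move=> ab; apply: aeS (itv_transport_ae ab) => x; rewrite !patchE => h.
case: ifPn => [|/negP]; case: ifPn => [|/negP] => //=; rewrite !inE /=.
- by move=> nx yx; case: h => [->|[/(_ yx)//]]; rewrite mulr0.
- by move=> yx nx; case: h => [->|[_ /(_ yx)//]]; rewrite mulr0.
Qed.

Lemma itv_transport_integral a b f : a <= b -> measurable_fun setT f ->
  (\int[leb]_(x in `[a, b]) (f (y x) * y' x)%:E =
   \int[leb]_(x in `[y a, y b]) (f x)%:E)%E.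
Proof.
move=> ab mf; have mF := transport_measurable mf.
have my : measurable_fun setT y by case: yy'.
rewrite (transport_integral yy')//.
rewrite integral_mkcond [RHS]integral_mkcond.
apply: ae_eq_integral => //.
- apply/(measurable_restrictT _ _).1 => //.
  by apply/measurable_EFinP; exact: measurable_funTS.
- apply/(measurable_restrictT _ _).1; first exact: measurable_preimage.
  by apply/measurable_EFinP; exact: measurable_funTS.
- by apply: aeS (itv_transport_patch f ab) => x E _; exact/esym/E.
Qed.

Lemma itv_transport_integrable a b f : a <= b -> measurable_fun setT f ->
  leb.-integrable `[y a, y b] (EFin \o f) ->
  leb.-integrable `[a, b] (EFin \o (fun x => f (y x) * y' x)).
Proof.
move=> ab mf; have mF := transport_measurable mf.
have my : measurable_fun setT y by case: yy'.
move=> /integrableP[_ fy]; apply/integrableP; split.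
  by apply/measurable_EFinP; exact: measurable_funTS.
have := @itv_transport_integral a b (fun x => `|f x|) ab.
have mnf : measurable_fun setT (fun x => `|f x|) by exact: measurableT_comp.
move=> /(_ mnf) E.
rewrite [ltLHS](_ : _ = (\int[leb]_(x in `[a, b]) (`|f (y x)| * y' x)%:E)%E).
  by rewrite E.
apply: eq_integral => x _ /=; rewrite normrM [`|y' x|]ger0_norm//.
by case: yy'.
Qed.

Lemma itv_transport_Rintegral a b f : a <= b -> measurable_fun setT f ->
  \int[leb]_(x in `[a, b]) (f (y x) * y' x) = \int[leb]_(x in `[y a, y b]) f x.
Proof. by move=> ab mf; rewrite /Rintegral itv_transport_integral. Qed.

Lemma transport_loc_int w : loc_int w -> loc_int (fun x => w (y x) * y' x).
Proof.
move=> [mw iw]; split; first exact: transport_measurable.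
move=> a b; have [ab|ba] := leP a b; first exact: itv_transport_integrable.
by rewrite set_itv_ge -?ltNge//; exact: integrable_set0.
Qed.

(** Chain rule in integrated form: transporting the integral of [w] over [[y a, y b]] back to
    [[a, b]] exhibits the density of the composite. *)
Lemma is_prim_comp u w : is_prim u w ->
  is_prim (u \o y) (fun x => w (y x) * y' x).
Proof.
move=> [lw uw]; split; first exact: transport_loc_int.
move=> a b ab; rewrite itv_transport_Rintegral//; last exact: lw.1.
by rewrite -uw//; exact: ynd.
Qed.

(** The chain rule for the identity. A push-forward identity thus determines the derivative of [y],
    which is how [cumul_inv] is differentiated. *)
Lemma transports_is_prim : is_prim y y'.
Proof.
apply: (is_prim_ae _ _ (is_prim_comp (@is_prim_id R))); first by case: yy'.
by apply: aeW => x /=; rewrite mul1r.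
Qed.

End monotone_transport.

Lemma ge0_measurable_funV {R : realType} (f : R -> R) :
  measurable_fun setT f -> (forall x, 0 <= f x) ->
  measurable_fun setT (fun x => (f x)^-1).
Proof.
move=> mf f0; have E : (fun x => (f x)^-1) = (fun x => f x `^ (-1)).
  by apply/funext => x; rewrite powR_inv1.
rewrite E; apply: (@measurableT_comp _ _ _ _ _ _ (@powR R ^~ (-1))) => //.
Qed.

(** * Monotone maps of degree one and their generalized inverses *)

Section lift.
Context {R : realType}.
Local Notation leb := (@lebesgue_measure R).
Implicit Types (f g u w : R -> R) (a b c : R).

Lemma leb_itvcoE a b : a <= b -> leb `[a, b[%classic = (b - a)%:E.
Proof.
rewrite lebesgue_measure_itv/= lte_fin.
by rewrite le_eqVlt => /predU1P[->|->//]; rewrite ltxx subrr.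
Qed.

(** Absolutely continuous nondecreasing lifts of circle maps of degree one; [y'] is a representative
    of the derivative that is nonnegative at every point. *)
Definition lift_prim (y y' : R -> R) : Prop :=
  [/\ is_prim y y', forall x, 0 <= y' x & forall x, y (x + 1) = y x + 1].

Variables (y y' : R -> R).
Hypothesis yy' : lift_prim y y'.

Lemma lift_nd : {homo y : s t / s <= t}.
Proof.
case: yy' => -[_ yE] y'0 _ a b ab.
by rewrite -subr_ge0 yE//; apply: Rintegral_ge0 => x _.
Qed.

Lemma lift_continuous : continuous y.
Proof. by case: yy' => yE _ _; exact: is_prim_continuous yE. Qed.

Lemma lift_measurable : measurable_fun setT y.
Proof. exact: (continuous_loc_int lift_continuous).1. Qed.

Lemma lift_addn x (n : nat) : y (x + n%:R) = y x + n%:R.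
Proof.
case: yy' => _ _ y1; elim: n => [|n IH]; first by rewrite !addr0.
by rewrite -natr1 !addrA y1 IH.
Qed.

(** The left end of the fibre of [y] over [x]. Taking an infimum gives the equivalence
    [lift_inv_le], by which preimages of intervals [[a, b[] are again of this form. *)
Definition lift_inv x := inf [set s | x <= y s].
Local Notation chi := lift_inv.

Let chi_ex x : [set s | x <= y s] !=set0.
Proof.
pose n := (Num.truncn (x - y 0)).+1; exists (0 + n%:R) => /=.
by rewrite lift_addn -lerBlDl ltW// truncnS_gt.
Qed.

Let chi_lb x : has_lbound [set s | x <= y s].
Proof.
pose n := (Num.truncn (y 0 - x)).+1; exists (- n%:R) => s /= xs.
rewrite leNgt; apply/negP => sn; move: xs; apply/negP; rewrite -ltNge.
have := lift_addn (- n%:R) n; rewrite addNr => /eqP; rewrite -subr_eq => /eqP E.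
apply: (@le_lt_trans _ _ (y (- n%:R))); first by apply: lift_nd; exact: ltW.
by rewrite -E ltrBlDr -ltrBlDl truncnS_gt.
Qed.

(** Continuity of [y] at the infimum: if [y (chi x)] were above [x], a point further left would
    still be in the set; if it were below, so would be the value at points of the set close to the
    infimum. *)
Lemma lift_invK x : y (chi x) = x.
Proof.
have cy : {for chi x, continuous y} by exact: lift_continuous.
apply/eqP; rewrite eq_le; apply/andP; split; rewrite leNgt; apply/negP => h.
  have /nbhs_ballP[e /= e0 he] : \forall s \near chi x, x < y s.
    exact: (@cvgr_gt _ _ (nbhs (chi x)) _ y _ cy).
  have : x < y (chi x - e / 2).
    apply: he; rewrite /ball /= opprB addrC subrK gtr0_norm ?divr_gt0//.
    by rewrite ltr_pdivrMr// ltr_pMr// ltr1n.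
  move=> /ltW xy; have := ge_inf (chi_lb x) xy.
  by rewrite -/(chi x) lerBrDr gerDl leNgt divr_gt0.
have /nbhs_ballP[e /= e0 he] : \forall s \near chi x, y s < x.
  exact: (@cvgr_lt _ _ (nbhs (chi x)) _ y _ cy).
have [s /= xs se] := inf_adherent e0 (conj (chi_ex x) (chi_lb x)).
have chis : chi x <= s by exact: ge_inf.
have : y s < x.
  apply: he; rewrite /ball /= distrC ger0_norm ?subr_ge0//.
  by rewrite ltrBlDl.
by rewrite ltNge xs.
Qed.

Lemma lift_inv_le x s : (chi x <= s) = (x <= y s).
Proof.
apply/idP/idP => [xs|xs]; first by rewrite -{1}(lift_invK x); exact: lift_nd.
exact: ge_inf.
Qed.

Lemma lift_inv_lt x s : (s < chi x) = (y s < x).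
Proof. by rewrite !ltNge lift_inv_le. Qed.

Lemma lift_inv_nd : {homo chi : s t / s <= t}.
Proof. by move=> s t st; rewrite lift_inv_le lift_invK. Qed.

Lemma lift_inv_measurable : measurable_fun setT chi.
Proof. exact: nondecreasing_measurable lift_inv_nd. Qed.

Lemma lift_inv_add1 x : chi (x + 1) = chi x + 1.
Proof.
have [_ _ y1] := yy'.
apply/eqP; rewrite eq_le lift_inv_le y1 lift_invK lexx/=.
rewrite -lerBrDr lift_inv_le -(lerD2r 1) -y1 subrK lift_invK lexx.
by [].
Qed.

Lemma lift_preimage_itvco a b :
  y @^-1` `[a, b[%classic = `[chi a, chi b[%classic.
Proof.
by apply/seteqP; split=> x /=; rewrite !in_itv/= lift_inv_le lift_inv_lt.
Qed.

(** On [[a, b[] the preimage is [[chi a, chi b[], over which [y'] integrates to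
    [y (chi b) - y (chi a) = b - a]; uniqueness of measures does the rest. *)
Lemma lift_transports : transports y y'.
Proof.
have [[[my' iy'] yE] y'0 _] := yy'; have my := lift_measurable.
split=> // B mB.
pose m := pushforward (density leb my')
  (y : measurableTypeR R -> measurableTypeR R).
transitivity (m B); last first.
  by apply: eq_integral => x _; rewrite ger0_norm.
apply: (@measure_eq_itvco _ leb m) => // a b.
  have E : (\int[leb]_(x in `[chi a, chi b[) `|y' x|%:E)%E = m `[a, b[%classic.
    by rewrite -lift_preimage_itvco.
  move=> ab; apply: etrans E.
  have chiab := lift_inv_nd ab.
  transitivity ((\int[leb]_(x in `[chi a, chi b[) y' x)%R%:E); last first.
    rewrite -EFin_Rintegral//.
      by apply: eq_integral => x _; rewrite ger0_norm.
    apply: (@loc_int_itv _ y' _ (chi a) (chi b)) => //.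
    by apply: subset_itvl; rewrite bnd_simp.
  rewrite Rintegral_itv_bndo_bndc; last first.
    apply: (@loc_int_itv _ y' _ (chi a) (chi b)) => //.
    by apply: subset_itvl; rewrite bnd_simp.
  by rewrite -yE// !lift_invK; exact: leb_itvcoE.
exact: leb_itv_lty.
Qed.

(** A countable, hence Borel and null, set that contains every value taken by [y] more than once;
    away from it [chi] is a true inverse. *)
Definition lift_rat : set (measurableTypeR R) := y @` (range (@ratr R)).

Let countable_lift_rat : countable lift_rat.
Proof.
apply: sub_countable (card_image_le _ _) _.
by apply: sub_countable (card_image_le _ _) _; exact: countableP.
Qed.

Lemma measurable_lift_rat : measurable lift_rat.
Proof. exact: countable_measurable. Qed.

Lemma leb_lift_rat : leb lift_rat = 0%E.
Proof. exact: countable_lebesgue_measure0. Qed.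

(* A flat piece of [y] contains a rational point. *)
Lemma lift_inv_rat x : ~ lift_rat (y x) -> chi (y x) = x.
Proof.
move=> nx; apply/eqP; apply: contrapT => /negP ne; apply: nx.
have : chi (y x) < x by rewrite lt_neqAle ne lift_inv_le lexx.
move=> /rat_in_itvoo[q qi].
have cq : chi (y x) < ratr q by rewrite (itvP qi).
have qx : ratr q < x by rewrite (itvP qi).
exists (ratr q); first by exists q.
apply/eqP; rewrite eq_le lift_nd ?(ltW qx)//=.
by rewrite -[leLHS](lift_invK (y x)) lift_nd ?(ltW cq).
Qed.

(** Values taken on flat pieces lie in the null set [lift_rat], over which [y'] vanishes almost
    everywhere. *)
Lemma lift_inv_ae : \forall x \ae leb, y' x = 0 \/ chi (y x) = x.
Proof.
have N0 : leb.-negligible lift_rat.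
  exists lift_rat; split => //; [exact: measurable_lift_rat|exact: leb_lift_rat].
apply: aeS (transport_null lift_transports N0) => x h.
by have [/h|/lift_inv_rat] := pselect (lift_rat (y x)); [left|right].
Qed.

(** The measure of the preimage of a null set [N] by [chi] is the integral of [y'] over the points
    with [chi (y x)] in [N]; almost everywhere such a point has [y' x = 0] or lies in [N] itself. *)
Lemma lift_inv_ae_comp (P : R -> Prop) : (\forall x \ae leb, P x) ->
  \forall x \ae leb, P (chi x).
Proof.
move=> [N [mN N0 PN]].
have [my my' y'0 yE] := lift_transports.
have mchi := lift_inv_measurable.
exists (chi @^-1` N); split.
- exact: (measurable_preimage mchi mN).
- apply: etrans (yE _ (measurable_preimage mchi mN)) _.
  apply: (etrans _ (integral0 leb (y @^-1` (chi @^-1` N)))).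
  apply: ae_eq_integral => //.
  + by apply: measurable_preimage => //; exact: measurable_preimage.
  + by apply/measurable_EFinP; exact: measurable_funTS.
  + have nN : \forall x \ae leb, ~ N x by exists N; split => // x /= /contrapT.
    by apply: aeS2 nN lift_inv_ae => x nN [->//|/= ->].
- by move=> x; exact: PN.
Qed.

(** The density of the push-forward of [f dx] by [y], provided that [f] vanishes almost everywhere
    where [y'] does. *)
Definition lift_density f (x : R) := f (chi x) / y' (chi x).

Lemma lift_density_measurable f : measurable_fun setT f ->
  measurable_fun setT (lift_density f).
Proof.
move=> mf; have [[[my' _] _] _ _] := yy'.
have mchi := lift_inv_measurable.
apply: measurable_funM; first exact: measurableT_comp.
apply: ge0_measurable_funV => [|x]; first exact: measurableT_comp.
by case: yy'.
Qed.

Lemma lift_densityE f : (\forall x \ae leb, y' x = 0 -> f x = 0) ->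
  \forall x \ae leb, lift_density f (y x) * y' x = f x.
Proof.
move=> f0; apply: aeS2 f0 lift_inv_ae => x f0 [y0|xE].
  by rewrite y0 mulr0 f0.
have [y0|y0] := eqVneq (y' x) 0; first by rewrite y0 mulr0 f0.
by rewrite /lift_density xE divfK.
Qed.

End lift.

(** * Relabelings and the projection *)

Section relabelings.
Context {R : realType}.
Local Notation leb := (@lebesgue_measure R).
Local Notation Mclass :=
  {mfun_ leb, (measurableTypeR R) >-> (measurableTypeR R)}.
Implicit Types (f g u w : R -> R) (a b c : R).

Lemma Rintegral_cst_itv a b c : a <= b ->
  \int[leb]_(x in `[a, b]) c = c * (b - a).
Proof.
move=> ab; have /= := (is_primZ c (@is_prim_id R)).2 a b ab.
rewrite -mulrBr => ->.
by apply: eq_Rintegral => x _ /=; rewrite mulr1.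
Qed.

(** The group [calG] in differential form, with bounds on the derivative that hold at every point;
    see [bilip_calG] and [calG_bilip]. *)
Definition bilip (f f' : R -> R) : Prop := lift_prim f f' /\
  exists c C, 0 < c /\ forall x, c <= f' x <= C.

Lemma bilip_intro f p c C : is_prim f p -> 0 < c ->
  (\forall x \ae leb, c <= p x <= C) -> (forall x, f (x + 1) = f x + 1) ->
  exists2 f', bilip f f' & \forall x \ae leb, p x = f' x.
Proof.
move=> fp c0 pcC f1.
(* Clamping [p] makes the bounds valid everywhere; [Num.max c C] keeps the upper end above the lower
   one. *)
pose f' x := Num.max c (Num.min (Num.max c C) (p x)).
have pf' : \forall x \ae leb, p x = f' x.
  apply: aeS pcC => x /andP[cp pC]; rewrite /f'.
  have -> : Num.min (Num.max c C) (p x) = p x.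
    by apply/min_idPr; rewrite le_max pC orbT.
  by apply/esym/max_idPr.
have f'c x : c <= f' x by rewrite /f' le_max lexx.
exists f' => //; split; last first.
  exists c, (Num.max c C); split=> // x; rewrite f'c/= /f' ge_max.
  by rewrite le_max lexx/= ge_min lexx.
split=> //; last by move=> x; exact: le_trans (ltW c0) (f'c x).
apply: (is_prim_ae _ pf' fp).
apply: measurable_maxr => //; apply: measurable_minr => //; exact: fp.1.1.
Qed.

Lemma bilip_ae f f' (P : R -> Prop) : bilip f f' -> (\forall x \ae leb, P x) ->
  \forall x \ae leb, P (f x).
Proof.
move=> [ff' [c [C [c0 f'c]]]] /(transport_ae (lift_transports ff')).
apply: aeS => x [f'x|//]; have := f'c x; rewrite f'x => /andP[c0' _].
by move: c0; rewrite ltNge c0'.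
Qed.

Lemma bilip_comp f f' g g' : bilip f f' -> bilip g g' ->
  bilip (f \o g) (fun x => f' (g x) * g' x).
Proof.
move=> [[fp f0 f1] [c [C [c0 f'c]]]] [[gp g0 g1] [d [D [d0 g'd]]]].
have gl : lift_prim g g' by [].
split.
  split.
  - exact: (is_prim_comp (lift_transports gl) (lift_nd gl) fp).
  - by move=> x; exact: mulr_ge0.
  - by move=> x /=; rewrite g1 f1.
exists (c * d), (C * D); split; first exact: mulr_gt0.
move=> x; have /andP[? ?] := f'c (g x); have /andP[? ?] := g'd x.
by apply/andP; split; apply: ler_pM => //; exact: ltW.
Qed.

Lemma bilip_lt f f' : bilip f f' -> {homo f : a b / a < b}.
Proof.
move=> [[fp f0 f1] [c [C [c0 f'c]]]] a b ab.
rewrite -subr_gt0 fp.2 ?ltW//.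
apply: (@lt_le_trans _ _ (\int[leb]_(x in `[a, b]) c)).
  by rewrite Rintegral_cst_itv ?ltW// mulr_gt0// subr_gt0.
apply: le_Rintegral => //.
- exact: (loc_int_cst c).2.
- exact: fp.1.2.
- by move=> x _; have /andP[] := f'c x.
Qed.

Lemma bilip_invK f f' : bilip f f' -> cancel f (lift_inv f).
Proof.
move=> ff' x; have [lf _] := ff'; apply/eqP; rewrite eq_le.
rewrite (lift_inv_le lf) lexx/= leNgt; apply/negP => /(bilip_lt ff').
by rewrite (lift_invK lf) ltxx.
Qed.

(** Substituting [f] in the integral of [1 / f' (g x)] over [[a, b]] leaves the integral of 1 over
    [[g a, g b]]. *)
Lemma bilip_inv f f' : bilip f f' ->
  bilip (lift_inv f) (fun x => (f' (lift_inv f x))^-1).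
Proof.
move=> ff'; have fK := bilip_invK ff'.
have [lf [c [C [c0 f'c]]]] := ff'; have [fp f0 f1] := lf.
have f'0 x : 0 < f' x by rewrite (lt_le_trans c0)//; have /andP[] := f'c x.
set g := lift_inv f; set g' := fun x => _.
have mg' : measurable_fun setT g'.
  apply: ge0_measurable_funV => [|x]; last exact: ltW.
  by apply: measurableT_comp; [exact: fp.1.1|exact: lift_inv_measurable lf].
have g'b x : C^-1 <= g' x <= c^-1.
  have /andP[c1 c2] := f'c (g x).
  have C0 : 0 < C by rewrite (lt_le_trans c0)// (le_trans c1).
  rewrite /g' lef_pV2 ?posrE ?f'0// c2 lef_pV2 ?posrE ?f'0//.
split; last first.
  exists C^-1, c^-1; split => //.
  by rewrite invr_gt0 (lt_le_trans (f'0 0))//; have /andP[] := f'c 0.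
split; last 2 first.
- by move=> x; rewrite /g' invr_ge0 ltW.
- by move=> x; rewrite /g (lift_inv_add1 lf).
split.
  apply: (@loc_int_bounded _ _ c^-1) => //; apply: aeW => x.
  have g'0 : 0 <= g' x by rewrite /g' invr_ge0 ltW.
  by rewrite ger0_norm//; have /andP[] := g'b x.
move=> a b ab; have gab : g a <= g b by exact: (lift_inv_nd lf).
have := itv_transport_Rintegral (lift_transports lf) (lift_nd lf) gab mg'.
rewrite !(lift_invK lf) => <-.
have /= -> := ((@is_prim_id R).2 _ _ gab); apply: eq_Rintegral => x _.
by rewrite /g' /g fK mulVf// gt_eqF.
Qed.

Lemma bilip_prim_id f f' : bilip f f' ->
  is_prim (fun x => f x - x) (fun x => f' x - 1).
Proof. by move=> [[fp _ _] _]; exact: is_primB fp (@is_prim_id R). Qed.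

Lemma bilip_W1_per f f' : bilip f f' -> W1_per +oo%E (fun x => f x - x).
Proof.
move=> ff'; have [[fp f0 f1] [c [C [c0 f'c]]]] := ff'; apply/W1_perooP; split.
  by move=> x; rewrite f1 opprD addrACA subrr addr0.
exists (fun x => f' x - 1); first exact: bilip_prim_id ff'.
exists (C + 1); apply: aeW => x; have /andP[_ fC] := f'c x.
by rewrite (le_trans (ler_normB _ _))// normr1 lerD2r ger0_norm.
Qed.

Lemma bilip_calG f f' : bilip f f' -> calG f.
Proof.
move=> ff'; have [lf [c [C [c0 f'c]]]] := ff'; have [fp f0 f1] := lf; split.
- apply/W1inf_locP; exists f' => // a b; exists C; apply: aeW => x _.
  by have /andP[_ fC] := f'c x; rewrite ger0_norm.
- exact: f1.
- exact: bilip_W1_per ff'.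
- exists (lift_inv f); split.
  + exact: bilip_invK ff'.
  + exact: (lift_invK lf).
  + exact: bilip_W1_per (bilip_inv ff').
Qed.

(** If [f b < f a] with [a < b], then [f (b + n)] exceeds [f a] for large [n], and the intermediate
    value theorem gives a second point, to the right of [b], where [f] takes the value [f a]. *)
Lemma continuous_lift_inj f : continuous f -> injective f ->
  (forall x, f (x + 1) = f x + 1) -> {homo f : a b / a < b}.
Proof.
move=> cf fI f1 a b ab.
have fn x (n : nat) : f (x + n%:R) = f x + n%:R.
  elim: n => [|n IH]; first by rewrite !addr0.
  by rewrite -natr1 !addrA f1 IH.
rewrite lt_neqAle; apply/andP; split.
  by apply/eqP => /fI E; move: ab; rewrite E ltxx.
rewrite leNgt; apply/negP => fba.
pose n := (Num.truncn (f a - f b)).+1.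
have fan : f a <= f (b + n%:R) by rewrite fn -lerBlDl ltW// truncnS_gt.
have bn : b <= b + n%:R by rewrite lerDl.
have [|s sbn fs] := @IVT _ f _ _ (f a) bn (continuous_subspaceT cf).
  have fbn : f b <= f (b + n%:R) by rewrite fn lerDl.
  by rewrite (min_idPl fbn) (max_idPr fbn) (ltW fba) fan.
move/fI : fs => E; move: sbn; rewrite E in_itv/= => /andP[ba _].
by move: ab; rewrite ltNge ba.
Qed.

(** The upper bound on the derivative comes from [f - id], the positive lower bound from the
    inverse: [g] is Lipschitz with constant [L], so [f] increases by at least [(b - a) / L] on
    [[a, b]]. *)
Lemma calG_bilip f : calG f -> exists f', bilip f f'.
Proof.
move=> [_ f1 /W1_perooP[_ [fk fkp [C fkC]]]].
move=> [g [fK gK /W1_perooP[_ [gk gkp [D gkD]]]]].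
have fp : is_prim f (fun x => fk x + 1).
  have := is_primD fkp (@is_prim_id R).
  by congr is_prim; apply/funext => x /=; rewrite subrK.
have gp : is_prim g (fun x => gk x + 1).
  have := is_primD gkp (@is_prim_id R).
  by congr is_prim; apply/funext => x /=; rewrite subrK.
have flt := continuous_lift_inj (is_prim_continuous fp) (can_inj fK) f1.
pose L := `|D| + 1.
have L0 : 0 < L by rewrite ltr_wpDl.
have gL a b : a <= b -> g b - g a <= L * (b - a).
  move=> ab; rewrite gp.2//.
  rewrite -Rintegral_cst_itv//.
  have mgp := gp.1.1.
  pose h x := Num.min L (gk x + 1).
  have mh : measurable_fun setT h by exact: measurable_minr.
  have gh : \forall x \ae leb, gk x + 1 = h x.
    apply: aeS gkD => x gD; apply/esym/min_idPr.
    rewrite lerD2r (le_trans (ler_norm _))// (le_trans gD)//.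
    exact: ler_norm.
  rewrite (eq_ae_Rintegral _ mgp mh gh)//.
  apply: le_Rintegral => //; last by move=> x _; rewrite ge_min lexx.
    exact: (loc_int_ae mh gh gp.1).2.
  exact: (loc_int_cst L).2.
have fb : \forall x \ae leb, L^-1 <= fk x + 1.
  apply: loc_int_le_ae; [exact: loc_int_cst|exact: fp.1|].
  move=> a b ab; rewrite Rintegral_cst_itv// -fp.2// ler_pdivrMl//.
  have := gL (f a) (f b); rewrite !fK; apply.
  by move: ab; rewrite le_eqVlt => /predU1P[->//|/flt/ltW].
have [|||f' ff' _] := @bilip_intro f _ L^-1 (C + 1) fp; last by exists f'.
- by rewrite invr_gt0.
- apply: aeS2 fb fkC => x -> fC /=; rewrite lerD2r.
  by rewrite (le_trans (ler_norm _)).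
- exact: f1.
Qed.

(** The conditions of [calF] with explicit derivatives, for functions [nu] and [r] instead of
    classes, so that formulas can be manipulated before [ae_class] is applied. Periodicity turns the
    local bounds into the global one of [lp_bound]. *)
Record lagr_prim (y y' U U' nu r : R -> R) : Prop := LagrPrim {
  lp_lift : lift_prim y y';
  lp_U : is_prim U U';
  lp_Uper : forall x, U (x + 1) = U x;
  lp_mnu : measurable_fun setT nu;
  lp_mr : measurable_fun setT r;
  lp_nuper : ae_per nu;
  lp_rper : ae_per r;
  lp_bound : exists C, \forall x \ae leb,
    [/\ `|y' x| <= C, `|U' x| <= C, `|nu x| <= C & `|r x| <= C];
  lp_nu0 : \forall x \ae leb, 0 <= nu x;
  lp_coer : exists2 c, 0 < c & \forall x \ae leb, c <= y' x + nu x;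
  lp_eq : \forall x \ae leb,
    y' x * nu x = y' x ^+ 2 * U x ^+ 2 + U' x ^+ 2 + r x ^+ 2 }.

Lemma lagr_prim_ae y y' U U' nu r nu2 r2 : lagr_prim y y' U U' nu r ->
  measurable_fun setT nu2 -> measurable_fun setT r2 ->
  (\forall x \ae leb, nu x = nu2 x) -> (\forall x \ae leb, r x = r2 x) ->
  lagr_prim y y' U U' nu2 r2.
Proof.
move=> [l Up U1 mnu mr nu1 r1 [C bd] nu0 [c c0 coer] eq] mnu2 mr2 nuE rE.
split => //.
- exact: ae_per_eq nuE nu1.
- exact: ae_per_eq rE r1.
- by exists C; apply: aeS3 bd nuE rE => x + <- <-.
- by apply: aeS2 nuE nu0 => x <-.
- by exists c => //; apply: aeS2 nuE coer => x <-.
- by apply: aeS3 nuE rE eq => x <- <-.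
Qed.

Lemma lagr_prim_class y y' U U' nu r : lagr_prim y y' U U' nu r ->
  lagr_prim y y' U U' (ae_class nu) (ae_class r).
Proof.
move=> l; apply: (lagr_prim_ae l).
- exact: measurable_class.
- exact: measurable_class.
- by apply: aeS (ae_classE (lp_mnu l)) => x ->.
- by apply: aeS (ae_classE (lp_mr l)) => x ->.
Qed.

Lemma lagr_prim_calF y y' U U' (nu r : Mclass) : lagr_prim y y' U U' nu r ->
  calF R (Lagrangian y U nu r).
Proof.
move=> l; have [[yp y0 y1] Up U1 mnu mr nu1 r1 [C bd] nu0 [c c0 coer] eq] := l.
have bnu : \forall x \ae leb, `|nu x| <= C by apply: aeS bd => x [].
have br : \forall x \ae leb, `|r x| <= C by apply: aeS bd => x [].
have yE := wderivE yp; have UE := wderivE Up.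
split.
- split => /=.
  + apply/W1_per1P; split.
      by move=> x; rewrite y1 opprD addrACA subrr addr0.
    by exists (y' \- cst 1); exact: is_primB yp (@is_prim_id R).
  + by apply/W1_per1P; split => //; exists U'.
  + by apply/Lp_per1P; split => //; exact: (loc_int_bounded mnu bnu).2.
  + by apply/Lp_per1P; split => //; exact: (loc_int_bounded mr br).2.
- split; apply/W1inf_locP.
    by exists y' => // a b; exists C; apply: aeS bd => x [].
  by exists U' => // a b; exists C; apply: aeS bd => x [].
- by split; apply/LinfP; split => //; exists C.
- split => //; first by apply: aeS yE => x ->.
  by exists c => //; apply: aeS2 yE coer => x ->.
- by apply: aeS3 yE UE eq => x -> ->.
Qed.

Lemma W1inf_loc_per_bounded f c : W1inf_loc f ->
  (forall x, f (x + 1) = f x + c) ->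
  is_prim f (wderiv f) /\ exists C, \forall x \ae leb, `|wderiv f x| <= C.
Proof.
move=> /W1inf_locP[g fg gC] f1; have fp := is_prim_wderiv fg; split=> //.
have [C hC] := gC 0 1; exists C; apply: ae_per_bounded.
  exact: is_prim_per fp f1.
by apply: aeS2 hC (wderivE fg) => x hC ->.
Qed.

Lemma calF_lagr_prim X : calF R X ->
  exists y' U', lagr_prim (la_y X) y' (la_U X) U' (la_nu X) (la_r X).
Proof.
case: X => y U nu r /= [[/= y1 U1 nu1 r1] [yl Ul] [nuoo roo] [y0 nu0 coer] eq].
have yper x : y (x + 1) = y x + 1.
  have /W1_per1P[/(_ x) + _] := y1; lra.
have Uper x : U (x + 1) = U x by have /W1_per1P[] := U1.
have [yp [Cy yC]] := W1inf_loc_per_bounded yl yper.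
have [Up [CU UC]] := W1inf_loc_per_bounded (c := 0) Ul
  (fun x => etrans (Uper x) (esym (addr0 _))).
have /LinfP[mnu [Cnu nuC]] := nuoo; have /LinfP[mr [Cr rC]] := roo.
(* The derivative is nonnegative only almost everywhere; [lift_prim] asks for it at every point. *)
pose y' x := Num.max 0 (wderiv y x).
have yE : \forall x \ae leb, wderiv y x = y' x.
  by apply: aeS y0 => x h; apply/esym/max_idPr.
exists y', (wderiv U); split=> //.
- split=> //; last by move=> x; rewrite /y' le_max lexx.
  apply: (is_prim_ae _ yE yp).
  by apply: measurable_maxr => //; exact: yp.1.1.
- by have /Lp_per1P[] := nu1.
- by have /Lp_per1P[] := r1.
- exists (`|Cy| + `|CU| + `|Cnu| + `|Cr|).
  have H a C d : `|a| <= C -> `|C| <= d -> `|a| <= d.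
    by move=> /le_trans h1 h2; apply: h1; exact: le_trans (ler_norm _) h2.
  have B : \forall x \ae leb, [/\ `|nu x| <= Cnu & `|r x| <= Cr].
    by apply: aeS2 nuC rC => x.
  apply: aeS3 (aeS2 (fun x p q => conj p q) yE yC) UC B => x [<- h1] h2 [h3 h4].
  have [[[c1 c2] c3] c4] := (normr_ge0 Cy, normr_ge0 CU, normr_ge0 Cnu, normr_ge0 Cr).
  by split; [apply: H h1 _|apply: H h2 _|apply: H h3 _|apply: H h4 _]; lra.
- have [c c0 h] := coer; exists c => //.
  by apply: aeS2 yE h => x <-.
- by apply: aeS2 yE eq => x <-.
Qed.

End relabelings.

(** * The action of relabelings, and the projection as a relabeling *)

Section relabeling_action.
Context {R : realType}.
Local Notation leb := (@lebesgue_measure R).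
Local Notation Mclass :=
  {mfun_ leb, (measurableTypeR R) >-> (measurableTypeR R)}.
Implicit Types (f g u w : R -> R) (a b c : R) (X : lagrangian R).

Lemma bilip_prim f f' : bilip f f' -> is_prim f f'.
Proof. by move=> [[]]. Qed.

Lemma bilip_transports f f' : bilip f f' -> transports f f'.
Proof. by move=> [/lift_transports]. Qed.

Lemma bilip_per f f' : bilip f f' -> ae_per f'.
Proof. by move=> [[fp _ f1] _]; exact: is_prim_per fp f1. Qed.

Lemma lagr_prim_relabel y y' U U' nu r f f' : lagr_prim y y' U U' nu r ->
  bilip f f' -> lagr_prim (y \o f) (fun x => y' (f x) * f' x) (U \o f)
    (fun x => U' (f x) * f' x) (fun x => nu (f x) * f' x)
    (fun x => r (f x) * f' x).
Proof.
move=> [[yp y0 y1] Up U1 mnu mr nu1 r1 [C bd] nu0 [c c0 coer] eq] ff'.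
have [[fp f0 f1] [d [D [d0 fdD]]]] := ff'.
have ft := bilip_transports ff'; have fnd := lift_nd ff'.1.
have f'1 := bilip_per ff'.
have per g : ae_per g -> ae_per (fun x => g (f x) * f' x).
  move=> g1; apply: aeS2 (bilip_ae ff' g1) f'1 => x gE ->.
  by rewrite f1 gE.
split.
- split; first exact: (is_prim_comp ft fnd yp).
    by move=> x; rewrite mulr_ge0.
  by move=> x /=; rewrite f1 y1.
- exact: (is_prim_comp ft fnd Up).
- by move=> x /=; rewrite f1 U1.
- exact: (transport_measurable ft mnu).
- exact: (transport_measurable ft mr).
- exact: per.
- exact: per.
- exists (C * D); apply: aeS (bilip_ae ff' bd) => x [h1 h2 h3 h4].
  have H a : `|a| <= C -> `|a * f' x| <= C * D.
    move=> aC; rewrite normrM; apply: ler_pM => //.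
    by rewrite ger0_norm//; have /andP[] := fdD x.
  by split; exact: H.
- by apply: aeS (bilip_ae ff' nu0) => x h; rewrite mulr_ge0.
- exists (c * d); first exact: mulr_gt0.
  apply: aeS (bilip_ae ff' coer) => x h; rewrite -mulrDl.
  by apply: ler_pM => //; [exact: ltW|exact: ltW|have /andP[] := fdD x].
- apply: aeS (bilip_ae ff' eq) => x /= h.
  (* The energy identity is homogeneous of degree two in [y'], [U'], [nu] and [r], so both sides
     gain [f' x ^+ 2]. *)
  have -> : y' (f x) * f' x * (nu (f x) * f' x) =
      (y' (f x) * nu (f x)) * f' x ^+ 2 by ring.
  by rewrite h; ring.
Qed.

Lemma relabelE X f f' : bilip f f' -> relabel X f =
  Lagrangian (la_y X \o f) (la_U X \o f)
    (ae_class (fun x => la_nu X (f x) * f' x))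
    (ae_class (fun x => la_r X (f x) * f' x)).
Proof.
move=> ff'; have fE := wderivE (bilip_prim ff').
by rewrite /relabel; congr Lagrangian; apply: eq_ae_class;
  apply: aeS fE => x ->.
Qed.

Lemma relabel_calF X f f' : calF R X -> bilip f f' -> calF R (relabel X f).
Proof.
move=> FX ff'; have [y' [U' l]] := calF_lagr_prim FX.
rewrite (relabelE _ ff').
exact: lagr_prim_calF (lagr_prim_class (lagr_prim_relabel l ff')).
Qed.

Lemma measurable_relabel f f' (c : Mclass) : bilip f f' ->
  measurable_fun setT (fun x => c (f x) * f' x).
Proof.
move=> ff'; apply: (transport_measurable (bilip_transports ff')).
exact: measurable_class.
Qed.

Lemma relabel_comp X f f' g g' : bilip f f' -> bilip g g' ->
  relabel (relabel X f) g = relabel X (f \o g).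
Proof.
move=> ff' gg'; rewrite (relabelE _ ff') (relabelE _ gg').
rewrite (relabelE _ (bilip_comp ff' gg')) /=.
congr Lagrangian; apply: eq_ae_class.
  have := bilip_ae gg' (ae_classE (measurable_relabel (la_nu X) ff')).
  by apply: aeS => x ->; rewrite mulrA.
have := bilip_ae gg' (ae_classE (measurable_relabel (la_r X) ff')).
by apply: aeS => x ->; rewrite mulrA.
Qed.

Lemma bilip_shift c : bilip (fun x => x + c) (cst 1).
Proof.
split; last by exists 1, 1; split => // x; rewrite lexx.
split=> // [|x]; last by rewrite addrAC.
apply: (is_prim_ae _ _ (is_primD (@is_prim_id R) (is_prim_cst c))) => //.
by apply: aeW => x; rewrite /= addr0.
Qed.

Lemma relabel_orbit_relabel X f f' : bilip f f' ->
  relabel_orbit (relabel X f) = relabel_orbit X.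
Proof.
move=> ff'; apply/seteqP; split => _ [g Gg <-].
  have [g' gg'] := calG_bilip Gg; exists (f \o g).
    exact: bilip_calG (bilip_comp ff' gg').
  by rewrite (relabel_comp _ ff' gg').
have [g' gg'] := calG_bilip Gg; have fi := bilip_inv ff'.
exists (lift_inv f \o g).
  exact: bilip_calG (bilip_comp fi gg').
rewrite (relabel_comp _ ff' (bilip_comp fi gg')).
by rewrite (_ : f \o _ = g)//; apply/funext => x /=; rewrite (lift_invK ff'.1).
Qed.

Lemma energyE y y' U U' (nu r : Mclass) : lagr_prim y y' U U' nu r ->
  energy (Lagrangian y U nu r) = \int[leb]_(x in `[0, 1]) nu x.
Proof.
move=> l; rewrite /energy Lnorm1 /Rintegral; congr fine.
have mnu := lp_mnu l; have nu0 := lp_nu0 l.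
rewrite ge0_integral_leb_itv//; last first.
  by apply: measurableT_comp => //; exact/measurable_EFinP.
apply: ae_eq_integral => //.
- apply: measurable_funTS; apply: measurableT_comp => //; exact/measurable_EFinP.
- by apply/measurable_EFinP; exact: measurable_funTS.
- by apply: aeS nu0 => x h _ /=; rewrite ger0_norm.
Qed.

Lemma ae_ge0_Rintegral f (B : set R) : measurable B -> measurable_fun setT f ->
  (\forall x \ae leb, 0 <= f x) -> 0 <= \int[leb]_(x in B) f x.
Proof.
move=> mB mf f0; pose h x := Num.max 0 (f x).
have fh : \forall x \ae leb, f x = h x.
  by apply: aeS f0 => x h0; apply/esym/max_idPr.
rewrite (eq_ae_Rintegral mB mf _ fh).
  by apply: Rintegral_ge0 => x _; rewrite /h le_max lexx.
exact: measurable_maxr.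
Qed.

Lemma lagr_prim_nu (y y' U U' nu r : R -> R) : lagr_prim y y' U U' nu r ->
  is_prim (primitive nu) nu.
Proof.
move=> l; have [C bd] := lp_bound l; apply: is_prim_primitive.
apply: (loc_int_bounded (lp_mnu l)).
by apply: aeS bd => x [_ _ h _]; exact: h.
Qed.

Lemma energy_ge0 X : calF R X -> 0 <= energy X.
Proof.
move=> FX; have [y' [U' l]] := calF_lagr_prim FX.
case: X FX l => y U nu r FX /= l; rewrite (energyE l).
by apply: ae_ge0_Rintegral => //; [exact: lp_mnu l|exact: lp_nu0 l].
Qed.

Lemma energy_relabel X f f' : calF R X -> bilip f f' ->
  energy (relabel X f) = energy X.
Proof.
move=> FX ff'; have [y' [U' l]] := calF_lagr_prim FX.
case: X FX l => y U nu r FX /= l.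
have lf := lagr_prim_relabel l ff'.
have [[_ _ f1] _] := ff'; have fnd := lift_nd ff'.1.
rewrite (relabelE _ ff') /= (energyE l) (energyE (lagr_prim_class lf)).
rewrite (eq_ae_Rintegral _ _ _ (ae_classE (lp_mnu lf)))//; last 2 first.
- exact: measurable_class.
- exact: lp_mnu lf.
rewrite (itv_transport_Rintegral (bilip_transports ff') fnd)//; last exact: lp_mnu l.
have -> : f 1 = f 0 + 1 by rewrite -f1 add0r.
exact: (per_Rintegral (lagr_prim_nu l) (lp_nuper l)).
Qed.

Lemma energy_lt0 X : calF R X -> 0 < 1 + energy X.
Proof. by move=> FX; rewrite ltr_wpDr// energy_ge0. Qed.

(** Coercivity and boundedness make [F] bilipschitz, and over a period [y] gains 1 and the primitive
    of [nu] gains [h], whence [F (x + 1) = F x + 1]. Since [y' + nu = (1 + h) * F'], relabeling by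
    the inverse of [F] makes the sum constant. *)
Lemma Pi1_relabel X : calF R X ->
  exists f f', [/\ bilip f f', Pi1 X = relabel X f & calF0 (relabel X f)].
Proof.
move=> FX; have [y' [U' l]] := calF_lagr_prim FX.
have h0 := energy_lt0 FX; set h := energy X in h0.
have [[yp y0 y1] _ _ mnu _ nu1 _ [C bd] nu0 [c c0 coer] _] := l.
have nup := lagr_prim_nu l.
pose F xi := (1 + h)^-1 * (la_y X xi + primitive (la_nu X) xi).
have Fp : is_prim F (fun x => (1 + h)^-1 * (y' x + la_nu X x)).
  exact: (is_primZ _ (is_primD yp nup)).
have hE : \int[leb]_(x in `[0, 1]) la_nu X x = h.
  by rewrite /h; case: X FX l {h h0 yp y0 y1 mnu nu1 bd nu0 coer nup F Fp} =>
    y U nu r FX l /=; rewrite (energyE l).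
have [|||F' FF' FE] := @bilip_intro _ F _ ((1 + h)^-1 * c)
    ((1 + h)^-1 * (C + C)) Fp.
- by rewrite mulr_gt0 ?invr_gt0.
- apply: aeS2 bd coer => x [h1 _ h2 _] h3.
  rewrite !ler_pM2l ?invr_gt0// h3/= lerD//.
    exact: le_trans (ler_norm _) h1.
  exact: le_trans (ler_norm _) h2.
- move=> x; rewrite /F y1.
  have := per_Rintegral nup nu1 x; rewrite -nup.2 ?lerDl// hE => E.
  have -> : primitive (la_nu X) (x + 1) = primitive (la_nu X) x + h.
    by rewrite -E addrCA subrr addr0.
  have -> : la_y X x + 1 + (primitive (la_nu X) x + h) =
    (la_y X x + primitive (la_nu X) x) + (1 + h) by ring.
  by rewrite mulrDr mulVf// gt_eqF.
have Fi := bilip_inv FF'; have FK := bilip_invK FF'.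
set g := lift_inv F in Fi FK; set g' := fun x => _ in Fi.
exists g, g'; split; first exact: Fi.
  (* [F] is a bijection of the line, so the partial inverse used by [Pi1] is its generalized
     inverse. *)
  have E x : 'pinv_(fun=> 0) setT F x = g x.
    apply: (can_inj FK); rewrite (lift_invK FF'.1) pinvK// inE.
    by exists (g x) => //; exact: (lift_invK FF'.1).
  by rewrite /Pi1 -/h -/F (_ : 'pinv_(fun=> 0) setT F = g)//; apply/funext.
split; first exact: relabel_calF Fi.
rewrite (energy_relabel FX Fi) -/h (relabelE _ Fi) /=.
have yg := is_prim_comp (bilip_transports Fi) (lift_nd Fi.1) yp.
have := ae_classE (measurable_relabel (la_nu X) Fi).
apply: aeS3 (wderivE yg) (bilip_ae Fi FE) => x -> e1 ->.
rewrite -mulrDl.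
have -> : y' (g x) + la_nu X (g x) = (1 + h) * F' (g x).
  by rewrite -e1 mulrA mulfV ?mul1r// gt_eqF.
rewrite /g' -mulrA mulfV ?mulr1// gt_eqF//.
have [_ [d [D [d0 dD]]]] := FF'.
by rewrite (lt_le_trans d0)//; have /andP[] := dD (g x).
Qed.

(** The mean of [y] over [[t, t + 1]], called [Q t], has derivative [y (t + 1) - y t = 1], so moving
    the window by [- a] lowers the mean by [a]. *)
Lemma lift_shift_integral y y' a : lift_prim y y' ->
  \int[leb]_(x in `[0, 1]) y (x - a) = \int[leb]_(x in `[0, 1]) y x - a.
Proof.
move=> yl; have [yp _ y1] := yl.
have Pp := is_prim_primitive (continuous_loc_int (lift_continuous yl)).
set P := primitive _ in Pp.
pose Q t := P (t + 1) - P t.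
have Qp : is_prim Q (cst 1).
  apply: (is_prim_ae _ _ (is_primB (is_prim_shift 1 Pp) Pp)) => //.
  by apply: aeW => x /=; rewrite y1 addrC addKr.
have QE s t : s <= t -> Q t - Q s = t - s.
  by move=> st; rewrite Qp.2// -(@is_prim_id R).2.
have -> : \int[leb]_(x in `[0, 1]) y (x - a) = Q (- a).
  have := is_prim_shift (- a) Pp; move=> [_ /(_ 0 1 ler01) <-].
  by rewrite /Q sub0r (addrC 1).
have <- : Q 0 = \int[leb]_(x in `[0, 1]) y x by rewrite /Q add0r Pp.2.
by have [a0|/ltW a0] := leP 0 a;
  [have := QE (- a) 0|have := QE 0 (- a)]; rewrite ?oppr_le0 ?oppr_ge0 => /(_ a0);
  lra.
Qed.

Lemma Pi2_relabel X : calF0 X ->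
  exists f f', [/\ bilip f f', Pi2 X = relabel X f & calH R (relabel X f)].
Proof.
move=> [FX F0]; have [y' [U' l]] := calF_lagr_prim FX.
have [[yp y0 y1] _ _ mnu mr nu1 _ [C bd] nu0 [c c0 coer] _] := l.
set a := \int[leb]_(xi in `[0, 1]) la_y X xi.
have ff' := bilip_shift (- a).
exists (fun x => x - a), (cst 1); split=> //.
  rewrite /Pi2 -/a (relabelE _ ff'); congr Lagrangian;
  by apply: eq_ae_class; apply: aeW => x; rewrite mulr1.
split.
  split; first exact: relabel_calF ff'.
  rewrite (energy_relabel FX ff') (relabelE _ ff') /=.
  have yE := wderivE (is_prim_shift (- a) yp).
  have nuE := ae_classE (measurable_relabel (la_nu X) ff').
  have F0a := bilip_ae ff' (aeS2 (fun x p q => conj p q) F0 (wderivE yp)).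
  apply: aeS3 yE nuE F0a => x e1 e2 [e3 e4].
  by rewrite e1 e2 -e3 e4 mulr1.
rewrite (relabelE _ ff') /=.
by rewrite (lift_shift_integral _ (lp_lift l)) subrr.
Qed.

Lemma Pi_relabel X : calF R X ->
  exists f f', [/\ bilip f f', Pi X = relabel X f & calH R (relabel X f)].
Proof.
move=> FX; have [f [f' [ff' E F0]]] := Pi1_relabel FX.
rewrite /Pi E; have [g [g' [gg' -> H0]]] := Pi2_relabel F0.
exists (f \o g), (fun x => f' (g x) * g' x); split.
- exact: bilip_comp.
- exact: relabel_comp ff' gg'.
- by rewrite -(relabel_comp _ ff' gg').
Qed.

End relabeling_action.

(** * From Lagrangian to Eulerian variables *)

Section eulerian_of_lagrangian.
Context {R : realType}.
Local Notation leb := (@lebesgue_measure R).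
Local Notation Mclass :=
  {mfun_ leb, (measurableTypeR R) >-> (measurableTypeR R)}.
Implicit Types (f g u w : R -> R) (a b c : R) (X : lagrangian R).
Implicit Types (mu : borel_measure R).

Lemma borel_measure_ext mu1 mu2 :
  (forall B : set (measurableTypeR R), measurable B -> mu1 B = mu2 B) ->
  mu1 = mu2.
Proof.
move=> h; have : repr mu1 == repr mu2 %[mod borel_measure R].
  by rewrite eqmodE; apply/asboolP.
by rewrite !reprK => /eqP.
Qed.

Lemma pi_measureE (m : pre_borel_measure R) (B : set (measurableTypeR R)) :
  measurable B ->
  (\pi_(borel_measure R) m : borel_measure R) B =
  (m : {measure set (measurableTypeR R) -> \bar R}) B.
Proof.
move=> mB.
have : repr (\pi_(borel_measure R) m) == m %[mod borel_measure R] by rewrite reprK.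
by rewrite eqmodE => /asboolP; apply.
Qed.

Lemma loc_int_eq_ae f g : loc_int f -> loc_int g ->
  (forall a b, a <= b ->
    \int[leb]_(x in `[a, b]) f x = \int[leb]_(x in `[a, b]) g x) ->
  \forall x \ae leb, f x = g x.
Proof.
move=> lf lg fg.
have h1 := @loc_int_le_ae _ _ _ lf lg
  (fun a b ab => (eq_ind_r (fun z => z <= _) (lexx _) (fg a b ab))).
have h2 := @loc_int_le_ae _ _ _ lg lf
  (fun a b ab => (eq_ind_r (fun z => _ <= z) (lexx _) (fg a b ab))).
by apply: aeS2 h1 h2 => x h1 h2; apply/eqP; rewrite eq_le h1.
Qed.

Lemma lift_preimage_itvcc (y y' : R -> R) a b : lift_prim y y' ->
  y @^-1` `[a, b]%classic `<=` `[lift_inv y a, lift_inv y (b + 1)]%classic.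
Proof.
move=> yl x /=; rewrite !in_itv/= => /andP[ax xb].
rewrite (lift_inv_le yl) ax/= ltW// (lift_inv_lt yl).
by rewrite (le_lt_trans xb)// ltrDl.
Qed.

Lemma lift_preimage_integrable (y y' : R -> R) f (B : set (measurableTypeR R)) a b :
  lift_prim y y' -> loc_int f -> measurable B -> B `<=` `[a, b]%classic ->
  leb.-integrable (y @^-1` B) (EFin \o f).
Proof.
move=> yl lf mB Bab.
apply: (@loc_int_sub _ _ _ (lift_inv y a) (lift_inv y (b + 1))) => //.
  exact: (measurable_preimage (lift_measurable yl) mB).
by move=> x /Bab /(lift_preimage_itvcc yl).
Qed.

Section lift_density.
Variables (y y' f : R -> R).
Hypotheses (yl : lift_prim y y') (lf : loc_int f).
Hypothesis f0 : \forall x \ae leb, y' x = 0 -> f x = 0.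
Local Notation fhat := (lift_density y y' f).

Let mfhat : measurable_fun setT fhat.
Proof. exact: (lift_density_measurable yl lf.1). Qed.

Let mF : measurable_fun setT (fun x => fhat (y x) * y' x).
Proof. exact: (transport_measurable (lift_transports yl) mfhat). Qed.

Let FE : \forall x \ae leb, f x = fhat (y x) * y' x.
Proof. by apply: aeS (lift_densityE yl f0) => x ->. Qed.

Lemma lift_density_loc_int : loc_int fhat.
Proof.
split=> // a b.
apply/(transport_integrable (lift_transports yl)) => //.
apply: (@lift_preimage_integrable y y' _ _ a b yl) => //.
exact: loc_int_ae FE lf.
Qed.

Lemma lift_density_Rintegral (B : set (measurableTypeR R)) : measurable B ->
  \int[leb]_(x in B) fhat x = \int[leb]_(x in y @^-1` B) f x.
Proof.
move=> mB; rewrite (transport_Rintegral (lift_transports yl))//.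
apply/esym/(eq_ae_Rintegral _ lf.1 mF FE).
exact: (measurable_preimage (lift_measurable yl) mB).
Qed.

Lemma lift_density_is_prim u : is_prim (u \o y) f -> is_prim u fhat.
Proof.
move=> [_ uf]; split; first exact: lift_density_loc_int.
move=> a b ab; have chiab := lift_inv_nd yl ab.
have := uf _ _ chiab; rewrite /= !(lift_invK yl) => ->.
rewrite (eq_ae_Rintegral _ lf.1 mF FE)//.
rewrite (itv_transport_Rintegral (lift_transports yl) (lift_nd yl))//.
by rewrite !(lift_invK yl).
Qed.

End lift_density.

Section lagr_prim_facts.
Variables (y y' U U' nu r : R -> R).
Hypothesis l : lagr_prim y y' U U' nu r.
Let yl := lp_lift l.
Local Notation chi := (lift_inv y).

(** Where [y' = 0] the energy identity reduces to [0 = U' ^ 2 + r ^ 2]. The next lemma extracts the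
    other square. *)
Lemma lagr_prim_r_eq0 : \forall x \ae leb, y' x = 0 -> r x = 0.
Proof.
apply: aeS (lp_eq l) => x /[swap] ->; rewrite mul0r expr0n/= mul0r add0r => /eqP.
by rewrite eq_sym paddr_eq0 ?sqr_ge0// !sqrf_eq0 => /andP[_ /eqP].
Qed.

Lemma lagr_prim_U'_eq0 : \forall x \ae leb, y' x = 0 -> U' x = 0.
Proof.
apply: aeS (lp_eq l) => x /[swap] ->; rewrite mul0r expr0n/= mul0r add0r => /eqP.
by rewrite eq_sym paddr_eq0 ?sqr_ge0// !sqrf_eq0 => /andP[/eqP].
Qed.

Lemma lagr_prim_nu_loc_int : loc_int nu.
Proof.
have [C bd] := lp_bound l; apply: (loc_int_bounded (lp_mnu l)).
by apply: aeS bd => x [_ _ h _]; exact: h.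
Qed.

Lemma lagr_prim_r_loc_int : loc_int r.
Proof.
have [C bd] := lp_bound l; apply: (loc_int_bounded (lp_mr l)).
by apply: aeS bd => x [_ _ _ h]; exact: h.
Qed.

(** Between [chi (y x)] and [x] the map [y] is constant, so a point [t] there with [chi (y t) = t]
    is the left end. Everywhere else, up to a null set, [y'] and hence [U'] vanish, and [U] does not
    change. *)
Lemma lagr_prim_U_factor x : U (chi (y x)) = U x.
Proof.
have sx : chi (y x) <= x by rewrite (lift_inv_le yl).
apply/eqP; rewrite eq_sym -subr_eq0 (lp_U l).2//.
pose s := chi (y x).
have U0 : \forall t \ae leb, s <= t <= x -> U' t = 0.
  have ns : \forall t \ae leb, t != s.
    exists [set s]; split; first exact: measurable_set1.
      exact: lebesgue_measure_set1.
    by move=> t /= /negP; rewrite negbK => /eqP.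
  apply: (aeS3 _ ns (lift_inv_ae yl) lagr_prim_U'_eq0).
  move=> t nts [y0|E] tU /andP[st tx]; first exact: tU.
  move: nts; rewrite -E; case/eqP; congr chi; apply/eqP; rewrite eq_le.
  rewrite (lift_nd yl tx)/= -[leLHS](lift_invK yl (y x)).
  exact: (lift_nd yl).
rewrite /Rintegral (_ : (\int[leb]_(t in _) _)%E = 0%E)//.
apply: (etrans _ (integral0 leb `[s, x])); apply: ae_eq_integral => //.
  by apply/measurable_EFinP/measurable_funTS; exact: (lp_U l).1.1.
by apply: aeS U0 => t + /=; rewrite in_itv/= => /[apply] ->.
Qed.

(** Testing the push-forward identity on segments identifies [rho] with [lift_density y y' r];
    composing with [y] recovers [r], both sides being zero where [y'] vanishes. *)
Lemma is_eulerian_of_rho u rho mu (nu2 r2 : Mclass) :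
  (\forall x \ae leb, r2 x = r x) ->
  is_eulerian_of (Lagrangian y U nu2 r2) (Eulerian u rho mu) ->
  \forall x \ae leb, r x = rho (y x) * y' x.
Proof.
move=> rE [_ _ /loc_intP lrho rhoE].
have lr := lagr_prim_r_loc_int; have r0 := lagr_prim_r_eq0.
have rhoh : \forall x \ae leb, rho x = lift_density y y' r x.
  apply: loc_int_eq_ae => //; first exact: (lift_density_loc_int yl lr r0).
  move=> a b ab; rewrite (lift_density_Rintegral yl lr r0)//.
  rewrite (rhoE a b `[a, b]%classic)//.
  apply: eq_ae_Rintegral => //; last exact: lr.1.
    exact: (measurable_preimage (lift_measurable yl)).
  exact: measurable_class.
apply: aeS2 (transport_ae (lift_transports yl) rhoh) (lift_densityE yl r0).
by move=> x [->|->] <-; rewrite ?mulr0.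
Qed.

End lagr_prim_facts.

(** Surjectivity of [y] determines [u], and the push-forwards determine [rho] and [mu]; so the
    choice in [mapM] has a single candidate. *)
Lemma is_eulerian_of_uniq X E1 E2 : calF R X ->
  is_eulerian_of X E1 -> is_eulerian_of X E2 -> E1 = E2.
Proof.
move=> FX; have [y' [U' l]] := calF_lagr_prim FX; have yl := lp_lift l.
case: X FX l yl => y U nu r FX /= l yl; case: E1 => u1 rho1 mu1.
case: E2 => u2 rho2 mu2 [u1E mu1E /loc_intP l1 rho1E] [u2E mu2E /loc_intP l2 rho2E].
congr Eulerian.
- apply/funext => x; rewrite -(lift_invK yl x).
  by rewrite u1E u2E.
- apply: ae_class_eq; apply: loc_int_eq_ae => // a b ab.
  by rewrite (rho1E a b)// (rho2E a b).
- by apply: borel_measure_ext => B mB; rewrite mu1E// mu2E.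
Qed.

Lemma is_eulerian_of_relabel X f f' E : calF R X -> bilip f f' ->
  is_eulerian_of X E -> is_eulerian_of (relabel X f) E.
Proof.
move=> FX ff'; rewrite (relabelE _ ff').
have [y' [U' l]] := calF_lagr_prim FX; have yl := lp_lift l.
have my := lift_measurable yl.
case: X FX l yl my => y U nu r FX /= l yl my; case: E => u rho mu.
have ft := bilip_transports ff'.
have mf : measurable_fun setT f by case: ft.
have mnuf := measurable_relabel nu ff'.
have mrf := measurable_relabel r ff'.
move=> [uE muE lrho rhoE]; split => //.
- move=> B mB; have myB := measurable_preimage my mB.
  have myfB : measurable ((y \o f) @^-1` B).
    exact: (measurable_preimage mf myB).
  rewrite muE// (transport_integral ft)//; last exact: measurable_class.
  apply: ae_eq_integral => //.
  + by apply/measurable_EFinP; exact: measurable_funTS.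
  + apply/measurable_EFinP; apply: measurable_funTS; exact: measurable_class.
  + by apply: aeS (ae_classE mnuf) => x -> _.
- move=> a b B mB Bab; have myB := measurable_preimage my mB.
  have myfB : measurable ((y \o f) @^-1` B).
    exact: (measurable_preimage mf myB).
  rewrite (rhoE a b)// (transport_Rintegral ft)//; last exact: measurable_class.
  apply: eq_ae_Rintegral => //; first exact: measurable_class.
  by apply: aeS (ae_classE mrf) => x ->.
Qed.

End eulerian_of_lagrangian.

(** * The Eulerian triplet of an element of [calF], and its membership in [calD] *)

Section existence.
Context {R : realType}.
Local Notation leb := (@lebesgue_measure R).
Local Notation Mclass :=
  {mfun_ leb, (measurableTypeR R) >-> (measurableTypeR R)}.
Implicit Types (f g w : R -> R) (a b c : R) (X : lagrangian R).
Implicit Types (mu : borel_measure R).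

Lemma is_ac_part_ae (mu : borel_measure R) (g1 g2 : R -> R) :
  measurable_fun setT g1 -> measurable_fun setT g2 ->
  (\forall x \ae leb, g1 x = g2 x) ->
  (exists mus : {measure set (measurableTypeR R) -> \bar R},
    (exists N : set (measurableTypeR R),
       [/\ measurable N, leb N = 0%E & mus (~` N) = 0%E]) /\
    (forall B : set (measurableTypeR R), measurable B ->
       mu B = (\int[leb]_(x in B) (g1 x)%:E + mus B)%E)) ->
  is_ac_part mu (fun B => \int[leb]_(x in B) (g2 x)%:E)%E.
Proof.
move=> mg1 mg2 g12 [mus [musN muE]]; split.
  apply/null_content_dominatesP => B mB B0.
  apply: null_set_integral => //.
  by apply/measurable_EFinP; exact: measurable_funTS.
exists mus; split=> // B mB; rewrite muE//; congr (_ + _)%E.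
apply: ae_eq_integral => //; try
  by apply/measurable_EFinP; exact: measurable_funTS.
by apply: aeS g12 => x -> _.
Qed.

Variables (y y' U U' : R -> R) (nu r : Mclass).
Hypothesis l : lagr_prim y y' U U' nu r.
Let yl := lp_lift l.
Local Notation chi := (lift_inv y).

Let u := U \o chi.
Let w := lift_density y y' U'.
Let rho := lift_density y y' r.
Let g x := u x ^+ 2 + w x ^+ 2 + rho x ^+ 2.
Let S : set (measurableTypeR R) := y' @^-1` [set 0].
Let nuS x := nu x * \1_S x.

Let my : measurable_fun setT y. Proof. exact: lift_measurable yl. Qed.
Let my' : measurable_fun setT y'. Proof. by case: yl => [[[]]]. Qed.
Let mchi : measurable_fun setT chi. Proof. exact: lift_inv_measurable yl. Qed.
Let mnu : measurable_fun setT nu. Proof. exact: lp_mnu l. Qed.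
Let mS : measurable S.
Proof. exact: (measurable_preimage my' (measurable_set1 0)). Qed.
Let mnuS : measurable_fun setT nuS.
Proof. by apply: measurable_funM => //; exact: measurable_indic. Qed.

Let lw : loc_int w.
Proof. exact: (lift_density_loc_int yl (lp_U l).1 (lagr_prim_U'_eq0 l)). Qed.

Let lrho : loc_int rho.
Proof.
exact: (lift_density_loc_int yl (lagr_prim_r_loc_int l) (lagr_prim_r_eq0 l)).
Qed.

Let uE : u \o y = U.
Proof. by apply/funext => x; exact: lagr_prim_U_factor l x. Qed.

Let uw : is_prim u w.
Proof.
apply: (lift_density_is_prim yl (lp_U l).1 (lagr_prim_U'_eq0 l)).
by rewrite uE; exact: lp_U l.
Qed.

Let mu_ : measurable_fun setT u.
Proof. exact: (continuous_loc_int (is_prim_continuous uw)).1. Qed.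

Let mg : measurable_fun setT g.
Proof.
apply: measurable_funD; last exact: measurable_funX lrho.1.
by apply: measurable_funD; apply: measurable_funX => //; exact: lw.1.
Qed.

Let g0 x : 0 <= g x. Proof. by rewrite !addr_ge0 ?sqr_ge0. Qed.

(** Off the critical set [S], dividing the energy identity by [y'] expresses [nu] through [u], [w]
    and [rho] at [y x]. On [S] that term is zero and all of [nu] goes into [nuS]. *)
Let gE : \forall x \ae leb, nu x = g (y x) * y' x + nuS x.
Proof.
apply: aeS3 (lift_inv_ae yl) (lp_eq l) (lp_nu0 l) => x [y0|E] eqx nu0.
  by rewrite y0 mulr0 add0r /nuS indicE mem_set ?mulr1.
have [y0|y0] := eqVneq (y' x) 0.
  by rewrite y0 mulr0 add0r /nuS indicE mem_set ?mulr1.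
rewrite /nuS indicE memNset ?mulr0 ?addr0; last by move/eqP; rewrite (negbTE y0).
rewrite /g /u /w /rho /lift_density /= E.
apply: (mulfI y0); rewrite eqx.
by field.
Qed.

Let nu_abs : \forall x \ae leb, nu x = `|nu x|.
Proof. by apply: aeS (lp_nu0 l) => x h; rewrite ger0_norm. Qed.

Let m : pre_borel_measure R := image_density my mnu.
Let mus := image_density my mnuS.

Let E := Eulerian u (ae_class rho) (\pi_(borel_measure R) m).

Let preim (B : set (measurableTypeR R)) : measurable B -> measurable (y @^-1` B).
Proof. exact: measurable_preimage. Qed.

Let mEfin (f : R -> R) (B : set R) : measurable_fun setT f ->
  measurable_fun B (EFin \o f).
Proof. by move=> mf; apply/measurable_EFinP; exact: measurable_funTS. Qed.

Let muE (B : set (measurableTypeR R)) : measurable B ->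
  eu_mu E B = (\int[leb]_(x in y @^-1` B) (nu x)%:E)%E.
Proof.
move=> mB; apply: (etrans (pi_measureE m mB)).
apply: (etrans (image_densityE my mnu B)).
have myB := preim mB.
apply: ae_eq_integral => //; [|exact: mEfin|].
  by apply: mEfin; exact: measurableT_comp.
by apply: aeS nu_abs => x <- _.
Qed.

Let rhoE := ae_classE lrho.1.

Lemma eulerian_of_lagr_prim : is_eulerian_of (Lagrangian y U nu r) E.
Proof.
split.
- by move=> x; rewrite -[in RHS]uE.
- by move=> B mB; rewrite -muE.
- apply/loc_intP; apply: (@loc_int_ae _ rho) => //.
    exact: measurable_class.
  by apply: aeS rhoE => x ->.
- move=> a b B mB Bab.
  rewrite (eq_ae_Rintegral mB (measurable_class _) lrho.1 rhoE).
  exact: (lift_density_Rintegral yl (lagr_prim_r_loc_int l)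
    (lagr_prim_r_eq0 l) mB).
Qed.

Let muE2 (B : set (measurableTypeR R)) : measurable B ->
  eu_mu E B = (\int[leb]_(x in B) (g x)%:E + mus B)%E.
Proof.
move=> mB; have myB := preim mB.
have mF := transport_measurable (lift_transports yl) mg.
rewrite muE// [X in (X + _)%E](transport_integral (lift_transports yl))//.
have mS1 : measurable_fun setT (fun x => `|nuS x|) by exact: measurableT_comp.
suff H : (\int[leb]_(x in y @^-1` B) (nu x)%:E =
    \int[leb]_(x in y @^-1` B) (g (y x) * y' x)%:E +
    \int[leb]_(x in y @^-1` B) `|nuS x|%:E)%E by exact: H.
apply: (etrans _ (@ge0_integralD _ (measurableTypeR R) R leb _ myB
  (fun x => (g (y x) * y' x)%:E) (fun x => `|nuS x|%:E) _ _ _ _)).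
- apply: ae_eq_integral => //.
  + exact: mEfin.
  + by apply: emeasurable_funD; exact: mEfin.
  + apply: aeS2 gE (lp_nu0 l) => x e nu0 _; rewrite /= -EFinD ger0_norm ?e//.
    by rewrite /nuS mulr_ge0.
- by move=> x _; rewrite lee_fin mulr_ge0//; case: yl.
- exact: mEfin.
- by move=> x _; rewrite lee_fin.
- exact: mEfin.
Qed.

Let muy (B : set (measurableTypeR R)) a b : measurable B -> B `<=` `[a, b]%classic ->
  (eu_mu E B < +oo)%E.
Proof.
move=> mB Bab; rewrite muE//; apply: integrable_lty; first exact: preim.
exact: (lift_preimage_integrable yl (lagr_prim_nu_loc_int l) mB Bab).
Qed.

(** The part of [mu] with density [g] is at most [mu], which is finite on bounded sets. This single
    bound yields the square integrability of both [w] and [rho]. *)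
Let gy : (\int[leb]_(x in `[0%R, 1%R]) (g x)%:E < +oo)%E.
Proof.
have m01 : measurable (`[0, 1]%classic : set (measurableTypeR R)) by [].
apply: le_lt_trans (muy m01 (@subset_refl _ _)).
by rewrite muE2// leeDl.
Qed.

Let le_gy (f : R -> R) : measurable_fun setT f ->
  (\forall x \ae leb, f x ^+ 2 <= g x) ->
  (\int[leb]_(x in `[0%R, 1%R]) (f x ^+ 2)%:E < +oo)%E.
Proof.
move=> mf fg; apply: le_lt_trans gy; apply: ae_ge0_le_integral => //.
- by move=> x _; rewrite lee_fin sqr_ge0.
- by apply: mEfin; exact: measurable_funX.
- by move=> x _; rewrite lee_fin.
- exact: mEfin.
- by apply: aeS fg => x h _; rewrite lee_fin.
Qed.

Let H1u : H1_per u.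
Proof.
apply/H1_perP; split.
  by move=> x; rewrite /u /= (lift_inv_add1 yl) (lp_Uper l).
exists w => //; apply: le_gy; first exact: lw.1.
by apply: aeW => x; rewrite /g addrAC lerDr addr_ge0 ?sqr_ge0.
Qed.

Let L2rho : Lp_per 2%:E (ae_class rho).
Proof.
apply/Lp_per2P; split; first exact: measurable_class.
- apply: le_gy; first exact: measurable_class.
  by apply: aeS rhoE => x ->; rewrite /g lerDr addr_ge0 ?sqr_ge0.
- apply: (@ae_per_eq _ rho); first by apply: aeS rhoE => x ->.
  have y'1 : ae_per y' by case: yl => yp _ y1; exact: is_prim_per yp y1.
  apply: aeS2 (lift_inv_ae_comp yl y'1) (lift_inv_ae_comp yl (lp_rper l)).
  by move=> x h1 h2; rewrite /rho /lift_density (lift_inv_add1 yl) h1 h2.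
Qed.

Let radon_mu : radon (eu_mu E).
Proof.
move=> K cK; have mK := compact_measurable cK.
have [M [_ MK]] := compact_bounded cK.
apply: (@muy _ (- (M + 1)) (M + 1)) => //.
move=> x Kx /=; rewrite in_itv/=.
have : `|x| <= M + 1 by apply: MK => //; rewrite ltrDl.
by rewrite ler_norml.
Qed.

Let per_mu : periodic_measure (eu_mu E).
Proof.
move=> B mB; have [_ _ y1] := yl.
have imE : [set x + 1 | x in B] = (fun x => x - 1) @^-1` B.
  apply/seteqP; split => [_ [x Bx <-]/=|x /= Bx]; first by rewrite addrK.
  by exists (x - 1) => //; rewrite subrK.
have mim : measurable ([set x + 1 | x in B] : set (measurableTypeR R)).
  rewrite imE; apply: measurable_preimage => //.
  exact: measurable_funD.
rewrite !muE// (transport_integral (transports_shift 1)) => [|//|//]; last exact: preim.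
have -> : (fun x => x + 1) @^-1` (y @^-1` [set x + 1 | x in B]) = y @^-1` B.
  rewrite imE; apply/seteqP; split => x /=; by rewrite y1 addrK.
apply: ae_eq_integral; [exact: preim| | |].
- apply: mEfin; apply: measurable_funM => //.
  by apply: measurableT_comp => //; exact: measurable_funD.
- exact: mEfin.
- by apply: aeS (lp_nuper l) => x -> _; rewrite mulr1.
Qed.

(* The singular part is carried by the image of [S], on which [y] is critical. *)
Let ac_mu : is_ac_part (eu_mu E) (fun B => \int[leb]_(x in B)
  (u x ^+ 2 + wderiv u x ^+ 2 + ae_class rho x ^+ 2)%:E)%E.
Proof.
have uw' := is_prim_wderiv uw.
apply: (@is_ac_part_ae _ g) => //.
- apply: measurable_funD; last by apply: measurable_funX; exact: measurable_class.
  by apply: measurable_funD; apply: measurable_funX => //; exact: uw'.1.1.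
- by apply: aeS2 (wderivE uw) rhoE => x -> ->.
exists mus; split; last exact: muE2.
have mchiS : measurable (chi @^-1` S : set (measurableTypeR R)).
  exact: (measurable_preimage mchi mS).
have chiS0 : leb (chi @^-1` S) = 0%E.
  have [_ _ _ yE] := lift_transports yl.
  apply: (etrans (yE _ mchiS)).
  apply: (etrans _ (integral0 leb (y @^-1` (chi @^-1` S)))).
  apply: ae_eq_integral => //; [exact: preim|exact: mEfin|].
  by apply: aeS (lift_inv_ae yl) => x [->//|E1] /=; rewrite E1 => ->.
(* A Borel null set that contains the image of [S] by [y]: a point of [S] whose value is not in
   [lift_rat] is recovered by [chi] from this value. *)
exists (chi @^-1` S `|` lift_rat y); split.
- by apply: measurableU => //; exact: measurable_lift_rat.
- apply/eqP; rewrite -measure_le0 (le_trans (measureU2 _ _ _))//.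
    exact: measurable_lift_rat.
  by rewrite [X in (X + _)%E]chiS0 [X in (_ + X)%E]leb_lift_rat adde0.
apply: (etrans (image_densityE _ _ _)); apply: integral0_eq => x /= nx.
rewrite /nuS indicE memNset ?mulr0 ?normr0// => Sx; apply: nx.
have [rx|nrx] := pselect (lift_rat y (y x)); first by right.
by left; rewrite /= (lift_inv_rat yl nrx).
Qed.

Lemma calD_lagr_prim : calD R E.
Proof. by split. Qed.

End existence.

(** * The map M and its invariance under relabeling *)

Section mapM_invariance.
Context {R : realType}.
Local Notation leb := (@lebesgue_measure R).
Implicit Types (X : lagrangian R).

Lemma mapM_eq X E : calF R X -> is_eulerian_of X E -> mapM X = E.
Proof.
move=> FX XE; rewrite /mapM; case: xgetP => [E' _ XE'|/(_ E)//].
exact: is_eulerian_of_uniq FX XE' XE.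
Qed.

Lemma mapMP X : calF R X -> is_eulerian_of X (mapM X) /\ calD R (mapM X).
Proof.
move=> FX; have [y' [U' l]] := calF_lagr_prim FX.
case: X FX l => y U nu r FX /= l.
have XE := eulerian_of_lagr_prim l; rewrite (mapM_eq FX XE); split=> //.
exact: calD_lagr_prim.
Qed.

Lemma mapM_relabel X f f' : calF R X -> bilip f f' -> mapM (relabel X f) = mapM X.
Proof.
move=> FX ff'; apply: mapM_eq; first exact: relabel_calF FX ff'.
apply: (is_eulerian_of_relabel FX ff').
by have [] := mapMP FX.
Qed.

End mapM_invariance.

(** * Injectivity of M on [calH] *)

Section injectivity.
Context {R : realType}.
Local Notation leb := (@lebesgue_measure R).
Implicit Types (X : lagrangian R).

Lemma calH_inv_increment X E : calH R X -> is_eulerian_of X E ->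
  energy X = fine (eu_mu E `[0, 1[%classic) /\
  forall a b, a <= b ->
    (1 + energy X) * (lift_inv (la_y X) b - lift_inv (la_y X) a) =
    b - a + fine (eu_mu E `[a, b[%classic).
Proof.
move=> [[FX F0] _]; have [y' [U' l]] := calF_lagr_prim FX; have yl := lp_lift l.
case: E => u rho mu; case: X FX F0 l yl => y U nu r FX /= F0 l yl [_ muE _ _].
have lnu := lagr_prim_nu_loc_int l; have [yp _ y1] := yl.
set h := energy _ in F0 *; set chi := lift_inv y.
have E a b : a <= b ->
    \int[leb]_(x in `[chi a, chi b]) nu x = fine (mu `[a, b[%classic).
  move=> ab; rewrite muE//; rewrite -Rintegral_itv_bndo_bndc.
    by rewrite -(lift_preimage_itvco yl).
  apply: (@loc_int_itv _ _ _ (chi a) (chi b)) => //.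
  by apply: subset_itvl; rewrite bnd_simp.
split.
  rewrite -E ?ler01// /h (energyE l).
  rewrite -(per_Rintegral (lagr_prim_nu l) (lp_nuper l) (chi 0)).
  by rewrite -(lift_inv_add1 yl) add0r.
move=> a b ab; have chiab : chi a <= chi b := lift_inv_nd yl ab.
rewrite -E// -Rintegral_cst_itv//.
have F0' : \forall x \ae leb, 1 + h = y' x + nu x.
  by apply: aeS2 F0 (wderivE yp) => x <- ->.
have mnu := lp_mnu l; have my' := yp.1.1.
rewrite (@eq_ae_Rintegral _ (cst (1 + h)) _ _ _ _ _ F0')//; last first.
  exact: measurable_funD.
rewrite RintegralD//; [|exact: yp.1.2|exact: lnu.2].
by rewrite -yp.2// !(lift_invK yl).
Qed.

Lemma calH_inj X1 X2 E : calH R X1 -> calH R X2 ->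
  is_eulerian_of X1 E -> is_eulerian_of X2 E -> X1 = X2.
Proof.
move=> H1 H2 E1 E2.
have [h1 c1] := calH_inv_increment H1 E1.
have [h2 c2] := calH_inv_increment H2 E2.
have [[FX1 F01] I1] := H1; have [[FX2 F02] I2] := H2.
have h0 := energy_lt0 FX1.
have [y1' [U1' l1]] := calF_lagr_prim FX1; have yl1 := lp_lift l1.
have [y2' [U2' l2]] := calF_lagr_prim FX2; have yl2 := lp_lift l2.
(* The increments of the two inverses agree, so the inverses differ by their difference at 0. *)
pose c := lift_inv (la_y X1) 0 - lift_inv (la_y X2) 0.
have hE : energy X2 = energy X1 by rewrite h1.
have chiE x : lift_inv (la_y X1) x = lift_inv (la_y X2) x + c.
  have H a b : a <= b -> lift_inv (la_y X1) b - lift_inv (la_y X1) a =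
      lift_inv (la_y X2) b - lift_inv (la_y X2) a.
    move=> ab; apply: (mulfI (lt0r_neq0 h0)).
    by rewrite c1// -c2// hE.
  by rewrite /c; have [/H|/ltW/H] := leP 0 x; lra.
have yE x : la_y X1 x = la_y X2 (x - c).
  (* A lift is recovered from its generalized inverse by the equivalence of [chi z <= x] and
     [z <= y x]. *)
  have H z : (z <= la_y X1 x) = (z <= la_y X2 (x - c)).
    by rewrite -(lift_inv_le yl1) -(lift_inv_le yl2) chiE lerBrDr.
  by apply/eqP; rewrite eq_le -H lexx H lexx.
have c0 : c = 0.
  have := lift_shift_integral c yl2; rewrite I2 sub0r => cE.
  apply/eqP; rewrite -oppr_eq0 -cE; apply/eqP; apply: etrans I1.
  by apply: eq_Rintegral => x _; rewrite yE.
have {}yE : la_y X1 = la_y X2 by apply/funext => x; rewrite yE c0 subr0.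
case: E E1 E2 {h1 c1 h2 c2} => u rho mu E1 E2.
have rE X y' U' : lagr_prim (la_y X) y' (la_U X) U' (la_nu X) (la_r X) ->
    is_eulerian_of X (Eulerian u rho mu) ->
    \forall x \ae leb, la_r X x = rho (la_y X x) * wderiv (la_y X) x.
  case: X => y U nu r /= l XE; have [yp _ _] := lp_lift l.
  apply: aeS2 (is_eulerian_of_rho l _ XE) (wderivE yp); last exact: aeW.
  by move=> x -> ->.
have r1E := rE _ _ _ l1 E1; have r2E := rE _ _ _ l2 E2.
have UE X : is_eulerian_of X (Eulerian u rho mu) -> la_U X = u \o la_y X.
  by case: X => y U nu r [uE _ _ _]; apply/funext => x /=; rewrite uE.
have U1E := UE _ E1; have U2E := UE _ E2.
move: yE hE F01 F02 r1E r2E U1E U2E; clear.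
case: X1 => y1 U1 nu1 r1; case: X2 => y2 U2 nu2 r2 /= -> hE F01 F02 r1E r2E -> ->.
congr Lagrangian; apply: ae_class_eq.
  (* The normalization of [calF0] gives [nu = 1 + h - y_xi] on both sides, with the same [y] and
     [h]. *)
  by apply: aeS2 F01 F02 => x e1 e2; move: hE e1 e2; lra.
by apply: aeS2 r1E r2E => x -> ->.
Qed.

End injectivity.

(** * From Eulerian to Lagrangian variables *)

Section lagrangian_of_eulerian.
Context {R : realType}.
Local Notation leb := (@lebesgue_measure R).
Implicit Types (a b c x xi : R).

Variable mu : borel_measure R.
Hypothesis mur : radon mu.
Hypothesis mup : periodic_measure mu.

Let m a b := fine (mu `[a, b[%classic).

Lemma radon_itvco a b : (mu `[a, b[%classic < +oo)%E.
Proof.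
apply: le_lt_trans (mur (@segment_compact _ a b)).
apply: le_measure; rewrite ?inE//.
by apply: subset_itvl; rewrite bnd_simp.
Qed.

Let mE a b : mu `[a, b[%classic = (m a b)%:E.
Proof. by rewrite /m fineK// ge0_fin_numE// radon_itvco. Qed.

Let m_ge0 a b : 0 <= m a b.
Proof. exact: fine_ge0. Qed.

Let mD a b c : a <= b -> b <= c -> m a c = m a b + m b c.
Proof.
move=> ab bc; have : (m a c)%:E = ((m a b)%:E + (m b c)%:E)%E.
  rewrite -!mE -measureU//.
    congr (mu _); apply/seteqP; split => x /=; rewrite !in_itv/=.
      by move=> /andP[ax xc]; have [xb|bx] := ltP x b; [left|right];
        rewrite ?ax ?bx.
    move=> [] /andP[h1 h2].
      by rewrite h1 (lt_le_trans h2).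
    by rewrite h2 andbT (le_trans ab).
  apply/seteqP; split => x //= []; rewrite !in_itv/= => /andP[_ xb] /andP[bx _].
  by move: xb; rewrite ltNge bx.
by rewrite -EFinD => -[].
Qed.

Let mper a b : m (a + 1) (b + 1) = m a b.
Proof.
rewrite /m -(mup (B := `[a, b[%classic))//; congr (fine (mu _)).
apply/seteqP; split => [x /= xab|_ [x /= xab <-]].
  by exists (x - 1); rewrite ?subrK//=; move: xab; rewrite !in_itv/= lerBrDr ltrBlDr.
by move: xab; rewrite !in_itv/= lerD2r ltrD2r.
Qed.

Let mxx a : m a a = 0.
Proof. by rewrite /m set_itv_ge ?measure0// bnd_simp ltxx. Qed.

Let h := m 0 1.

Let m1 x : m x (x + 1) = h.
Proof.
have x1 : x <= x + 1 by rewrite lerDl.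
have [x0|/ltW x0] := leP 0 x.
  have := mD x0 x1; have := mD (@ler01 R) (_ : 1 <= x + 1).
  rewrite lerDr => /(_ x0); have := mper 0 x; rewrite add0r => -> ->.
  by rewrite -/h; lra.
have x11 : x + 1 <= 1 by rewrite gerDr.
have := mD x1 x11; rewrite (mD x0 (@ler01 R)).
by have := mper x 0; rewrite add0r => ->; rewrite -/h; lra.
Qed.

Lemma cumulB a b : a <= b -> cumul mu b - cumul mu a = m a b.
Proof.
move=> ab; rewrite /cumul; case: (leP 0 a) => a0.
  by rewrite (le_trans a0 ab) -!/(m _ _) (mD a0 ab); lra.
case: (leP 0 b) => b0; rewrite -!/(m _ _).
  by rewrite (mD (ltW a0) b0); lra.
by rewrite (mD ab (ltW b0)); lra.
Qed.

(** Strictly increasing and left continuous, with jumps at the atoms of [mu]. After scaling by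
    [1 + h], [cumul_inv] is its generalized inverse, flat across these jumps. *)
Let Phi x := cumul mu x + x.

Let PhiB a b : a <= b -> Phi b - Phi a = m a b + (b - a).
Proof. by move=> ab; rewrite -cumulB// /Phi; lra. Qed.

Let Phi_lt a b : a < b -> Phi a < Phi b.
Proof. by move=> ab; have := PhiB (ltW ab); have := m_ge0 a b; lra. Qed.

Let Phi1 x : Phi (x + 1) = Phi x + (1 + h).
Proof.
have := @PhiB x (x + 1); rewrite lerDl => /(_ ler01).
by rewrite m1; lra.
Qed.

Let Phi0 : Phi 0 = 0.
Proof. by rewrite /Phi /cumul lexx -/(m _ _) mxx addr0. Qed.

Let h0 : 0 <= h. Proof. exact: m_ge0. Qed.

(** Left continuity of [Phi]: the intervals [[x - 1 / (n + 1), x[] decrease to the empty set, so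
    their mass tends to zero. It makes the inequality in [y_lt] strict. *)
Let Phi_left x e : 0 < e -> exists2 t, t < x & Phi x - e < Phi t.
Proof.
move=> e0; pose I (n : nat) : set (measurableTypeR R) :=
  `[x - n.+1%:R^-1, x[%classic.
have cI : mu (I n) @[n --> \oo] --> mu (\bigcap_n I n).
  apply: nonincreasing_cvg_mu => //.
  - by rewrite /I; exact: radon_itvco.
  - by move=> n; exact: (measurable_itv `[x - n.+1%:R^-1, x[).
  - by apply: bigcapT_measurable => n; exact: (measurable_itv `[x - n.+1%:R^-1, x[).
  - move=> n k nk; apply/subsetPset; apply: subset_itvr; rewrite bnd_simp.
    by rewrite lerB// lef_pV2 ?posrE ?ltr0n// ler_nat.
have I0 : \bigcap_n I n = set0.
  apply/seteqP; split => // t It.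
  have tx : t < x by have : I 0%N t := It 0%N Logic.I; rewrite /I /= in_itv/= => /andP[].
  pose n := Num.truncn (x - t)^-1.
  have : I n t := It n Logic.I; rewrite /I /= in_itv/= => /andP[+ _].
  apply/negP; rewrite -ltNge ltrBrDr -ltrBrDl.
  rewrite invf_plt ?posrE ?subr_gt0 ?ltr0n//.
  exact: truncnS_gt.
rewrite I0 measure0 in cI.
have e20 : 0 < e / 2 by rewrite divr_gt0.
have [n [mn ne]] : exists n, m (x - n.+1%:R^-1) x < e / 2 /\ n.+1%:R^-1 < e / 2.
  have c1 : \forall n \near \oo, m (x - n.+1%:R^-1) x < e / 2.
    exact: (@cvgr_lt _ _ \oo _ (fun n => m (x - n.+1%:R^-1) x) _ (fine_cvg cI)).
  have c2 : \forall n \near \oo, n.+1%:R^-1 < e / 2.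
    exact: (near_infty_natSinv_lt (PosNum e20)).
  have [n _ hn] := filterI c1 c2.
  by exists n; have [/= h1 h2] := hn n (leqnn n); split.
have xn : x - n.+1%:R^-1 < x by rewrite ltrBlDr ltrDl invr_gt0.
exists (x - n.+1%:R^-1) => //.
move: ne mn xn; set d : R := _^-1 => ne mn xn.
by have := PhiB (ltW xn); move: mn ne; lra.
Qed.

Definition cumul_inv xi := sup [set x | cumul mu x + x < (1 + h) * xi].
Local Notation y := cumul_inv.

Let y_ne xi : [set x | Phi x < (1 + h) * xi] !=set0.
Proof.
(* To the left of 0 one has [Phi x <= x], so any nonpositive [x] below [(1 + h) * xi] is in the
   set. *)
pose x := Num.min 0 ((1 + h) * xi - 1); exists x => /=.
have x0 : x <= 0 by rewrite /x ge_min lexx.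
have x1 : x <= (1 + h) * xi - 1 by rewrite /x ge_min lexx orbT.
by have := PhiB x0; rewrite Phi0; have := m_ge0 x 0; lra.
Qed.

Let y_ub xi : has_ubound [set x | Phi x < (1 + h) * xi].
Proof.
(* To the right of 0 one has [x <= Phi x], so a positive member of the set is below
   [(1 + h) * xi]. *)
exists (Num.max 0 ((1 + h) * xi)) => x /= Px.
rewrite le_max; have [//|x0/=] := leP x 0.
by have := PhiB (ltW x0); rewrite Phi0; have := m_ge0 0 x; lra.
Qed.

Let y_ge x xi : Phi x < (1 + h) * xi -> x <= y xi.
Proof. by move=> Px; exact: ub_le_sup. Qed.

Let y_le x xi : (1 + h) * xi <= Phi x -> y xi <= x.
Proof.
move=> xP; apply: ge_sup => // t /= tP; rewrite leNgt; apply/negP => /Phi_lt.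
by rewrite -/(Phi t) in tP; lra.
Qed.

Let y_lt x xi : (1 + h) * xi < Phi x -> y xi < x.
Proof.
move=> xP; have [|t tx tP] := @Phi_left x (Phi x - (1 + h) * xi).
  by rewrite subr_gt0.
by apply: le_lt_trans tx; apply: y_le; lra.
Qed.

Lemma cumul_inv_nd : {homo y : s t / s <= t}.
Proof.
move=> s t st; apply: ge_sup => // x /= xs; apply: y_ge; apply: lt_le_trans xs _.
by rewrite ler_wpM2l// addr_ge0.
Qed.

Lemma cumul_inv_add1 xi : y (xi + 1) = y xi + 1.
Proof.
apply/eqP; rewrite eq_le; apply/andP; split.
  apply: ge_sup => // x /=; rewrite -/(Phi x) => Px.
  rewrite -lerBlDr; apply: y_ge.
  have := Phi1 (x - 1); rewrite subrK => E.
  by move: Px; rewrite E mulrDr mulr1; lra.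
rewrite -lerBrDr; apply: ge_sup => // x /=; rewrite -/(Phi x) => Px.
rewrite lerBrDr; apply: y_ge; rewrite Phi1 mulrDr mulr1.
by lra.
Qed.

Let my : measurable_fun setT y.
Proof. exact: nondecreasing_measurable cumul_inv_nd. Qed.

Let h1 : 0 < 1 + h. Proof. by rewrite ltr_wpDr. Qed.

Let mh : measurable_fun setT (cst (1 + h) : R -> R). Proof. by []. Qed.

(** Atoms at [a] or [b] leave it open which end points belong to the preimage; it is squeezed
    between the open and the closed interval with ends [Phi a / (1 + h)] and [Phi b / (1 + h)],
    which have the same measure. *)
Let leb_preim a b : a <= b ->
  leb (y @^-1` `[a, b[%classic) = ((Phi b - Phi a) / (1 + h))%:E.
Proof.
move=> ab; have Pab : Phi a / (1 + h) <= Phi b / (1 + h).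
  rewrite ler_pM2r ?invr_gt0//; have := PhiB ab; have := m_ge0 a b; lra.
have mA : measurable (y @^-1` `[a, b[%classic).
  exact: measurable_preimage.
apply/eqP; rewrite mulrBl eq_le; apply/andP; split.
  apply: (@le_trans _ _ (leb `[Phi a / (1 + h), Phi b / (1 + h)]%classic)).
    apply: le_measure; rewrite ?inE//.
    move=> xi /=; rewrite !in_itv/= ler_pdivrMr// ler_pdivlMr// ![xi * _]mulrC.
    move=> /andP[axi xib]; apply/andP; split; rewrite leNgt; apply/negP.
      by move=> /y_lt; rewrite ltNge axi.
    by move=> /y_ge; rewrite leNgt xib.
  by rewrite lebesgue_measure_itv/= lte_fin; case: ifPn => //; rewrite lee_fin subr_ge0.
apply: (@le_trans _ _ (leb `]Phi a / (1 + h), Phi b / (1 + h)[%classic)).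
  rewrite lebesgue_measure_itv/= lte_fin; case: ifPn => //.
  by rewrite -leNgt lee_fin subr_le0.
apply: le_measure; rewrite ?inE//.
move=> xi /=; rewrite !in_itv/= ltr_pdivrMr// ltr_pdivlMr// ![xi * _]mulrC.
by move=> /andP[/y_ge -> /y_lt ->].
Qed.

Lemma cumul_inv_image (B : set (measurableTypeR R)) : measurable B ->
  image_density my mh B = measure_add mu leb B.
Proof.
have imE a b : a <= b -> image_density my mh `[a, b[%classic = (Phi b - Phi a)%:E.
  move=> ab; rewrite image_densityE.
  have mA : measurable (y @^-1` `[a, b[%classic).
    exact: measurable_preimage.
  transitivity (`|1 + h|%:E * leb (y @^-1` `[a, b[%classic))%E.
    exact: (@integral_cst _ (measurableTypeR R) R leb _ mA `|1 + h|%:E).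
  rewrite (leb_preim ab) -EFinM ger0_norm ?ltW//.
  by rewrite mulrC divfK// gt_eqF.
apply: measure_eq_itvco => a b.
  move=> ab; apply: (etrans (imE _ _ ab)).
  apply/esym/(etrans (measure_addE _ _ _)).
  rewrite mE PhiB// EFinD; congr (_ + _)%E.
  exact: leb_itvcoE.
have [ab|ba] := leP a b.
  exact: (eq_ind_r (fun z => (z < +oo)%E) (ltry (Phi b - Phi a)) (imE _ _ ab)).
have -> : `[a, b[%classic = set0 :> set R by rewrite set_itv_ge// bnd_simp -leNgt ltW.
by rewrite measure0.
Qed.

End lagrangian_of_eulerian.

(** * The derivative of [cumul_inv], and L~ as a section of M *)

Section lagrangian_of_eulerian_density.
Context {R : realType}.
Local Notation leb := (@lebesgue_measure R).
Local Notation Mclass :=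
  {mfun_ leb, (measurableTypeR R) >-> (measurableTypeR R)}.
Implicit Types (a b x xi : R).

Variables (u w : R -> R) (rho : Mclass) (mu : borel_measure R).
Hypothesis mur : radon mu.
Hypothesis mup : periodic_measure mu.
Hypothesis uw : is_prim u w.
Hypothesis up : forall x, u (x + 1) = u x.
Hypothesis rhop : ae_per rho.

Let g x := u x ^+ 2 + w x ^+ 2 + rho x ^+ 2.

Variable mus : {measure set (measurableTypeR R) -> \bar R}.
Variable N : set (measurableTypeR R).
Hypothesis mN : measurable N.
Hypothesis N0 : leb N = 0%E.
Hypothesis musN : mus (~` N) = 0%E.
Hypothesis muE : forall B : set (measurableTypeR R), measurable B ->
  mu B = (\int[leb]_(x in B) (g x)%:E + mus B)%E.

Local Notation y := (cumul_inv mu).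
Let c := 1 + fine (mu `[0, 1[%classic).
(* [y'] is the derivative of [y]: [y] maps [c dxi] to [mu + dx], whose density
   is [1 + g] off the null set [N] carrying the singular part of [mu]. *)
Let k x := (1 + g x)^-1 * \1_(~` N) x.
Let y' x := c * k (y x).

Let c0 : 0 < c. Proof. by rewrite ltr_wpDr// fine_ge0. Qed.

Let g0 x : 0 <= g x. Proof. by rewrite !addr_ge0 ?sqr_ge0. Qed.

Let g1 x : 0 < 1 + g x. Proof. by rewrite ltr_wpDr. Qed.

Let mrho : measurable_fun setT rho. Proof. exact: measurable_class. Qed.

Let mg : measurable_fun setT g.
Proof.
apply: measurable_funD; last exact: measurable_funX.
apply: measurable_funD; apply: measurable_funX; last exact: uw.1.1.
exact: (continuous_loc_int (is_prim_continuous uw)).1.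
Qed.

Let mg1 : measurable_fun setT (fun x : R => 1 + g x).
Proof. exact: measurable_funD. Qed.

Let mg1V : measurable_fun setT (fun x : R => (1 + g x)^-1).
Proof. by apply: ge0_measurable_funV => // x; exact: ltW. Qed.

Let mk : measurable_fun setT k.
Proof.
apply: measurable_funM => //; apply: measurable_indic; exact: measurableC.
Qed.

Let my : measurable_fun setT y.
Proof. exact: nondecreasing_measurable (cumul_inv_nd mur). Qed.

Let my' : measurable_fun setT y'.
Proof. by apply: measurable_funM => //; exact: measurableT_comp. Qed.

Let mc : measurable_fun setT (cst c : R -> R). Proof. by []. Qed.

Let k0 x : 0 <= k x.
Proof. by rewrite mulr_ge0// ?invr_ge0 ?ltW// indicE; case: (_ \in _). Qed.

(** Points of [N] against the others. The bounds on [U'] and [r] and the energy identity are all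
    checked through this dichotomy. *)
Let kg x : k x = 0 \/ k x * (1 + g x) = 1.
Proof.
rewrite /k indicE; case: (_ \in _); [right|left]; last by rewrite mulr0.
by rewrite mulr1 mulVf// gt_eqF.
Qed.

Let mEfin (f : R -> R) (B : set R) : measurable_fun setT f ->
  measurable_fun B (EFin \o f).
Proof. by move=> mf; apply/measurable_EFinP; exact: measurable_funTS. Qed.

Let image_setD (A : set (measurableTypeR R)) : measurable A -> A `<=` ~` N ->
  measure_add mu leb A = density leb mg1 A.
Proof.
move=> mA AN; apply: (etrans (measure_addE _ _ _)).
have mus0 : mus A = 0%E.
  apply/eqP; rewrite -measure_le0 -musN; apply: le_measure; rewrite ?inE//.
  exact: measurableC.
rewrite muE// mus0 adde0 /density.
transitivity (\int[leb]_(x in A) (g x)%:E + \int[leb]_(x in A) (1 : R)%:E)%E.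
  by congr (_ + _)%E; rewrite (integral_cst leb mA) mul1e.
rewrite -ge0_integralD//; last 2 first.
- by move=> x _; rewrite lee_fin.
- exact: mEfin.
apply: eq_integral => x _ /=.
by rewrite ger0_norm ?(ltW (g1 x))// -EFinD addrC.
Qed.

(** The integral of [y'] over the preimage of [B] is that of [k] over [B] against [mu + dx]. There
    [k] discards [N] and cancels the density [1 + g], leaving the Lebesgue measure of [B] minus [N],
    which is that of [B]. *)
Lemma cumul_inv_transports : transports y y'.
Proof.
split=> // [x|B mB]; first by rewrite mulr_ge0// ltW.
have mBN : measurable (B `&` ~` N).
  by apply: measurableI => //; exact: measurableC.
transitivity (\int[image_density my mc]_(x in B) (k x)%:E)%E; last first.
  rewrite ge0_integral_image_density//; apply: eq_integral => x _.
  by rewrite /= gtr0_norm// mulrC.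
rewrite (eq_measure_integral (measure_add mu leb)); last first.
  by move=> A mA _; exact: cumul_inv_image.
transitivity (\int[measure_add mu leb]_(x in B `&` ~` N) ((1 + g x)^-1)%:E)%E; last first.
  rewrite integral_mkcondr; apply: eq_integral => x _.
  by rewrite patchE /k indicE; case: ifP; rewrite ?mulr1 ?mulr0.
rewrite (eq_measure_integral (density leb mg1)); last first.
  by move=> A mA AB; apply: image_setD => // x /AB[].
rewrite (@ge0_integral_density _ (measurableTypeR R) R leb)//; last 2 first.
- by move=> x _; rewrite invr_ge0 ltW.
- exact: measurable_funTS.
transitivity (\int[leb]_(x in B `&` ~` N) (1 : R)%:E)%E; last first.
  by apply: eq_integral => x _; rewrite gtr0_norm// mulVf// gt_eqF.
rewrite (integral_cst leb mBN) mul1e.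
apply: (etrans (measureDI leb mB mN)); rewrite -setDE.
suff BN0 : leb (B `&` N) = 0%E by rewrite -[RHS]adde0; congr (_ + _)%E.
apply/eqP; rewrite -measure_le0 -N0; apply: le_measure; rewrite ?inE//.
exact: measurableI.
Qed.

Local Notation yy' := cumul_inv_transports.

Lemma cumul_inv_lift : lift_prim y y'.
Proof.
split; first exact: transports_is_prim yy' (cumul_inv_nd mur).
- by move=> x; case: yy'.
- exact: cumul_inv_add1.
Qed.

Let U := u \o y.
Let U' x := w (y x) * y' x.
Let nu x := c - y' x.
Let r x := rho (y x) * y' x.

Let mnu : measurable_fun setT nu. Proof. exact: measurable_funB. Qed.

Let mr : measurable_fun setT r.
Proof. by apply: measurable_funM => //; exact: measurableT_comp. Qed.

Let k1 x : k x <= 1.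
Proof. by have [->//|] := kg x; have := k0 x; have := g0 x; nra. Qed.

Let nu0 x : 0 <= nu x.
Proof. by rewrite subr_ge0 /y' ger_pMr. Qed.

Let bound (f : R -> R) x : `|f x| <= 1 + g x -> `|f x * (c * k x)| <= c.
Proof.
move=> fg; rewrite normrM (normrM c) (gtr0_norm c0) (ger0_norm (k0 x)).
have : `|f x| * k x <= 1.
  have [->|<-] := kg x; first by rewrite mulr0.
  by rewrite mulrC ler_wpM2l.
by move=> fk; rewrite mulrCA ger_pMr.
Qed.

Let sqr_bound (s t : R) : s ^+ 2 <= t -> `|s| <= 1 + t.
Proof. by move=> st; rewrite ler_norml; apply/andP; split; nra. Qed.

Let w_bound x : `|w x| <= 1 + g x.
Proof.
apply: sqr_bound; rewrite /g.
by have := sqr_ge0 (u x); have := sqr_ge0 (rho x); lra.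
Qed.

Let rho_bound x : `|rho x| <= 1 + g x.
Proof.
apply: sqr_bound; rewrite /g.
by have := sqr_ge0 (u x); have := sqr_ge0 (w x); lra.
Qed.

Lemma cumul_inv_lagr_prim : lagr_prim y y' U U' nu r.
Proof.
have [yp _ y1] := cumul_inv_lift.
have y'0 x : 0 <= y' x by rewrite mulr_ge0// ltW.
have py' : ae_per y' := is_prim_per yp y1.
split.
- exact: cumul_inv_lift.
- exact: (is_prim_comp yy' (cumul_inv_nd mur) uw).
- by move=> x; rewrite /U /= y1 up.
- exact: mnu.
- exact: mr.
- by apply: aeS py' => x; rewrite /nu => ->.
- apply: aeS2 py' (transport_ae yy' rhop) => x; rewrite /r y1 => ->.
  by move=> [->|->//]; rewrite !mulr0.
- exists c; apply: aeW => x; split; last exact: bound.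
  + by rewrite ger0_norm ?y'0// -subr_ge0; exact: nu0.
  + exact: bound.
  + by rewrite ger0_norm// /nu gerBl; exact: y'0.
- exact: aeW.
- by exists c => //; apply: aeW => x; rewrite /nu addrC subrK.
- apply: aeW => x; rewrite /nu /U' /r /U /y' /=.
  have [->|kE] := kg (y x); first by ring.
  (* Here [k * (1 + g) = 1], so [nu = y' * g] at [y x], and the identity is the definition of [g].
     In the case just closed, [y'], [U'] and [r] are all zero. *)
  have -> : c - c * k (y x) = c * k (y x) * g (y x).
    by rewrite -{1}(mulr1 c) -kE; ring.
  by rewrite /g; ring.
Qed.

Let mu_itv a b : (mu `[a, b]%classic < +oo)%E.
Proof. exact: mur (@segment_compact _ a b). Qed.

(** The absolute value of [rho] is at most [1 + g], whose integral over a segment is at most the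
    Lebesgue measure plus the [mu]-measure of it. *)
Let lrho : loc_int rho.
Proof.
apply: (le_loc_int (g := fun x => 1 + g x)) => //.
  by apply: aeW => x; rewrite (gtr0_norm (g1 x)).
split => // a b; apply/integrableP; split; first exact: mEfin.
have -> : (\int[leb]_(x in `[a, b]) `|(EFin \o (fun x : R => (1 + g x)%R)) x| =
    density leb mg1 `[a, b])%E by [].
apply: (@le_lt_trans _ _ (leb `[a, b]%classic + mu `[a, b]%classic)%E); last first.
  by rewrite lte_add_pinfty//; exact: leb_itv_lty.
have -> : density leb mg1 `[a, b] = (\int[leb]_(x in `[a, b]) (1 : R)%:E +
    \int[leb]_(x in `[a, b]) (g x)%:E)%E.
  rewrite -ge0_integralD//; last 2 first.
  - by move=> x _; exact: g0.
  - exact: mEfin.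
  by apply: eq_integral => x _ /=; rewrite gtr0_norm.
apply: leeD; first by rewrite (integral_cst leb) ?mul1e.
by rewrite muE ?leeDl.
Qed.

(** The constant [c = nu + y'] is pushed forward to [mu + dx] and [y'] to [dx]. Lebesgue measure can
    be cancelled on bounded intervals, where it is finite, and uniqueness of measures extends the
    equality. *)
Let muE_nu (B : set (measurableTypeR R)) : measurable B ->
  mu B = (\int[leb]_(x in y @^-1` B) (nu x)%:E)%E.
Proof.
move=> mB.
transitivity (image_density my mnu B); last first.
  by rewrite image_densityE; apply: eq_integral => x _; rewrite ger0_norm.
apply: measure_eq_itvco mB => a b; last exact: radon_itvco.
move=> ab; have mI : measurable (`[a, b[%classic : set (measurableTypeR R)).
  exact: measurable_itv.
have mJ : measurable (y @^-1` `[a, b[%classic) by exact: measurable_preimage.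
have lI : leb `[a, b[%classic \is a fin_num by rewrite leb_itvcoE.
have [_ _ y'0 yE] := yy'.
rewrite -(addeK (mu _) lI) -(addeK (image_density my mnu _) lI); congr (_ - _)%E.
transitivity (measure_add mu leb `[a, b[); first exact/esym/measure_addE.
rewrite -(cumul_inv_image mur mI) !image_densityE.
transitivity (\int[leb]_(x in y @^-1` `[a, b[) (`|nu x|)%:E +
    \int[leb]_(x in y @^-1` `[a, b[) (y' x)%:E)%E; last by rewrite -yE.
rewrite -ge0_integralD//; last 3 first.
- by apply: mEfin; exact: measurableT_comp.
- by move=> x _; exact: y'0.
- exact: mEfin.
apply: eq_integral => x _ /=; rewrite ger0_norm ?(ltW c0)// ger0_norm//.
by rewrite -EFinD /nu subrK.
Qed.

Lemma cumul_inv_calF : calF R (Lagrangian y U (ae_class nu) (ae_class r)).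
Proof. exact: lagr_prim_calF (lagr_prim_class cumul_inv_lagr_prim). Qed.

Lemma cumul_inv_eulerian_of :
  is_eulerian_of (Lagrangian y U (ae_class nu) (ae_class r))
    (Eulerian u rho mu).
Proof.
split => //.
- move=> B mB; apply: (etrans (muE_nu mB)).
  have mJ : measurable (y @^-1` B) by exact: measurable_preimage.
  apply: ae_eq_integral => //; try exact: mEfin.
    by apply: mEfin; exact: measurable_class.
  by apply: aeS (ae_classE mnu) => x -> _.
- by apply/loc_intP.
- move=> a b B mB _; rewrite (transport_Rintegral yy' mB)//.
  have mJ : measurable (y @^-1` B) by exact: measurable_preimage.
  apply: eq_ae_Rintegral => //; first exact: measurable_class.
  by apply: aeS (ae_classE mr) => x ->.
Qed.

Lemma cumul_inv_Ltilde :
  Ltilde (Eulerian u rho mu) = Lagrangian y U (ae_class nu) (ae_class r).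
Proof.
have [yp _ _] := cumul_inv_lift.
rewrite /Ltilde; congr Lagrangian; apply: eq_ae_class.
  by apply: aeS (wderivE yp) => x; rewrite /nu => <-.
by apply: aeS (wderivE yp) => x; rewrite /r => <-.
Qed.

End lagrangian_of_eulerian_density.

(** * The inverse maps and the orbit space *)

Section inverses.
Context {R : realType}.
Implicit Types (E : eulerian R) (X : lagrangian R).

Lemma LtildeP E : calD R E -> calF R (Ltilde E) /\ is_eulerian_of (Ltilde E) E.
Proof.
case: E => u rho mu [Hu Lrho mur mup [_ [mus [[N [mN N0 musN]] muE]]]].
have [up [w0 uw0 _]] := (H1_perP u).1 Hu.
have uw := is_prim_wderiv uw0.
have [_ _ rhop] := (Lp_per2P rho).1 Lrho.
rewrite (cumul_inv_Ltilde mur mup uw mN N0 musN muE).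
split; first exact: (cumul_inv_calF mur mup uw up rhop mN N0 musN muE).
exact: (cumul_inv_eulerian_of mur uw mN N0 musN muE).
Qed.

Lemma calF_calH X : calH R X -> calF R X. Proof. by case=> -[]. Qed.

Lemma calH_Pi X : calF R X -> calH R (Pi X).
Proof. by move=> /Pi_relabel[f [f' [_ ->]]]. Qed.

Lemma Pi_in_orbit X : calF R X -> relabel_orbit X (Pi X).
Proof. by move=> /Pi_relabel[f [f' [/bilip_calG Gf -> _]]]; exists f. Qed.

Lemma relabel_orbit_Pi X : calF R X -> relabel_orbit (Pi X) = relabel_orbit X.
Proof.
move=> /Pi_relabel[f [f' [ff' -> _]]]; exact: relabel_orbit_relabel ff'.
Qed.

Lemma mapM_inj_calH X1 X2 : calH R X1 -> calH R X2 -> mapM X1 = mapM X2 ->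
  X1 = X2.
Proof.
move=> HX1 HX2 E; apply: (calH_inj HX1 HX2 (mapMP (calF_calH HX1)).1).
by rewrite E; exact: (mapMP (calF_calH HX2)).1.
Qed.

Lemma mapM_orbit X Y : calF R X -> relabel_orbit X Y -> mapM Y = mapM X.
Proof. by move=> FX [f /calG_bilip[f' ff'] <-]; exact: mapM_relabel ff'. Qed.

Lemma mapM_Pi X : calF R X -> mapM (Pi X) = mapM X.
Proof. by move=> FX; exact: mapM_orbit (Pi_in_orbit FX). Qed.

Lemma calH_mapL E : calD R E -> calH R (mapL E).
Proof. by move=> /LtildeP[FE _]; exact: calH_Pi. Qed.

Lemma mapLK E : calD R E -> mapM (mapL E) = E.
Proof.
by move=> /LtildeP[FE EE]; rewrite /mapL mapM_Pi//; exact: mapM_eq.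
Qed.

(** Both sides lie in [calH] and have the same image [mapM X] under M, so injectivity concludes and
    [Ltilde (mapM X)] need not be computed. *)
Lemma mapMK X : calF R X -> mapL (mapM X) = Pi X.
Proof.
move=> FX; have [_ DX] := mapMP FX.
apply: (mapM_inj_calH (calH_mapL DX) (calH_Pi FX)).
exact: (etrans (mapLK DX) (esym (mapM_Pi FX))).
Qed.

Lemma Pi_id X : calH R X -> Pi X = X.
Proof.
move=> HX; have FX := calF_calH HX.
exact: (mapM_inj_calH (calH_Pi FX) HX (mapM_Pi FX)).
Qed.

(** M is constant on the orbit and injective on [calH], so the orbit meets [calH] at most once. *)
Lemma orbit_calH X : calF R X -> relabel_orbit X `&` calH R = [set Pi X].
Proof.
move=> FX; apply/seteqP; split=> [Y [XY HY]|_ ->] /=.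
  apply: (mapM_inj_calH HY (calH_Pi FX)).
  exact: (etrans (mapM_orbit FX XY) (esym (mapM_Pi FX))).
by split; [exact: Pi_in_orbit|exact: calH_Pi].
Qed.

End inverses.

Lemma set_bij_inverse {T1 T2 : Type} (A : set T1) (B : set T2)
    (f : T1 -> T2) (g : T2 -> T1) :
  set_fun A B f -> set_fun B A g -> (forall x, A x -> g (f x) = x) ->
  (forall y, B y -> f (g y) = y) -> set_bij A B f.
Proof.
move=> fAB gBA fK gK; split=> // [x1 x2 /set_mem A1 /set_mem A2 E|y By].
  by rewrite -(fK _ A1) E fK.
by exists (g y); [exact: gBA|exact: gK].
Qed.

Theorem theorem2p10 (R : realType) :
  (* M : F -> D is well defined *)
  (forall X, calF R X -> is_eulerian_of X (mapM X) /\ calD R (mapM X)) /\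
  (* L : D -> H and M : H -> D are invertible *)
  set_bij (calD R) (calH R) (@mapL R) /\
  set_bij (calH R) (calD R) (@mapM R) /\
  (forall X, calF R X -> mapL (mapM X) = Pi X) /\
  (forall E, calD R E -> mapM (mapL E) = E) /\
  (* Pi is a projection of F onto H, and Pi X is the unique element of H which
     is a relabeling of X *)
  set_fun (calF R) (calH R) (@Pi R) /\
  (forall X, calH R X -> Pi X = X) /\
  (forall X, calF R X -> relabel_orbit X `&` calH R = [set Pi X]) /\
  (* Pi induces a bijection between F/G and H *)
  (exists phi : set (lagrangian R) -> lagrangian R,
    set_bij (FmodG R) (calH R) phi /\
    forall X, calF R X -> phi (relabel_orbit X) = Pi X).
Proof.
have MH X : calH R X -> calD R (mapM X) by move=> /calF_calH/mapMP[].
have MK X : calH R X -> mapL (mapM X) = X.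
  by move=> HX; exact: (etrans (mapMK (calF_calH HX)) (Pi_id HX)).
have [phi phiP] : {phi : set (lagrangian R) -> lagrangian R &
    forall O, FmodG R O -> (O `&` calH R) (phi O)}.
  apply: (@choice _ _ (fun O Y => FmodG R O -> (O `&` calH R) Y)) => O.
  have [[X FX <-]|nO] := pselect (FmodG R O).
    by exists (Pi X) => _; rewrite (orbit_calH FX).
  (* An arbitrary value for sets that are not orbits; [phi] is constrained on [FmodG] alone. *)
  by exists (Lagrangian id (cst 0) (Mclass0 R) (Mclass0 R)).
have phiE X : calF R X -> phi (relabel_orbit X) = Pi X.
  move=> FX; have := phiP (relabel_orbit X) (ex_intro2 _ _ X FX erefl).
  by rewrite (orbit_calH FX).
split; first exact: mapMP.
split.
  exact: (set_bij_inverse (@calH_mapL R) MH (@mapLK R) MK).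
split.
  exact: (set_bij_inverse MH (@calH_mapL R) MK (@mapLK R)).
split; first exact: mapMK.
split; first exact: mapLK.
split; first exact: calH_Pi.
split; first exact: Pi_id.
split; first exact: orbit_calH.
exists phi; split=> //.
apply: (@set_bij_inverse _ _ _ _ phi (@relabel_orbit R)).
- by move=> _ [X FX <-]; rewrite (phiE _ FX); exact: calH_Pi.
- by move=> X /calF_calH FX; exists X.
- by move=> _ [X FX <-]; rewrite (phiE _ FX) (relabel_orbit_Pi FX).
- by move=> X HX; exact: (etrans (phiE _ (calF_calH HX)) (Pi_id HX)).
Qed.
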